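(* Let $D\subset\mathbb{R}^d$, $K$ and $V$ satisfy Assumption (A) of the context. Assume that $Y_0$ is a $D$-valued random variable with distribution $\mu_0$ and that $(B_t)_{t\ge0}$ is a Brownian motion independent of $Y_0$. For any $T>0$, there exists exactly one strong solution $Y_t$ on $[0,T]$ of the nonlinear equation $$Y_t=Y_0+\int_0^tP_{Y_s}\left(-\nabla K*\mu_s(Y_s)-\nabla V(Y_s)\right)ds,\qquad\mu_t=\mathrm{Law}(Y_t).$$ Moreover, if $Y_t^i$ ($i=1,2$) are two solutions of this equation with initial data $Y_0^i$ respectively, then $$\mathbb{E}\left[|Y_t^1-Y_t^2|^2\right]\le\left(1-2t(\lambda_K^-+\lambda_V^-)e^{-2t(\lambda_K^-+\lambda_V^-)}\right)\mathbb{E}\left[|Y_0^1-Y_0^2|^2\right]\qquad\text{for all }t\in[0,T].$$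
   Context: Assumption (A), with $d\ge 2$: (1) $D\subset\mathbb{R}^d$ is a closed, bounded, convex domain with $C^1$ boundary $\partial D$; $n(x)$ denotes the outward unit normal at $x\in\partial D$; $D-D:=\{x-y : x,y\in D\}$. (2) $K(x)=K(-x)$ for all $x\in\mathbb{R}^d$. (3) $K\in C^1(D-D)$ is $\lambda_K$-convex on $D-D$ for some $\lambda_K\in\mathbb{R}$. (4) $V\in C^1(D)$ is $\lambda_V$-convex on $D$ for some $\lambda_V\in\mathbb{R}$. Here $f\in C^1(U)$ is $\lambda$-convex on a convex set $U$ if $f(y)\ge f(x)+\langle\nabla f(x),y-x\rangle+\frac{\lambda}{2}|y-x|^2$ for all $x,y\in U$; this implies $\langle\nabla f(x)-\nabla f(y),x-y\rangle\ge\lambda|x-y|^2$. Put $\lambda_K^-:=\min\{0,\lambda_K\}$ and $\lambda_V^-:=\min\{0,\lambda_V\}$. For a probability measure $\mu$ on $D$, $\nabla K*\mu(x):=\int_D\nabla K(x-y)\,d\mu(y)$. For $x\in D$, $v\in\mathbb{R}^d$: $P_x(v)=v$ if $x$ is interior to $D$, or if $x\in\partial D$ and $v\cdot n(x)\le0$; otherwise $P_x(v)$ is the orthogonal projection of $v$ onto the tangent plane of $\partial D$ at $x$, i.e. $v-(v\cdot n(x))n(x)$. Solutions $Y$ are $D$-valued processes with (absolutely) continuous paths; the only randomness in the equation comes from the initial datum $Y_0$ (the Brownian motion does not enter the equation). *)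

(* Defs.v *)
From HB Require Import structures.
From mathcomp Require Import all_boot all_order all_algebra.
From mathcomp Require Import all_classical all_reals all_analysis.

Set Implicit Arguments.
Unset Strict Implicit.
Unset Printing Implicit Defensive.

Import Order.TTheory GRing.Theory Num.Theory.
Import numFieldNormedType.Exports.

Local Open Scope classical_set_scope.
Local Open Scope ring_scope.

(* The library norm on 'rV[R]_d is the sup norm, so the Euclidean structure is
   spelled out; the topology is the same. *)
Definition dotp (R : realType) (d : nat) (u v : 'rV[R]_d) : R :=
  \sum_(i < d) u 0 i * v 0 i.

Definition enorm (R : realType) (d : nat) (u : 'rV[R]_d) : R :=
  Num.sqrt (dotp u u).

Definition gradient (R : realType) (d : nat) (f : 'rV[R]_d -> R)
    (x : 'rV[R]_d) : 'rV[R]_d :=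
  \row_(i < d) 'D_(delta_mx 0 i) f x.

(* f is C^1 on the (typically closed) set U with gradient g: f is
   differentiable in the interior of U, and f and its gradient extend
   continuously up to the boundary.  When U is the closure of its interior,
   g is uniquely determined on U. *)
Definition C1_with_gradient (R : realType) (d : nat) (U : set 'rV[R]_d)
    (f : 'rV[R]_d -> R) (g : 'rV[R]_d -> 'rV[R]_d) : Prop :=
  [/\ {within U, continuous f},
      {within U, continuous g}
    & forall x, U° x -> differentiable f x /\ g x = gradient f x].

Definition C1_on (R : realType) (d : nat) (U : set 'rV[R]_d)
    (f : 'rV[R]_d -> R) : Prop :=
  exists g, C1_with_gradient U f g.

(* Meaningful on U when C1_on U f; junk elsewhere. *)
Definition grad_on (R : realType) (d : nat) (U : set 'rV[R]_d)
    (f : 'rV[R]_d -> R) : 'rV[R]_d -> 'rV[R]_d :=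
  xget (fun=> 0) [set g | C1_with_gradient U f g].

Definition lambda_convex (R : realType) (d : nat) (lam : R)
    (U : set 'rV[R]_d) (f : 'rV[R]_d -> R) : Prop :=
  forall x y, U x -> U y ->
    f x + dotp (grad_on U f x) (y - x) + lam / 2 * enorm (y - x) ^+ 2 <= f y.

Definition boundary (R : realType) (d : nat) (D : set 'rV[R]_d) :
  set 'rV[R]_d := closure D `\` D°.

(* Near x, rho is C^1 and D = {rho <= 0}, with nonvanishing gradient at x. *)
Definition local_defining_function (R : realType) (d : nat)
    (D : set 'rV[R]_d) (x : 'rV[R]_d) (rho : 'rV[R]_d -> R) : Prop :=
  [/\ \forall y \near x,
        differentiable rho y /\ {for y, continuous (gradient rho)},
      gradient rho x != 0
    & \forall y \near x, D y <-> rho y <= 0].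

Definition C1_boundary (R : realType) (d : nat) (D : set 'rV[R]_d) : Prop :=
  forall x, boundary D x -> exists rho, local_defining_function D x rho.

(* The normalized gradient at x of a defining function; it does not depend on
   which defining function is used. *)
Definition outward_normal (R : realType) (d : nat) (D : set 'rV[R]_d)
    (x : 'rV[R]_d) : 'rV[R]_d :=
  xget 0 [set n | exists rho, local_defining_function D x rho /\
                  n = (enorm (gradient rho x))^-1 *: gradient rho x].

Definition tangential_proj (R : realType) (d : nat) (D : set 'rV[R]_d)
    (x v : 'rV[R]_d) : 'rV[R]_d :=
  let n := outward_normal D x in
  if `[< boundary D x /\ 0 < dotp v n >] then v - dotp v n *: n else v.

Definition diff_set (R : realType) (d : nat) (D : set 'rV[R]_d) :
  set 'rV[R]_d := [set x - y | x in D & y in D].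

Definition assumption_A (R : realType) (d : nat) (D : set 'rV[R]_d)
    (K V : 'rV[R]_d -> R) (lamK lamV : R) : Prop :=
  [/\ [/\ closed D, bounded_set D, convex_set D, D° !=set0 & C1_boundary D],
      forall x, K x = K (- x),
      C1_on (diff_set D) K /\ lambda_convex lamK (diff_set D) K
    & C1_on D V /\ lambda_convex lamV D V].

(* R^d with its Borel sigma-algebra. *)
Notation borel_rV R d := (g_sigma_algebraType (@open 'rV[R]_d)).

Definition grad_conv (R : realType) (d : nat) (D : set 'rV[R]_d)
    (K : 'rV[R]_d -> R) (mu : probability (borel_rV R d) R)
    (x : 'rV[R]_d) : 'rV[R]_d :=
  \row_(i < d) \int[mu]_(y in (D : set (borel_rV R d)))
                 (grad_on (diff_set D) K (x - (y : 'rV[R]_d)) 0 i).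

Definition velocity (R : realType) (d : nat) (D : set 'rV[R]_d)
    (K V : 'rV[R]_d -> R) (mu : probability (borel_rV R d) R)
    (x : 'rV[R]_d) : 'rV[R]_d :=
  tangential_proj D x (- grad_conv D K mu x - grad_on D V x).

(* Processes are indexed by all of R; only times in [0, T] are constrained. *)
Definition solution (R : realType) (d : nat) (D : set 'rV[R]_d)
    (K V : 'rV[R]_d -> R) (disp : measure_display)
    (Omega : measurableType disp) (P : probability Omega R) (T : R)
    (Y0 : {RV P >-> borel_rV R d}) (Y : R -> {RV P >-> borel_rV R d}) : Prop :=
  let b s w : 'rV[R]_d := velocity D K V (distribution P (Y s)) (Y s w) in
  [/\ forall t w, t \in `[0, T] -> D (Y t w),
      forall w, {within `[0, T], continuous (fun t => Y t w : 'rV[R]_d)},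
      {ae P, forall w, forall i : 'I_d,
        lebesgue_measure.-integrable `[0, T] (fun s => (b s w 0 i)%:E)}
    & {ae P, forall w, forall t, t \in `[0, T] ->
        (Y t w : 'rV[R]_d) = (Y0 w : 'rV[R]_d) +
          \row_(i < d) \int[lebesgue_measure]_(s in `[0, t]) (b s w 0 i)}].

(* The sigma-algebra generated by the vectors X i, i in J. *)
Definition generated_by (R : realType) (d : nat) (Omega I : Type)
    (J : set I) (X : I -> Omega -> 'rV[R]_d) : set (set Omega) :=
  <<s \bigcup_(i in J) preimage_set_system setT (X i)
        (@measurable _ (borel_rV R d)) >>.

Definition independent_systems (R : realType) (disp : measure_display)
    (Omega : measurableType disp) (P : probability Omega R)
    (F G : set (set Omega)) : Prop :=
  forall A B, F A -> G B -> P (A `&` B) = (P A * P B)%E.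

Definition increment (R : realType) (d : nat) (disp : measure_display)
    (Omega : measurableType disp) (P : probability Omega R)
    (B : R -> {RV P >-> borel_rV R d}) (s t : R) (w : Omega) : 'rV[R]_d :=
  (B t w : 'rV[R]_d) - (B s w : 'rV[R]_d).

(* Standard d-dimensional Brownian motion started at 0; normal_prob takes the
   standard deviation as its second parameter. *)
Definition brownian_motion (R : realType) (d : nat) (disp : measure_display)
    (Omega : measurableType disp) (P : probability Omega R)
    (B : R -> {RV P >-> borel_rV R d}) : Prop :=
  [/\ {ae P, forall w, (B 0 w : 'rV[R]_d) = 0},
      {ae P, forall w,
        {within `[0, +oo[, continuous (fun t => B t w : 'rV[R]_d)}},
      forall s t, 0 <= s -> s < t ->
        independent_systems P (generated_by `[0, s] (fun r => B r))
          (generated_by [set: unit] (fun=> increment B s t))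
    & forall s t, 0 <= s -> s < t ->
        forall A : 'I_d -> set (measurableTypeR R),
          (forall i, measurable (A i)) ->
          P [set w | forall i, A i (increment B s t w 0 i)] =
          (\prod_(i < d) normal_prob 0 (Num.sqrt (t - s)) (A i))%E].

(* The filtration generated by Y0 and B, augmented by the null sets. *)
Definition augmented_filtration (R : realType) (d : nat)
    (disp : measure_display) (Omega : measurableType disp)
    (P : probability Omega R) (Y0 : {RV P >-> borel_rV R d})
    (B : R -> {RV P >-> borel_rV R d}) (t : R) : set (set Omega) :=
  <<s generated_by [set: unit] (fun=> Y0) `|`
      generated_by `[0, t] (fun r => B r) `|`
      [set N | P.-negligible N] >>.

Definition strong_solution (R : realType) (d : nat) (D : set 'rV[R]_d)
    (K V : 'rV[R]_d -> R) (disp : measure_display)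
    (Omega : measurableType disp) (P : probability Omega R) (T : R)
    (Y0 : {RV P >-> borel_rV R d}) (B Y : R -> {RV P >-> borel_rV R d}) :
    Prop :=
  solution D K V T Y0 Y /\
  forall t, t \in `[0, T] -> forall A : set (borel_rV R d), measurable A ->
    augmented_filtration Y0 B t (Y t @^-1` A).

(* Main.v *)
Require Import Defs.
From HB Require Import structures.
From mathcomp Require Import all_boot all_order all_algebra.
From mathcomp Require Import all_classical all_reals all_analysis.
From mathcomp Require Import measurable_realfun.
From mathcomp Require Import lra ring.

Set Implicit Arguments.
Unset Strict Implicit.
Unset Printing Implicit Defensive.

Import Order.TTheory GRing.Theory Num.Theory.
Import numFieldNormedType.Exports.

Local Open Scope classical_set_scope.
Local Open Scope ring_scope.

(* Write b(Y)(x) for the unprojected velocity at x when the law is that of Y.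
   Since grad K is odd, exchanging two independent copies shows that b is
   one-sided Lipschitz in mean, E<b(Y)Y - b(Y')Y', Y - Y'> <= L E|Y - Y'|^2,
   with L the rate of the theorem.  Projecting onto the tangent half-space only
   decreases the pairing of the velocity with Y_s - z for z in D, so a solution
   satisfies, over short times, a variational inequality whose error is
   arbitrarily small relative to the elapsed time; the one-sided bound and a
   discrete Gronwall argument then give contraction and uniqueness.
   The same inequality, with a vanishing additive slack, holds for the
   Euler scheme with nearest-point projection on D: hence the scheme is Cauchy,
   its limit satisfies the inequality without slack, and comparing the limit with
   segments along admissible directions identifies its right derivative with the
   projected velocity. *)

(** * Euclidean structure on row vectors *)

(** Two features rule out a Picard iteration: the projected field jumps at the boundary, and the
    gradients are only continuous. The variational inequality avoids the jump, since it mentions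
    only the unprojected drift; continuity enters through bounds of the form e + A * dist^2, whose
    square can be averaged over the law. The exchange of copies needs both points random, so the
    one-sided bound with different laws holds only in mean. Hence each comparison runs twice: in
    mean square, which brings the laws together, then along every path with the difference of laws
    as a small error. The second pass makes the scheme converge at every sample point, uniformly in
    time, and gives uniqueness with one exceptional set for all times. The quantifier order k, h0,
    eps is dictated by Gronwall: k is an error rate accumulated over the total time, h0 limits the
    step, and eps, paid once per step, must be small compared with the inverse of the number of
    steps. The factor of the theorem comes from e^a <= 1 + a e^a with a = -2t(lambda_K^- +
    lambda_V^-). *)

Section Euclidean.
Context {R : realType} {d : nat}.
Implicit Types (u v w : 'rV[R]_d) (a : R).

Lemma dotpC u v : dotp u v = dotp v u.
Proof. by apply: eq_bigr => i _; rewrite mulrC. Qed.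

Lemma dotpDl u v w : dotp (u + v) w = dotp u w + dotp v w.
Proof. by rewrite -big_split; apply: eq_bigr => i _; rewrite mxE mulrDl. Qed.

Lemma dotpZl a u w : dotp (a *: u) w = a * dotp u w.
Proof. by rewrite /dotp mulr_sumr; apply: eq_bigr => i _; rewrite mxE mulrA. Qed.

Lemma dotpNl u w : dotp (- u) w = - dotp u w.
Proof. by rewrite -scaleN1r dotpZl mulN1r. Qed.

Lemma dotpDr u v w : dotp w (u + v) = dotp w u + dotp w v.
Proof. by rewrite ![dotp w _]dotpC dotpDl. Qed.

Lemma dotpZr a u w : dotp w (a *: u) = a * dotp w u.
Proof. by rewrite ![dotp w _]dotpC dotpZl. Qed.

Lemma dotpNr u w : dotp w (- u) = - dotp w u.
Proof. by rewrite ![dotp w _]dotpC dotpNl. Qed.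

Lemma dotp0l u : dotp 0 u = 0.
Proof. by rewrite -(scale0r 0) dotpZl mul0r. Qed.

Lemma dotp0r u : dotp u 0 = 0.
Proof. by rewrite dotpC dotp0l. Qed.

Definition dotpE := (dotpDl, dotpDr, dotpNl, dotpNr, dotpZl, dotpZr).

Lemma dotp_ge0 u : 0 <= dotp u u.
Proof. by apply: sumr_ge0 => i _; rewrite -expr2 sqr_ge0. Qed.

Lemma enorm_ge0 u : 0 <= enorm u. Proof. exact: sqrtr_ge0. Qed.

Lemma enorm_sqr u : enorm u ^+ 2 = dotp u u.
Proof. by rewrite sqr_sqrtr// dotp_ge0. Qed.

Lemma normr_coord_le_enorm u (i : 'I_d) : `|u 0 i| <= enorm u.
Proof.
rewrite -sqrtr_sqr ler_wsqrtr// /dotp (bigD1 i)//= -expr2 lerDl.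
by apply: sumr_ge0 => j _; rewrite -expr2 sqr_ge0.
Qed.

Lemma dotp_eq0 u : dotp u u = 0 -> u = 0.
Proof.
move=> u0; apply/rowP => i; rewrite mxE; apply/eqP; rewrite -normr_eq0 eq_le normr_ge0 andbT.
by rewrite (le_trans (normr_coord_le_enorm u i))// /enorm u0 sqrtr0.
Qed.

Lemma enorm0 : enorm (0 : 'rV[R]_d) = 0.
Proof. by rewrite /enorm dotp0l sqrtr0. Qed.

Lemma enormN u : enorm (- u) = enorm u.
Proof. by rewrite /enorm dotpNl dotpNr opprK. Qed.

Lemma enormB u v : enorm (u - v) = enorm (v - u).
Proof. by rewrite -enormN opprB. Qed.

Lemma enormZ a u : enorm (a *: u) = `|a| * enorm u.
Proof. by rewrite /enorm dotpZl dotpZr mulrA -expr2 sqrtrM ?sqr_ge0// sqrtr_sqr. Qed.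

Lemma dotp_sqr_le u v : dotp u v ^+ 2 <= dotp u u * dotp v v.
Proof.
have [v0|v0] := eqVneq (dotp v v) 0.
  by rewrite (dotp_eq0 v0) !dotp0r expr0n mulr0.
have vp : 0 < dotp v v by rewrite lt0r v0 dotp_ge0.
have := dotp_ge0 (dotp v v *: u - dotp u v *: v).
rewrite !dotpE (dotpC v u) => h.
rewrite -(ler_pM2l vp) -subr_ge0; apply: le_trans h _.
by rewrite le_eqVlt; apply/orP; left; apply/eqP; ring.
Qed.

Lemma dotp_le u v : `|dotp u v| <= enorm u * enorm v.
Proof.
by rewrite -sqrtrM ?dotp_ge0// -sqrtr_sqr ler_wsqrtr// dotp_sqr_le.
Qed.

Lemma dotp_le_enorm u v : dotp u v <= enorm u * enorm v.
Proof. exact: le_trans (ler_norm _) (dotp_le u v). Qed.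

Lemma enormD u v : enorm (u + v) <= enorm u + enorm v.
Proof.
rewrite -(@ler_pXn2r _ 2)// ?nnegrE ?enorm_ge0 ?addr_ge0 ?enorm_ge0//.
rewrite sqrrD !enorm_sqr !dotpE (dotpC v u).
have := dotp_le_enorm u v; lra.
Qed.

Lemma enorm_sqrD u v : enorm (u + v) ^+ 2 <= 2 * enorm u ^+ 2 + 2 * enorm v ^+ 2.
Proof.
rewrite !enorm_sqr !dotpE (dotpC v u).
have := dotp_ge0 (u - v); rewrite !dotpE (dotpC v u); lra.
Qed.

Lemma mx_norm_le_enorm u : `|u| <= enorm u.
Proof.
rewrite [leLHS]/Num.norm/= mx_normrE; apply/bigmax_leP; split; first exact: enorm_ge0.
by move=> [i j] _ /=; rewrite (ord1 i); exact: normr_coord_le_enorm.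
Qed.

Lemma normr_coord_le u (i : 'I_d) : `|u 0 i| <= `|u|.
Proof.
by rewrite [leRHS]/Num.norm/= mx_normrE (le_bigmax _ (fun i : 'I_1 * 'I_d => `|u i.1 i.2|) (0, i)).
Qed.

Lemma enorm_le_bound u a : (forall i, `|u 0 i| <= a) -> 0 <= a ->
  enorm u <= d%:R * a.
Proof.
move=> ua a0; rewrite -(@ler_pXn2r _ 2)// ?nnegrE ?enorm_ge0 ?mulr_ge0//.
rewrite enorm_sqr /dotp.
apply: (@le_trans _ _ (\sum_(i < d) a ^+ 2)).
  apply: ler_sum => i _; rewrite -expr2 -real_normK ?num_real//.
  by rewrite ler_pXn2r// nnegrE.
rewrite sumr_const card_ord -[leLHS]mulr_natl exprMn; apply: ler_wpM2r; first exact: sqr_ge0.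
by rewrite -natrX ler_nat; case: (d) => // n; rewrite expnS expn1 leq_pmull.
Qed.

Lemma enorm_le_mx_norm u : enorm u <= d%:R * `|u|.
Proof. by apply: enorm_le_bound => // i; exact: normr_coord_le. Qed.

Lemma dotp_delta u (i : 'I_d) : dotp u (delta_mx 0 i) = u 0 i.
Proof.
rewrite /dotp (bigD1 i)//= mxE !eqxx mulr1 big1 ?addr0// => j ji.
by rewrite mxE (negbTE ji) andbF mulr0.
Qed.

Lemma nbhs_enormP (x : 'rV[R]_d) (A : set 'rV[R]_d) :
  nbhs x A <-> exists2 e, 0 < e & forall y, enorm (y - x) < e -> A y.
Proof.
split.
- move=> /nbhs_ballP[e /= e0 xA]; exists e => // y yx; apply: xA.
  rewrite -ball_normE /= -normrN opprB.
  exact: le_lt_trans (mx_norm_le_enorm _) yx.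
(* Dividing by [d.+1] instead of [d] keeps the radius meaningful for d = 0. *)
- move=> [e e0 xA]; apply/nbhs_ballP; exists (e / d.+1%:R) => /=.
    by rewrite divr_gt0.
  move=> y; rewrite -ball_normE /= => yx; apply: xA; rewrite enormB.
  apply: le_lt_trans (enorm_le_mx_norm _) _.
  move: yx; rewrite ltr_pdivlMr// => yx; apply: le_lt_trans yx.
  by rewrite mulrC ler_wpM2l// ler_nat.
Qed.

Lemma interior_enormP (A : set 'rV[R]_d) x :
  A° x <-> exists2 e, 0 < e & forall y, enorm (y - x) < e -> A y.
Proof. exact: nbhs_enormP. Qed.

Lemma within_continuous_enormP (W : normedModType R) (A : set 'rV[R]_d)
    (f : 'rV[R]_d -> W) :
  {within A, continuous f} <->
  forall x, A x -> forall e, 0 < e -> exists2 r, 0 < r &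
    forall y, A y -> enorm (y - x) < r -> `|f y - f x| < e.
Proof.
rewrite subspace_continuousP; split => fc x Ax.
- move=> e e0; have /cvgrPdist_lt/(_ e e0) := fc x Ax.
  move=> /nbhs_enormP[r r0 xr]; exists r => // y Ay yx.
  by rewrite distrC; apply: xr.
- apply/cvgrPdist_lt => e e0; have [r r0 xr] := fc x Ax e e0.
  apply/nbhs_enormP; exists r => // y yx Ay; rewrite distrC.
  exact: xr.
Qed.

Lemma within_continuous_enorm (A : set 'rV[R]_d) (f : 'rV[R]_d -> 'rV[R]_d) :
  {within A, continuous f} ->
  forall x, A x -> forall e, 0 < e -> exists2 r, 0 < r &
    forall y, A y -> enorm (y - x) < r -> enorm (f y - f x) < e.
Proof.
move=> /within_continuous_enormP fc x Ax e e0.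
have ed : 0 < e / d.+1%:R by rewrite divr_gt0.
have [r r0 xr] := fc x Ax _ ed; exists r => // y Ay yx.
apply: le_lt_trans (enorm_le_mx_norm _) _.
have := xr y Ay yx; rewrite ltr_pdivlMr// => h; apply: le_lt_trans h.
by rewrite mulrC ler_wpM2l// ler_nat.
Qed.

Lemma enorm_within_continuous (A : set 'rV[R]_d) (f : 'rV[R]_d -> 'rV[R]_d) :
  (forall x, A x -> forall e, 0 < e -> exists2 r, 0 < r &
    forall y, A y -> enorm (y - x) < r -> enorm (f y - f x) < e) ->
  {within A, continuous f}.
Proof.
move=> h; apply/within_continuous_enormP => x Ax e e0.
have [r r0 xr] := h x Ax e e0; exists r => // y Ay yx.
exact: le_lt_trans (mx_norm_le_enorm _) (xr y Ay yx).
Qed.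

Lemma enorm_lipschitz u v : `|enorm u - enorm v| <= enorm (u - v).
Proof.
rewrite ler_norml; have := enormD (u - v) v; have := enormD (v - u) u.
by rewrite !subrK (enormB v u) => *; apply/andP; split; lra.
Qed.

Lemma enorm_continuous : continuous (@enorm R d).
Proof.
move=> x; apply: (proj2 (@cvgrPdist_lt _ _ _ (nbhs x) _ _ _)) => e e0.
apply/nbhs_enormP; exists e => // y yx.
by apply: le_lt_trans (enorm_lipschitz _ _) _; rewrite enormB.
Qed.

Lemma compact_unif_enorm (A : set 'rV[R]_d) (g : 'rV[R]_d -> 'rV[R]_d) :
  compact A -> {within A, continuous g} ->
  forall e, 0 < e -> exists2 r, 0 < r & forall p q, A p -> A q ->
    enorm (p - q) < r -> enorm (g p - g q) < e.
Proof.
move=> /compact_near_coveringP cA gc e e0.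
(* Heine-Cantor as a near covering: the parameter of the filter is the modulus r, tending to 0 from
   the right. *)
have := cA R (0^'+) (fun r p => A p -> forall q, A q -> enorm (p - q) < r -> enorm (g p - g q) < e).
have near_r : forall x, A x -> \forall x' \near x & i \near 0^'+,
    A x' -> forall q, A q -> enorm (x' - q) < i -> enorm (g x' - g q) < e.
  move=> x Ax; have e2 : 0 < e / 2 by rewrite divr_gt0.
  have [r r0 xr] := within_continuous_enorm gc Ax e2.
  exists ([set y | enorm (y - x) < r / 2], [set i : R | i < r / 2]).
    split => /=.
      by apply/nbhs_enormP; exists (r / 2) => //; rewrite divr_gt0.
    by apply: nbhs_right_lt; rewrite divr_gt0.
  move=> [y i] /= [yx ir] Ay q Aq yq.
  have h1 := xr y Ay _; have h2 := xr q Aq _.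
  have -> : g y - g q = (g y - g x) + (g x - g q) by rewrite addrA subrK.
  apply: le_lt_trans (enormD _ _) _; rewrite (enormB (g x)).
  rewrite [e]splitr ltrD//; first by apply: h1; lra.
  apply: h2; have -> : q - x = (q - y) + (y - x) by rewrite addrA subrK.
  apply: le_lt_trans (enormD _ _) _; rewrite enormB; lra.
move=> /(_ _ near_r) h.
have : \forall r \near 0^'+, 0 < r /\ A `<=` (fun p => A p ->
    forall q, A q -> enorm (p - q) < r -> enorm (g p - g q) < e).
  by near=> r; split; near: r => //; exact: nbhs_right_gt.
move=> /filter_ex[r [r0 hr]]; exists r => // p q Ap Aq; exact: hr.
Unshelve. all: by end_near. Qed.

Lemma compact_enorm_bounded (A : set 'rV[R]_d) (g : 'rV[R]_d -> 'rV[R]_d) :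
  compact A -> {within A, continuous g} ->
  exists2 M, 0 <= M & forall p, A p -> enorm (g p) <= M.
Proof.
move=> cA gc.
have [A0|/set0P/negP/negPn/eqP A0] := pselect (A !=set0); last first.
  by exists 0 => // p; rewrite A0.
have [|c cA' h] := @EVT_max_rV R d (fun x => enorm (g x)) A A0 cA.
  move=> x; apply: continuous_comp; [exact: gc|exact: enorm_continuous].
by exists (enorm (g c)); [exact: enorm_ge0|move=> p Ap; apply: h; rewrite inE].
Qed.

(* A quadratic majorant of the modulus of continuity: unlike the modulus
   itself, it can be integrated against a second moment. *)
Lemma compact_quadratic_modulus (A : set 'rV[R]_d) (g : 'rV[R]_d -> 'rV[R]_d) :
  compact A -> {within A, continuous g} ->
  forall e, 0 < e -> exists2 M, 0 <= M & forall p q, A p -> A q ->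
    enorm (g p - g q) <= e + M * enorm (p - q) ^+ 2.
Proof.
move=> cA gc e e0.
have [r r0 hr] := compact_unif_enorm cA gc e0.
have [B B0 hB] := compact_enorm_bounded cA gc.
(* Beyond distance r the trivial bound 2B is at most 2B |p - q|^2 / r^2. *)
exists (2 * B / r ^+ 2); first by apply: divr_ge0; rewrite ?sqr_ge0 ?mulr_ge0.
move=> p q Ap Aq; have [pq|pq] := ltP (enorm (p - q)) r.
  apply: le_trans (ltW (hr _ _ Ap Aq pq)) _; rewrite lerDl mulr_ge0 ?sqr_ge0//.
  by apply: divr_ge0; rewrite ?sqr_ge0 ?mulr_ge0.
apply: (@le_trans _ _ (2 * B)).
  apply: le_trans (enormD _ _) _; rewrite enormN.
  by have := hB _ Ap; have := hB _ Aq; lra.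
have : 2 * B * 1 <= 2 * B / r ^+ 2 * enorm (p - q) ^+ 2.
  rewrite mulr1 mulrAC ler_pdivlMr ?exprn_gt0//; apply: ler_wpM2l.
    exact: mulr_ge0.
  by rewrite ler_pXn2r// nnegrE ?enorm_ge0// ltW.
by lra.
Qed.

End Euclidean.

(** * Convex geometry: normals and nearest points *)

Section Gradient.
Context {R : realType} {d : nat}.
Implicit Types (f rho : 'rV[R]_d -> R) (x v : 'rV[R]_d).

Lemma diff_gradient f x v : differentiable f x ->
  'D_v f x = dotp (gradient f x) v.
Proof.
move=> fx; rewrite deriveE// {1}(row_sum_delta v) linear_sum /dotp.
by apply: eq_bigr => i _; rewrite linearZ /= mxE -deriveE// mulrC.
Qed.

Lemma gradient_expansion f x v : differentiable f x ->
  forall e, 0 < e -> exists2 r, 0 < r & forall t, 0 < t -> t < r ->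
    `|f (x + t *: v) - f x - t * dotp (gradient f x) v| <= e * t.
Proof.
move=> fx e e0; have := @diff_derivable _ _ _ f x v fx.
rewrite /derivable => /cvgrPdist_lt/(_ e e0).
rewrite -/(derive f x v) diff_gradient//.
move=> [r /= r0 hr]; exists r => // t t0 tr.
have /hr : ball_ [eta Num.norm] 0 r t by rewrite /ball_ /= sub0r normrN gtr0_norm.
move=> /(_ (lt0r_neq0 t0)) /ltW h.
have -> : f (x + t *: v) - f x - t * dotp (gradient f x) v =
    - (t * (dotp (gradient f x) v - t^-1 *: (f (t *: v + x) - f x))).
  rewrite -[_ *: (_ - _)]/(_ * _) mulrBr mulVKf ?gt_eqF// (addrC x); ring.
by rewrite normrN normrM gtr0_norm// mulrC ler_pM2r.
Qed.

End Gradient.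

Section ConvexGeometry.
Context {R : realType} {d : nat}.
Implicit Types (D U : set 'rV[R]_d) (x y z v : 'rV[R]_d).

Lemma convex_segment D x y t : convex_set D -> D x -> D y -> 0 <= t -> t <= 1 ->
  D (x + t *: (y - x)).
Proof.
move=> cD Dx Dy t0 t1.
have := cD y x (Itv01 t0 t1); rewrite !inE => /(_ Dy Dx).
have -> : conv (Itv01 t0 t1) (y : convex_lmodType _) x = t *: y + (1 - t) *: x by [].
congr (D _); rewrite scalerBr scalerBl scale1r; apply/rowP => i; rewrite !mxE; ring.
Qed.

Lemma convex_diff_set D : convex_set D -> convex_set (diff_set D).
Proof.
move=> cD x y l; rewrite !inE => -[x1 Dx1 [x2 Dx2 <-]] [y1 Dy1 [y2 Dy2 <-]].
exists (x1 + (1 - l%:num) *: (y1 - x1)).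
  by apply: convex_segment => //; rewrite ?subr_ge0// lerBlDr lerDl.
exists (x2 + (1 - l%:num) *: (y2 - x2)).
  by apply: convex_segment => //; rewrite ?subr_ge0// lerBlDr lerDl.
have -> : conv l (x1 - x2 : convex_lmodType _) (y1 - y2) =
  l%:num *: (x1 - x2) + (1 - l%:num) *: (y1 - y2) by [].
by apply/rowP => i; rewrite !mxE; ring.
Qed.

Lemma compact_diff_set D : compact D -> compact (diff_set D).
Proof.
move=> cD; have -> : diff_set D = (fun p : 'rV[R]_d * 'rV[R]_d => p.1 - p.2) @` (D `*` D).
  apply/seteqP; split => [_ [x Dx [y Dy <-]]|_ [[x y] [/= Dx Dy] <-]].
    by exists (x, y).
  by exists x => //; exists y.
apply: continuous_compact; last exact: compact_setX.
apply: continuous_subspaceT => -[x y]; apply: cvgB; [exact: cvg_fst|exact: cvg_snd].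
Qed.

Lemma diff_setN D x : diff_set D x -> diff_set D (- x).
Proof. by move=> [y Dy [z Dz <-]]; exists z => //; exists y => //; rewrite opprB. Qed.

Lemma interior_diff_set0 D : D° !=set0 -> (diff_set D)° !=set0.
Proof.
move=> [x /interior_enormP[r r0 xr]]; exists 0; apply/interior_enormP.
exists r => // y; rewrite subr0 => yr; exists (y + x); first by apply: xr; rewrite addrK.
by exists x; [apply: xr; rewrite subrr enorm0|rewrite addrK].
Qed.

Lemma interiorN U x : (forall y, U y -> U (- y)) -> U° x -> U° (- x).
Proof.
move=> UN /interior_enormP[r r0 xr]; apply/interior_enormP; exists r => // y yr.
by rewrite -(opprK y); apply/UN/xr; rewrite -enormN opprB opprK addrC -[x]opprK.
Qed.

(** The homothety of centre x and ratio t sends the ball of radius r around y to a ball of radius t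
    * r, which convexity keeps in U; [y'] is the preimage of z. *)
Lemma interior_convex_segment U x y t : convex_set U -> U x -> U° y ->
  0 < t -> t <= 1 -> U° (x + t *: (y - x)).
Proof.
move=> cU Ux /interior_enormP[r r0 yr] t0 t1; apply/interior_enormP.
exists (t * r); first exact: mulr_gt0.
move=> z zr; pose y' := y + t^-1 *: (z - (x + t *: (y - x))).
have -> : z = x + t *: (y' - x).
  rewrite /y' scalerBr scalerDr scalerA mulfV ?gt_eqF// scale1r scalerBr.
  by apply/rowP => i; rewrite !mxE; ring.
apply: convex_segment => //; last exact: ltW.
apply: yr; rewrite /y' addrAC subrr add0r enormZ gtr0_norm ?invr_gt0//.
by rewrite mulrC ltr_pdivrMr// mulrC.
Qed.

End ConvexGeometry.

Section Projection.
Context {R : realType} {d : nat}.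
Implicit Types (D : set 'rV[R]_d) (x y z : 'rV[R]_d).

(** The metric projection, encoded by its obtuse-angle characterisation, the only form in which it
    is used below. *)
Definition nearest D x : 'rV[R]_d :=
  xget 0 [set y | D y /\ forall z, D z -> dotp (x - y) (z - y) <= 0].

Lemma nearest_exists D x : compact D -> convex_set D -> D !=set0 ->
  exists y, D y /\ forall z, D z -> dotp (x - y) (z - y) <= 0.
Proof.
move=> cD vD D0.
have [|y Dy ymin] := @EVT_min_rV R d (fun y => enorm (x - y)) D D0 cD.
  apply/within_continuous_enormP => y _ e e0; exists e => // z _ zy.
  apply: le_lt_trans (enorm_lipschitz _ _) _.
  by rewrite opprB addrC addrA subrK enormB.
exists y; rewrite inE in Dy; split => // z Dz.
rewrite leNgt; apply/negP => h.
have key t : 0 < t -> t <= 1 -> 2 * dotp (x - y) (z - y) <= t * dotp (z - y) (z - y).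
  move=> t0 t1; have /ymin : y + t *: (z - y) \in D.
    by rewrite inE; apply: convex_segment => //; exact: ltW.
  rewrite -(@ler_pXn2r _ 2)// ?nnegrE ?enorm_ge0// !enorm_sqr.
  rewrite opprD addrA; move: (x - y) (z - y) => u w.
  rewrite !dotpE (dotpC w u) => H; rewrite -(ler_pM2l t0); lra.
have zp : 0 <= dotp (z - y) (z - y) by exact: dotp_ge0.
pose a := dotp (x - y) (z - y); pose b := dotp (z - y) (z - y).
have ab : a <= b by have := key 1 ltr01 (lexx _); rewrite -/a -/b; rewrite -/a in h; lra.
have b0 : 0 < b by rewrite -/a in h; exact: lt_le_trans h ab.
(* With t = a / b the inequality 2a <= t b becomes 2a <= a, against a > 0. *)
have := key (a / b) (divr_gt0 h b0); rewrite ler_pdivrMr// mul1r => /(_ ab).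
by rewrite -/a -/b divfK ?gt_eqF// -/a; rewrite -/a in h; lra.
Qed.

Lemma nearestP D x : compact D -> convex_set D -> D !=set0 ->
  D (nearest D x) /\
  forall z, D z -> dotp (x - nearest D x) (z - nearest D x) <= 0.
Proof.
move=> cD vD D0; have [y hy] := nearest_exists x cD vD D0.
exact: (xgetPex 0 (ex_intro [set y | D y /\ forall z, D z -> dotp (x - y) (z - y) <= 0] y hy)).
Qed.

Lemma nearest_id D x : compact D -> convex_set D -> D x -> nearest D x = x.
Proof.
move=> cD vD Dx; have D0 : D !=set0 by exists x.
have [_ /(_ x Dx) h] := nearestP x cD vD D0.
by apply/esym/eqP; rewrite -subr_eq0; apply/eqP/dotp_eq0/le_anti; rewrite h dotp_ge0.
Qed.

(** Testing each obtuse-angle inequality at the other projection and adding gives |p - q|^2 <= <x -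
    y, p - q>. *)
Lemma nearest_lipschitz D x y : compact D -> convex_set D -> D !=set0 ->
  enorm (nearest D x - nearest D y) <= enorm (x - y).
Proof.
move=> cD vD D0; have [Dp hp] := nearestP x cD vD D0.
have [Dq hq] := nearestP y cD vD D0.
set p := nearest D x in Dp hp *; set q := nearest D y in Dq hq *.
have := hp _ Dq; have := hq _ Dp => h1 h2.
have h : enorm (p - q) ^+ 2 <= enorm (x - y) * enorm (p - q).
  apply: le_trans (dotp_le_enorm _ _); rewrite enorm_sqr.
  have : dotp (p - q) (p - q) - dotp (x - y) (p - q) =
    dotp (y - q) (p - q) + dotp (x - p) (q - p) by rewrite !dotpE (dotpC q p); ring.
  lra.
have [->|pq] := eqVneq (enorm (p - q)) 0; first exact: enorm_ge0.
by move: h; rewrite expr2 ler_pM2r// lt0r pq enorm_ge0.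
Qed.

Lemma nearest_continuous D : compact D -> convex_set D -> D !=set0 ->
  continuous (nearest D).
Proof.
move=> cD vD D0; apply/continuous_subspace_setT.
apply: enorm_within_continuous => x _ e e0; exists e => // y _ yx.
exact: le_lt_trans (nearest_lipschitz _ _ _ _ _) yx.
Qed.

End Projection.

Section OutwardNormal.
Context {R : realType} {d : nat}.
Variable (D : set 'rV[R]_d).
Hypotheses (clD : closed D) (vD : convex_set D) (bD : C1_boundary D).
Implicit Types (x y z v w : 'rV[R]_d).

Lemma boundary_in x : boundary D x -> D x.
Proof. by move=> [Dx _]; exact: clD. Qed.

Lemma not_boundary_interior x : D x -> ~ boundary D x -> D° x.
Proof.
move=> Dx nb; apply: contrapT => nI; apply: nb; split => //.
exact: subset_closure.
Qed.

Lemma outward_normalP x : boundary D x -> exists rho,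
  local_defining_function D x rho /\
  outward_normal D x = (enorm (gradient rho x))^-1 *: gradient rho x.
Proof.
move=> bx; have [rho hr] := bD bx; rewrite /outward_normal.
set S := [set n | _]; have : S (xget 0 S); last by [].
by apply: xgetPex; exists ((enorm (gradient rho x))^-1 *: gradient rho x), rho.
Qed.

Lemma defining_function_eq0 x rho : boundary D x ->
  local_defining_function D x rho -> rho x = 0.
Proof.
move=> bx [drho _ nD]; have Dx := boundary_in bx.
have [dx _] := nbhs_singleton drho.
have rx : rho x <= 0 by apply/(nbhs_singleton nD).
apply/eqP; rewrite eq_le rx /= leNgt; apply/negP => rx0.
case: bx => _; apply; rewrite /interior.
have h : \forall t \near x, rho t < 0.
  have := proj1 (@cvgrPdist_lt _ _ _ (nbhs x) _ rho (rho x)) (differentiable_continuous dx).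
  move=> /(_ (nbhs_filter x) (- rho x)); rewrite oppr_gt0 => /(_ rx0); apply: filterS => y /=.
  by rewrite ltr_norml => /andP[]; lra.
by apply: filterS2 nD h => y [_ hy] hr; apply/hy/ltW.
Qed.

Lemma enorm_gradient_gt0 x rho : local_defining_function D x rho ->
  0 < enorm (gradient rho x).
Proof.
move=> [_ g0 _]; rewrite lt0r enorm_ge0 andbT; apply: contra g0 => /eqP g0.
by apply/eqP/dotp_eq0; rewrite -enorm_sqr g0 expr0n.
Qed.

Lemma enorm_outward_normal x : boundary D x -> enorm (outward_normal D x) = 1.
Proof.
move=> bx; have [rho [hr ->]] := outward_normalP bx.
have g0 := enorm_gradient_gt0 hr.
by rewrite enormZ gtr0_norm ?invr_gt0// mulVf// gt_eqF.
Qed.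

(** If y - x pointed strictly outward, a defining function would become positive on the segment from
    x to y near x, while convexity keeps that segment in D. *)
Lemma outward_normal_le0 x y : boundary D x -> D y ->
  dotp (outward_normal D x) (y - x) <= 0.
Proof.
move=> bx Dy; have [rho [hr ->]] := outward_normalP bx.
have g0 := enorm_gradient_gt0 hr; have rx := defining_function_eq0 bx hr.
rewrite dotpZl mulr_ge0_le0 ?invr_ge0 ?enorm_ge0//.
have [drho _ nD] := hr; have [dx _] := nbhs_singleton drho.
rewrite leNgt; apply/negP => h; set a := dotp _ _ in h.
have a2 : 0 < a / 2 by rewrite divr_gt0.
have [r r0 /= hr'] := gradient_expansion (y - x) dx a2.
have : \forall t \near 0^'+, [/\ 0 < t, t < r, t <= 1 &
    nbhs x [set z | D z <-> rho z <= 0] /\ (D (x + t *: (y - x)) <-> rho (x + t *: (y - x)) <= 0)].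
  have hc : x + t *: (y - x) @[t --> (0:R)^'+] --> x.
    rewrite -[X in _ --> X]addr0; apply: cvgD; first exact: cvg_cst.
    rewrite -[X in _ --> X](scale0r (y - x)); apply: cvgZr_tmp.
    exact: cvg_at_right_filter cvg_id.
  have hn := hc _ nD; near=> t; split.
  - by near: t; exact: nbhs_right_gt.
  - by near: t; exact: nbhs_right_lt.
  - by near: t; exact: nbhs_right_le.
  - by split=> //; near: t.
move=> /filter_ex[t [t0 tr t1 [_ Dt]]].
have /Dt rt : D (x + t *: (y - x)) by apply: convex_segment (ltW t0) t1 => //; exact: boundary_in.
have := hr' t t0 tr; rewrite rx subr0 ler_norml => /andP[+ _].
rewrite -/a => h3; have := mulr_gt0 t0 h; lra.
Unshelve. all: by end_near. Qed.

Lemma inward_direction x w : boundary D x -> dotp (outward_normal D x) w < 0 ->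
  exists2 r, 0 < r & forall t, 0 <= t -> t < r -> D (x + t *: w).
Proof.
move=> bx; have [rho [hr ->]] := outward_normalP bx.
have g0 := enorm_gradient_gt0 hr; have rx := defining_function_eq0 bx hr.
rewrite dotpZl pmulr_rlt0 ?invr_gt0// => a0; set a := dotp _ _ in a0.
have [drho _ nD] := hr; have [dx _] := nbhs_singleton drho.
(* The error allowance -a in the first-order expansion gives rho <= a t - a t = 0, which already
   means membership in D. *)
have a2 : 0 < - a by rewrite oppr_gt0.
have [r r0 /= hr'] := gradient_expansion w dx a2.
have [r2 r20 hr2] : exists2 r, 0 < r & forall z, enorm (z - x) < r -> D z <-> rho z <= 0.
  exact/nbhs_enormP.
exists (Num.min r (r2 / (enorm w + 1))).
  by rewrite lt_min r0 divr_gt0// ltr_pwDr// enorm_ge0.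
move=> t; rewrite le_eqVlt => /predU1P[<- _|t0].
  by rewrite scale0r addr0; exact: boundary_in.
rewrite lt_min => /andP[tr]; rewrite ltr_pdivlMr ?ltr_pwDr ?enorm_ge0// => tr2.
apply/hr2.
  rewrite addrAC subrr add0r enormZ gtr0_norm//; lra.
by have := hr' t t0 tr; rewrite rx subr0 ler_norml -/a => /andP[_]; lra.
Qed.

Lemma interior_direction x w : D° x ->
  exists2 r, 0 < r & forall t, 0 <= t -> t < r -> D (x + t *: w).
Proof.
move=> /interior_enormP[r r0 xr]; exists (r / (enorm w + 1)).
  by rewrite divr_gt0// ltr_pwDr// enorm_ge0.
move=> t t0; rewrite ltr_pdivlMr ?ltr_pwDr ?enorm_ge0// => tr; apply: xr.
by rewrite addrAC subrr add0r enormZ ger0_norm//; lra.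
Qed.

Lemma tangential_proj_interior x v : D° x -> tangential_proj D x v = v.
Proof.
move=> Ix; rewrite /tangential_proj ifF//; apply/negP => /asboolP[[_ nI] _].
exact: nI.
Qed.

Lemma tangential_proj_boundary x v : boundary D x ->
  tangential_proj D x v =
  v - Num.max 0 (dotp v (outward_normal D x)) *: outward_normal D x.
Proof.
move=> bx; rewrite /tangential_proj; case: asboolP => [[_ h]|h].
  by rewrite max_r// ltW.
rewrite max_l ?scale0r ?subr0// leNgt; apply/negP => h2; exact: h.
Qed.

(** Treats interior and boundary points at once: v - P_x(v) = c n lies in the normal cone of D at x,
    with n = 0 inside, and c is nonzero only when it is the outward component of v. *)
Lemma tangential_projP x v : D x -> exists2 c, 0 <= c & exists n,
  [/\ tangential_proj D x v = v - c *: n,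
      enorm n <= 1, c = 0 \/ (dotp v n = c /\ enorm n = 1) &
      forall y, D y -> dotp n (y - x) <= 0].
Proof.
move=> Dx; have [bx|nb] := pselect (boundary D x).
  exists (Num.max 0 (dotp v (outward_normal D x))); first by rewrite le_max lexx.
  exists (outward_normal D x); split.
  - exact: tangential_proj_boundary.
  - by rewrite enorm_outward_normal.
  - have [h|h] := ltP 0 (dotp v (outward_normal D x)).
      by right; rewrite enorm_outward_normal// max_r// ltW.
    by left.
  - by move=> y Dy; exact: outward_normal_le0.
exists 0 => //; exists 0; split; rewrite ?enorm0//.
- by rewrite scaler0 subr0 tangential_proj_interior//; exact: not_boundary_interior.
- by left.
- by move=> y _; rewrite dotp0l.
Qed.

Lemma tangential_proj_dotp x v y : D x -> D y ->
  dotp (tangential_proj D x v) (x - y) <= dotp v (x - y).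
Proof.
move=> Dx Dy; have [c c0 [n [-> _ _ hn]]] := tangential_projP v Dx.
rewrite dotpDl dotpNl dotpZl gerDl oppr_le0 mulr_ge0//.
by rewrite -opprB dotpNr oppr_ge0 hn.
Qed.

Lemma enorm_tangential_proj x v : D x -> enorm (tangential_proj D x v) <= enorm v.
Proof.
move=> Dx; have [c c0 [n [-> _ hc _]]] := tangential_projP v Dx.
case: hc => [->|[vn n1]]; first by rewrite scale0r subr0.
rewrite -(@ler_pXn2r _ 2)// ?nnegrE ?enorm_ge0// !enorm_sqr !dotpE.
rewrite (dotpC n v) vn -(enorm_sqr n) n1; have := sqr_ge0 c; lra.
Qed.

(* Admissible directions approximate the projected velocity: push it slightly
   into the domain. *)
Lemma tangential_proj_approx x v e : D° !=set0 -> D x -> 0 < e ->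
  exists w, [/\ enorm (w - tangential_proj D x v) <= e,
    forall y, D y -> dotp (v - tangential_proj D x v) (y - x) <= 0,
    `|dotp (v - tangential_proj D x v) w| <= e * enorm v &
    exists2 r, 0 < r & forall t, 0 <= t -> t < r -> D (x + t *: w)].
Proof.
move=> D0 Dx e0; have [bx|nb] := pselect (boundary D x); last first.
  have Ix := not_boundary_interior Dx nb.
  exists v; rewrite tangential_proj_interior// subrr enorm0; split => //.
  - exact: ltW.
  - by move=> y _; rewrite dotp0l.
  - by rewrite dotp0l normr0 mulr_ge0 ?enorm_ge0// ltW.
  - exact: interior_direction.
set n := outward_normal D x; pose c := Num.max 0 (dotp v n).
have n1 : enorm n = 1 by exact: enorm_outward_normal.
have nn : dotp n n = 1 by rewrite -enorm_sqr n1 expr1n.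
have c0 : 0 <= c by rewrite le_max lexx.
have cv : c <= enorm v.
  by rewrite ge_max enorm_ge0 /=; have := dotp_le_enorm v n; rewrite n1 mulr1.
rewrite tangential_proj_boundary// -/n -/c.
have -> : v - (v - c *: n) = c *: n by rewrite opprB addrC subrK.
(* Complementarity: the removed part [c *: n] is orthogonal to the projected velocity. *)
have cn : c * (dotp v n - c) = 0.
  rewrite /c; have [h|h] := ltP 0 (dotp v n); last by rewrite mul0r.
  by rewrite subrr mulr0.
have vc : dotp v n - c <= 0 by rewrite subr_le0 le_max lexx orbT.
(* The normal component of this vector is at most -e, hence strictly inward, and by complementarity
   its pairing with [c *: n] is exactly -c e. *)
exists (v - c *: n - e *: n); split.
- by rewrite addrAC subrr add0r enormN enormZ n1 mulr1 gtr0_norm.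
- by move=> y Dy; rewrite dotpZl mulr_ge0_le0//; exact: outward_normal_le0.
- rewrite dotpZl !dotpE nn (dotpC n v) !mulr1.
  have -> : c * (dotp v n - c - e) = - (c * e) by rewrite mulrBr cn sub0r.
  by rewrite normrN ger0_norm 1?mulrC ?ler_wpM2l// ?mulr_ge0// ltW.
- apply: inward_direction => //; rewrite -/n !dotpE nn (dotpC n v) !mulr1; lra.
Qed.

End OutwardNormal.

(** * Gradients of even and of lambda-convex functions *)

Section GradOn.
Context {R : realType} {d : nat}.
Implicit Types (U D : set 'rV[R]_d) (f : 'rV[R]_d -> R) (x y : 'rV[R]_d).

Lemma grad_onP U f : C1_on U f -> C1_with_gradient U f (grad_on U f).
Proof. by move=> [g hg]; exact: (xgetPex (fun=> 0) (ex_intro (C1_with_gradient U f) g hg)). Qed.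

Lemma lambda_convex_monotone lam U f x y : lambda_convex lam U f -> U x -> U y ->
  lam * enorm (x - y) ^+ 2 <= dotp (grad_on U f x - grad_on U f y) (x - y).
Proof.
move=> h Ux Uy; have h1 := h _ _ Ux Uy; have h2 := h _ _ Uy Ux.
have e1 : dotp (grad_on U f x - grad_on U f y) (x - y) =
  - dotp (grad_on U f x) (y - x) - dotp (grad_on U f y) (x - y).
  by rewrite -(opprB x y) dotpNr opprK dotpDl dotpNl.
rewrite e1; move: h1 h2; rewrite (enormB y x); lra.
Qed.

Lemma gradient_even f x : (forall y, f y = f (- y)) ->
  differentiable f x -> differentiable f (- x) ->
  gradient f (- x) = - gradient f x.
Proof.
move=> fN fx fNx; apply/rowP => i; rewrite !mxE.
set e := delta_mx 0 i.
have -> : 'D_e f (- x) = 'D_(- e) f x.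
  rewrite /derive (_ : (fun h => h^-1 *: ((f \o shift (- x)) (h *: e) - f (- x))) =
    (fun h => h^-1 *: ((f \o shift x) (h *: - e) - f x)))//.
  apply/funext => h /=.
  by rewrite -fN fN opprD opprK scalerN.
by rewrite !deriveE// linearN.
Qed.

(** [grad_on] is tied to derivatives only in the interior, where oddness is the chain rule. At other
    points of U it follows by continuity along a segment towards an interior point. *)
Lemma grad_on_even U f : convex_set U -> U° !=set0 ->
  (forall x, U x -> U (- x)) -> (forall x, f x = f (- x)) -> C1_on U f ->
  forall x, U x -> grad_on U f (- x) = - grad_on U f x.
Proof.
move=> vU [y Iy] UN fN fU x Ux; have [_ gc hg] := grad_onP fU.
set g := grad_on U f in gc hg *.
have gI z : U° z -> g (- z) = - g z.
  move=> Iz; have INz := interiorN UN Iz.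
  have [dz ->] := hg _ Iz; have [dNz ->] := hg _ INz.
  exact: gradient_even.
apply/eqP; rewrite -addr_eq0; apply/eqP/dotp_eq0; rewrite -enorm_sqr.
suff h0 : enorm (g (- x) + g x) <= 0.
  by rewrite (@le_anti _ _ (enorm (g (- x) + g x)) 0) ?expr0n// h0 enorm_ge0.
apply/ler_addgt0Pr => e e0; rewrite add0r.
have e2 : 0 < e / 2 by rewrite divr_gt0.
have [r1 r10 h1] := within_continuous_enorm gc Ux e2.
have [r2 r20 h2] := within_continuous_enorm gc (UN _ Ux) e2.
(* Small enough that z = x + t (y - x) is within both continuity radii, of x for z and of -x for
   -z. *)
pose t := Num.min 1 (Num.min r1 r2 / (enorm (y - x) + 1) / 2).
have n0 := enorm_ge0 (y - x).
have m0 : 0 < Num.min r1 r2 by rewrite lt_min r10.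
have n1 : 0 < enorm (y - x) + 1 by rewrite ltr_pwDr.
have t0 : 0 < t by rewrite lt_min ltr01 !divr_gt0.
have t1 : t <= 1 by rewrite ge_min lexx.
have tn : t * enorm (y - x) < Num.min r1 r2.
  apply: (@le_lt_trans _ _ (Num.min r1 r2 / (enorm (y - x) + 1) / 2 * (enorm (y - x) + 1))).
    apply: ler_pM; [exact: ltW|exact: n0|by rewrite ge_min lexx orbT|lra].
  by rewrite mulrAC divfK ?gt_eqF//; lra.
pose z := x + t *: (y - x).
have Iz : U° z by exact: interior_convex_segment.
have zx : enorm (z - x) < Num.min r1 r2.
  by rewrite /z addrAC subrr add0r enormZ gtr0_norm.
have := zx; rewrite lt_min => /andP[zr1 zr2].
have Uz := interior_subset Iz.
have idr (a b c : 'rV[R]_d) : a + c = - (- b - a) - (b - c).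
  by rewrite !opprB opprK -addrA (addrC b) subrK.
rewrite (idr _ (g z)) -gI//.
apply: le_trans (enormD _ _) _; rewrite !enormN [e]splitr lerD//.
  by apply/ltW/h2; [exact: UN|rewrite -opprD enormN].
by apply/ltW/h1.
Qed.

End GradOn.

Section AssumptionA.
Context {R : realType} {d : nat} (D : set 'rV[R]_d) (K V : 'rV[R]_d -> R)
  (lamK lamV : R) (hA : assumption_A D K V lamK lamV).

Lemma assumption_A_compact : compact D.
Proof. by have [[clD bD _ _ _] _ _ _] := hA; exact: bounded_closed_compact. Qed.

Lemma assumption_A_gradK_odd x : diff_set D x ->
  grad_on (diff_set D) K (- x) = - grad_on (diff_set D) K x.
Proof.
have [[clD bD vD D0 _] KN [KC _] _] := hA.
apply: grad_on_even => //; [exact: convex_diff_set|exact: interior_diff_set0|].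
by move=> y; exact: diff_setN.
Qed.

End AssumptionA.

(** * Borel measurability and expectations of bounded variables *)

Section BorelRV.
Context {R : realType} {d : nat}.

Let rV := 'rV[R]_d.

(** The boxes with rational centres and radii 1/(n+1) form a countable base; this reduces Borel
    measurability of a vector-valued map to that of its coordinates. *)
Lemma open_rV_bigcup_boxes (A : set rV) : open A ->
  A = \bigcup_(qn in [set qn : 'rV[rat]_d * nat |
        [set y : rV | forall i, `|y 0 i - ratr (qn.1 0 i)| < qn.2.+1%:R^-1] `<=` A])
      [set y : rV | forall i, `|y 0 i - ratr (qn.1 0 i)| < qn.2.+1%:R^-1].
Proof.
move=> oA; apply/seteqP; split => [x Ax|x [qn + /= xq]]; last exact.
have [e /= e0 xA] : nbhs_ball x A by apply/nbhs_ballP; exact: open_nbhs_nbhs.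
have [n hn] : exists n : nat, 2 * n.+1%:R^-1 < e.
  exists (Num.truncn (2 / e)); have := truncnS_gt (2 / e).
  by rewrite ltr_pdivrMr// => h; rewrite ltr_pdivrMr// mulrC.
have hq i : exists q : rat, `|x 0 i - ratr q| < n.+1%:R^-1.
  have n0 : (0 : R) < n.+1%:R^-1 by rewrite invr_gt0.
  have : x 0 i - n.+1%:R^-1 < x 0 i + n.+1%:R^-1 by rewrite ltrD2l gtrN.
  move=> /rat_in_itvoo[q]; rewrite in_itv /= => /andP[h1 h2]; exists q.
  by rewrite distrC ltr_distl h1 h2.
pose q : 'rV[rat]_d := \row_i projT1 (cid (hq i)).
have qE i : `|x 0 i - ratr (q 0 i)| < n.+1%:R^-1.
  by rewrite mxE; case: cid.
exists (q, n) => //= y yq; apply: xA; split => // i j.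
rewrite /ball /= (ord1 i); apply: le_lt_trans hn.
have -> : x 0 j - y 0 j = (x 0 j - ratr (q 0 j)) - (y 0 j - ratr (q 0 j)) by ring.
by apply: le_trans (ler_normB _ _) _; rewrite mulr_natl mulr2n lerD// ltW.
Qed.

Lemma continuous_measurable_rV (D : set rV) (f : rV -> R) :
  closed D -> {within D, continuous f} ->
  measurable_fun (D : set (borel_rV R d)) f.
Proof.
move=> clD /continuousP cf.
apply: (measurability _ (RGenOpens.measurableE R)).
move=> _ [_ [a [b ->] <-]].
have /open_subspaceP[U oU UD] := cf _ (@interval_open _ (BRight a) (BLeft b) isT isT).
rewrite setIC -UD; apply: measurableI; first exact: sub_sigma_algebra.
by rewrite -(setCK D); apply: measurableC; apply: sub_sigma_algebra; exact: closed_openC.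
Qed.

Lemma measurable_fun_coord i :
  measurable_fun setT (fun x : borel_rV R d => x 0 i : R).
Proof.
apply: continuous_measurable_rV; first exact: closedT.
exact/continuous_subspaceT/coord_continuous.
Qed.

Context {disp : measure_display} {T : measurableType disp}.
Implicit Types (f g : T -> borel_rV R d).

Lemma measurable_rowP f :
  measurable_fun setT f <-> forall i, measurable_fun setT (fun t => f t 0 i : R).
Proof.
split=> [mf i|mf].
  exact: (measurableT_comp (measurable_fun_coord i) mf).
apply: (@measurability _ _ T (borel_rV R d) setT f (@open rV) erefl).
move=> _ [A oA <-]; rewrite setTI (open_rV_bigcup_boxes oA) preimage_bigcup.
rewrite bigcup_mkcond; apply: countable_bigcupT_measurable => [|[q n]]; first exact: countableP.
case: ifPn => // _.
have -> : f @^-1` [set y : rV | forall i, `|y 0 i - ratr (q 0 i)| < n.+1%:R^-1] =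
    \bigcap_(i in [set: 'I_d]) ((fun t => `|f t 0 i - ratr (q 0 i)|) @^-1` `]-oo, n.+1%:R^-1[).
  apply/seteqP; split => t /= h i; first by move=> _ /=; rewrite in_itv /=; exact: h.
  by have := h i I; rewrite /= in_itv.
apply: fin_bigcap_measurable => [|i _]; first exact: finite_finset.
rewrite -[_ @^-1` _]setTI; have : measurable_fun setT (fun t => `|f t 0 i - ratr (q 0 i)|).
  by apply: measurableT_comp => //; exact: measurable_funB.
by apply => //; exact: measurable_itv.
Qed.

Lemma measurable_continuous_comp (D : set rV) (g : rV -> R) f :
  closed D -> {within D, continuous g} -> measurable_fun setT f ->
  (forall t, D (f t)) -> measurable_fun setT (fun t => g (f t)).
Proof.
move=> clD gc mf fD.
apply: (@measurable_comp _ _ _ T (borel_rV R d) _ (D : set (borel_rV R d)) g setT f) => //.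
- by rewrite -(setCK D); apply: measurableC; apply: sub_sigma_algebra; exact: closed_openC.
- by move=> _ [t _ <-]; exact: fD.
- exact: continuous_measurable_rV.
Qed.

Lemma measurable_continuous_rV (g : rV -> rV) f :
  continuous g -> measurable_fun setT f ->
  measurable_fun setT (fun t => g (f t) : borel_rV R d).
Proof.
move=> gc mf; apply/measurable_rowP => i.
apply: (@measurable_continuous_comp setT (fun x => g x 0 i)) => //.
apply/within_continuous_enormP => x xT e e0.
have [r r0 h] := within_continuous_enorm (continuous_subspaceT gc) xT e0.
exists r => // y yT yx; apply: le_lt_trans (h y yT yx).
by have := normr_coord_le_enorm (g y - g x) i; rewrite !mxE.
Qed.

Lemma measurable_funD_rV f g : measurable_fun setT f -> measurable_fun setT g ->
  measurable_fun setT (fun t => ((f t : rV) + (g t : rV)) : borel_rV R d).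
Proof.
move=> /measurable_rowP mf /measurable_rowP mg; apply/measurable_rowP => i.
under eq_fun do rewrite mxE; exact: measurable_funD.
Qed.

Lemma measurable_funZ_rV a f : measurable_fun setT f ->
  measurable_fun setT (fun t => (a *: (f t : rV)) : borel_rV R d).
Proof.
move=> /measurable_rowP mf; apply/measurable_rowP => i.
under eq_fun do rewrite mxE; exact: measurable_funM.
Qed.

Lemma measurable_funB_rV f g : measurable_fun setT f -> measurable_fun setT g ->
  measurable_fun setT (fun t => ((f t : rV) - (g t : rV)) : borel_rV R d).
Proof.
move=> mf mg; have := measurable_funD_rV mf (measurable_funZ_rV (-1) mg).
by under eq_fun do rewrite scaleN1r.
Qed.

Lemma measurable_dotp f g : measurable_fun setT f -> measurable_fun setT g ->
  measurable_fun setT (fun t => dotp (f t : rV) (g t : rV)).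
Proof.
move=> /measurable_rowP mf /measurable_rowP mg; rewrite /dotp.
by apply: measurable_sum => i; exact: measurable_funM.
Qed.

End BorelRV.

Section Expectation.
Context {R : realType} {disp : measure_display} {T : measurableType disp}
  (P : probability T R).
Implicit Types (f g : T -> R).

(** All integrands arise from continuous functions on compact sets, so boundedness is available
    everywhere; it is stable under products and spares integrability conditions. *)
Definition bmeas f := measurable_fun setT f /\ exists M, forall w, `|f w| <= M.

Lemma bmeas_integrable f : bmeas f -> P.-integrable setT (EFin \o f).
Proof.
move=> [mf [M fM]]; apply: measurable_bounded_integrable => //.
  by rewrite -ge0_fin_numE// fin_num_measure.
by exists M; split; rewrite ?num_real// => x Mx w _; apply: le_trans (fM w) (ltW Mx).
Qed.

Lemma bmeas_cst c : bmeas (fun=> c).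
Proof. by split; [exact: measurable_cst|exists `|c|]. Qed.

Lemma bmeasD f g : bmeas f -> bmeas g -> bmeas (fun w => f w + g w).
Proof.
move=> [mf [M fM]] [mg [N gN]]; split; first exact: measurable_funD.
by exists (M + N) => w; apply: le_trans (ler_normD _ _) (lerD _ _).
Qed.

Lemma bmeasM f g : bmeas f -> bmeas g -> bmeas (fun w => f w * g w).
Proof.
move=> [mf [M fM]] [mg [N gN]]; split; first exact: measurable_funM.
by exists (M * N) => w; rewrite normrM ler_pM.
Qed.

Lemma bmeasZ c f : bmeas f -> bmeas (fun w => c * f w).
Proof. by move=> bf; apply: bmeasM => //; exact: bmeas_cst. Qed.

Lemma bmeasN f : bmeas f -> bmeas (fun w => - f w).
Proof. by move=> bf; under eq_fun do rewrite -mulN1r; exact: bmeasZ. Qed.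

Lemma bmeasB f g : bmeas f -> bmeas g -> bmeas (fun w => f w - g w).
Proof. by move=> bf bg; apply: bmeasD => //; exact: bmeasN. Qed.

Lemma bmeas_sum (I : Type) (r : seq I) (F : I -> T -> R) :
  (forall i, bmeas (F i)) -> bmeas (fun w => \sum_(i <- r) F i w).
Proof.
move=> bF; elim: r => [|i r IH].
  by under eq_fun do rewrite big_nil; exact: bmeas_cst.
by under eq_fun do rewrite big_cons; exact: bmeasD.
Qed.

Definition Ex f : R := \int[P]_w f w.

Lemma Ex_cst c : Ex (fun=> c) = c.
Proof.
rewrite /Ex Rintegral_cst// -[RHS]mulr1; congr (_ * _).
exact: (congr1 fine (probability_setT P)).
Qed.

Lemma ExD f g : bmeas f -> bmeas g -> Ex (fun w => f w + g w) = Ex f + Ex g.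
Proof. by move=> /bmeas_integrable bf /bmeas_integrable bg; exact: RintegralD. Qed.

Lemma ExZ c f : bmeas f -> Ex (fun w => c * f w) = c * Ex f.
Proof. by move=> /bmeas_integrable bf; exact: RintegralZl. Qed.

Lemma ExB f g : bmeas f -> bmeas g -> Ex (fun w => f w - g w) = Ex f - Ex g.
Proof. by move=> /bmeas_integrable bf /bmeas_integrable bg; exact: RintegralB. Qed.

Lemma ExN f : bmeas f -> Ex (fun w => - f w) = - Ex f.
Proof. by move=> bf; under eq_fun do rewrite -mulN1r; rewrite ExZ// mulN1r. Qed.

Lemma Ex_sum (I : Type) (r : seq I) (F : I -> T -> R) :
  (forall i, bmeas (F i)) -> Ex (fun w => \sum_(i <- r) F i w) = \sum_(i <- r) Ex (F i).
Proof.
move=> bF; elim: r => [|i r IH].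
  by under eq_fun do rewrite big_nil; rewrite Ex_cst big_nil.
under eq_fun do rewrite big_cons; rewrite ExD// ?IH ?big_cons//.
exact: bmeas_sum.
Qed.

Lemma Ex_ge0 f : (forall w, 0 <= f w) -> 0 <= Ex f.
Proof. by move=> f0; exact: Rintegral_ge0. Qed.

Lemma Ex_le f g : bmeas f -> bmeas g -> (forall w, f w <= g w) -> Ex f <= Ex g.
Proof. by move=> /bmeas_integrable bf /bmeas_integrable bg fg; exact: le_Rintegral. Qed.

Lemma Ex_ae f g : bmeas f -> bmeas g -> {ae P, forall w, f w = g w} -> Ex f = Ex g.
Proof.
move=> [mf _] [mg _] fg; congr fine; apply: ae_eq_integral => //; try exact/measurable_EFinP.
by apply: filterS fg => w /= -> _.
Qed.

Lemma Ex_le_ae f g : bmeas f -> bmeas g -> {ae P, forall w, f w <= g w} -> Ex f <= Ex g.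
Proof.
move=> bf bg fg.
(* The maximum dominates f everywhere and equals g almost everywhere. *)
pose h w := Num.max (f w) (g w).
have bh : bmeas h.
  have [mf [M fM]] := bf; have [mg [N gN]] := bg.
  split; first exact: measurable_maxr.
  exists (M + N) => w; rewrite /h; have := fM w; have := gN w.
  have := normr_ge0 (f w); have := normr_ge0 (g w).
  by rewrite /Num.max; case: ifP => _; lra.
rewrite -(Ex_ae bh bg).
  by apply: Ex_le => // w; rewrite /h le_max lexx.
by apply: filterS fg => w fg; rewrite /h max_r.
Qed.

Lemma expectation_Ex f : bmeas f -> ('E_P[f] = (Ex f)%:E)%E.
Proof.
move=> bf; rewrite unlock /Ex /Rintegral fineK//.
exact: integrable_fin_num (bmeas_integrable bf).
Qed.

End Expectation.

Section ExpectationFubini.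
Context {R : realType} {disp : measure_display} {T : measurableType disp}
  (P : probability T R).

Lemma bmeas_slice (F : T * T -> R) w : bmeas F -> bmeas (fun w' => F (w, w')).
Proof.
move=> [mF [M FM]]; split; last by exists M.
by apply: measurableT_comp mF _; exact: measurable_fun_pair.
Qed.

Lemma bmeas_prod_integrable (F : T * T -> R) : bmeas F ->
  (P \x P)%E.-integrable setT (EFin \o F).
Proof.
move=> [mF [M FM]].
have PP : (P \x P)%E setT = 1%E.
  rewrite -setXTT product_measure1E// -[RHS]mule1.
  by congr (_ * _)%E; exact: (probability_setT P).
apply: measurable_bounded_integrable => //; first exact: (eq_ind_r (fun x => x < +oo)%E (ltry 1) PP).
by exists M; split; rewrite ?num_real// => x Mx w _; apply: le_trans (FM w) (ltW Mx).
Qed.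

Lemma Ex_Fubini (F : T * T -> R) : bmeas F ->
  Ex P (fun w => Ex P (fun w' => F (w, w'))) = Ex P (fun w' => Ex P (fun w => F (w, w'))).
Proof.
move=> bF; have [mF [M FM]] := bF.
have iF := bmeas_prod_integrable bF.
have bG : bmeas (fun z : T * T => F (z.2, z.1)).
  split; last by exists M => z.
  by apply: measurableT_comp mF _; apply: measurable_fun_pair.
have E1 w : (Ex P (fun w' => F (w, w')))%:E = (\int[P]_w' (F (w, w'))%:E)%E.
  rewrite /Ex /Rintegral fineK//; apply: integrable_fin_num => //.
  exact: bmeas_integrable (bmeas_slice w bF).
have E2 w : (Ex P (fun w' => F (w', w)))%:E = (\int[P]_w' (F (w', w))%:E)%E.
  rewrite /Ex /Rintegral fineK//; apply: integrable_fin_num => //.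
  exact: bmeas_integrable (bmeas_slice w bG).
rewrite /Ex /Rintegral; congr fine.
rewrite (eq_integral (fun w => \int[P]_w' (F (w, w'))%:E)%E); last by move=> w _; exact: E1.
rewrite [RHS](eq_integral (fun w => \int[P]_w' (F (w', w))%:E)%E); last by move=> w _; exact: E2.
exact: (Fubini iF).
Qed.

Lemma bmeas_Ex (F : T * T -> R) : bmeas F -> bmeas (fun w => Ex P (fun w' => F (w, w'))).
Proof.
move=> bF; have [mF [M FM]] := bF.
have iF := bmeas_prod_integrable bF.
split.
  have := measurable_fubini_F iF => /= h.
  by apply: measurableT_comp h.
exists M => w; rewrite ler_norml -{1}(Ex_cst P (- M)) -{2}(Ex_cst P M).
have bw := bmeas_slice w bF; apply/andP; split; apply: Ex_le => //; try exact: bmeas_cst.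
  by move=> w'; have := FM (w, w'); rewrite ler_norml => /andP[].
by move=> w'; have := FM (w, w'); rewrite ler_norml => /andP[].
Qed.

End ExpectationFubini.

(** * The mean-field drift *)

Section BoundedVectors.
Context {R : realType} {d : nat} {disp : measure_display} {T : measurableType disp}.
Implicit Types (f g : T -> 'rV[R]_d).

Definition bvec f :=
  measurable_fun setT (f : T -> borel_rV R d) /\ exists M, forall w, enorm (f w) <= M.

Lemma bvec_cst x : bvec (fun=> x).
Proof. by split; [exact: measurable_cst|exists (enorm x)]. Qed.

Lemma bvecB f g : bvec f -> bvec g -> bvec (fun w => f w - g w).
Proof.
move=> [mf [M fM]] [mg [N gN]]; split; first exact: measurable_funB_rV.
by exists (M + N) => w; apply: le_trans (enormD _ _) _; rewrite enormN lerD.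
Qed.

Lemma bmeas_dotp f g : bvec f -> bvec g -> bmeas (fun w => dotp (f w) (g w)).
Proof.
move=> [mf [M fM]] [mg [N gN]]; split; first exact: measurable_dotp.
exists (M * N) => w; apply: le_trans (dotp_le _ _) _.
by apply: ler_pM; rewrite ?enorm_ge0.
Qed.

Lemma bmeas_enorm_sqr f : bvec f -> bmeas (fun w => enorm (f w) ^+ 2).
Proof. by move=> bf; under eq_fun do rewrite enorm_sqr; exact: bmeas_dotp. Qed.

Lemma bmeas_coord f i : bvec f -> bmeas (fun w => f w 0 i).
Proof.
move=> bf; have := bmeas_dotp bf (bvec_cst (delta_mx 0 i)).
by under eq_fun do rewrite dotp_delta.
Qed.

Lemma within_continuous_coord (A : set 'rV[R]_d) (g : 'rV[R]_d -> 'rV[R]_d) i :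
  {within A, continuous g} -> {within A, continuous (fun x => g x 0 i)}.
Proof.
move=> gc; apply/within_continuous_enormP => x Ax e e0.
have [r r0 h] := within_continuous_enorm gc Ax e0.
exists r => // y Ay yx; apply: le_lt_trans (h y Ay yx).
by have := normr_coord_le_enorm (g y - g x) i; rewrite !mxE.
Qed.

Lemma compact_closed_rV (A : set 'rV[R]_d) : compact A -> closed A.
Proof. by apply: compact_closed; exact: norm_hausdorff. Qed.

Lemma bvec_comp (A : set 'rV[R]_d) (g : 'rV[R]_d -> 'rV[R]_d) f :
  compact A -> {within A, continuous g} ->
  measurable_fun setT (f : T -> borel_rV R d) -> (forall w, A (f w)) ->
  bvec (fun w => g (f w)).
Proof.
move=> cA gc mf fA; split.
  apply/measurable_rowP => i.
  apply: (measurable_continuous_comp (g := fun x => g x 0 i) (compact_closed_rV cA)) => //.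
  exact: within_continuous_coord.
by have [M M0 hM] := compact_enorm_bounded cA gc; exists M => w; exact: hM.
Qed.

Lemma subrACA_rV (x y z t : 'rV[R]_d) : x - y - (z - t) = x - z - (y - t).
Proof. by apply/rowP => i; rewrite !mxE; ring. Qed.

(** Take u = v. This stands in for the norm inequality for vector-valued integrals: scalar integrals
    in each direction suffice. *)
Lemma enorm_dual (v : 'rV[R]_d) c : 0 <= c -> (forall u, dotp v u <= c * enorm u) -> enorm v <= c.
Proof.
move=> c0 h; have := h v; rewrite -enorm_sqr expr2.
have [->//|v0] := eqVneq (enorm v) 0.
by rewrite ler_pM2r// lt0r v0 enorm_ge0.
Qed.

End BoundedVectors.

Section Drift.
Context {R : realType} {d : nat} (D : set 'rV[R]_d)
  (gK gV : 'rV[R]_d -> 'rV[R]_d) (lamK lamV : R).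
Hypotheses (cD : compact D) (vD : convex_set D) (D0 : D !=set0)
  (gKc : {within diff_set D, continuous gK})
  (gVc : {within D, continuous gV})
  (gKodd : forall p, diff_set D p -> gK (- p) = - gK p)
  (gKm : forall p q, diff_set D p -> diff_set D q ->
     lamK * enorm (p - q) ^+ 2 <= dotp (gK p - gK q) (p - q))
  (gVm : forall p q, D p -> D q ->
     lamV * enorm (p - q) ^+ 2 <= dotp (gV p - gV q) (p - q)).

Let cU : compact (diff_set D). Proof. exact: compact_diff_set. Qed.

Lemma diff_set_in x y : D x -> D y -> diff_set D (x - y).
Proof. by move=> Dx Dy; exists x => //; exists y. Qed.

Definition rvD {disp} {T : measurableType disp} (Y : T -> 'rV[R]_d) :=
  measurable_fun setT (Y : T -> borel_rV R d) /\ forall w, D (Y w).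

Lemma compact_diameter : exists2 M, 0 <= M & forall x y, D x -> D y -> enorm (x - y) <= M.
Proof.
have [M M0 hM] := compact_enorm_bounded cU (continuous_subspaceT (fun x => cvg_id)).
by exists M => // x y Dx Dy; apply: hM; exact: diff_set_in.
Qed.

Context {disp : measure_display} {T : measurableType disp} (P : probability T R).
Implicit Types (Y : T -> 'rV[R]_d).

Lemma rvD_bvec Y : rvD Y -> bvec Y.
Proof.
move=> [mY YD]; apply: (bvec_comp (g := id) cD) => //.
exact: continuous_subspaceT (fun x => cvg_id).
Qed.

Lemma bvec_gK Y x : rvD Y -> D x -> bvec (fun w => gK (x - Y w)).
Proof.
move=> [mY YD] Dx; apply: (bvec_comp cU gKc) => [|w]; last exact: diff_set_in.
by apply: measurable_funB_rV => //; exact: measurable_cst.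
Qed.

(** The convolution is written as an expectation over the sample space instead of an integral
    against the law, so that two random variables can be compared through their coupling. *)
Definition drift Y x : 'rV[R]_d :=
  \row_(i < d) (- Ex P (fun w => gK (x - Y w) 0 i) - gV x 0 i).

Lemma dotp_drift Y x u : rvD Y -> D x ->
  dotp (drift Y x) u = - Ex P (fun w => dotp (gK (x - Y w)) u) - dotp (gV x) u.
Proof.
move=> bY Dx; have bi i := bmeas_coord i (bvec_gK bY Dx).
rewrite {3}/dotp /= Ex_sum; last first.
  by move=> i; under eq_fun do rewrite mulrC; exact: bmeasZ.
rewrite /dotp -sumrN -sumrB; apply: eq_bigr => i _.
rewrite mxE mulrBl mulNr; congr (- _ - _).
by rewrite mulrC -ExZ//; congr (Ex P); apply/funext => w; rewrite mulrC.
Qed.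

Lemma dotp_driftB Y Y' x x' u : rvD Y -> rvD Y' -> D x -> D x' ->
  dotp (drift Y x - drift Y' x') u =
  - Ex P (fun w => dotp (gK (x - Y w) - gK (x' - Y' w)) u) - dotp (gV x - gV x') u.
Proof.
move=> bY bY' Dx Dx'.
under eq_fun do rewrite dotpDl dotpNl.
rewrite ExB; last 2 first.
  by apply: bmeas_dotp; [exact: bvec_gK|exact: bvec_cst].
  by apply: bmeas_dotp; [exact: bvec_gK|exact: bvec_cst].
by rewrite !dotpDl !dotpNl !dotp_drift//; ring.
Qed.

Lemma bmeas_dist Y Y' : rvD Y -> rvD Y' -> bmeas (fun w => enorm (Y w - Y' w) ^+ 2).
Proof. by move=> /rvD_bvec bY /rvD_bvec bY'; apply: bmeas_enorm_sqr; exact: bvecB. Qed.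

(** The arguments of [gK] differ by (x - x') - (Y - Y'). The quadratic modulus together with |u -
    v|^2 <= 2|u|^2 + 2|v|^2 separates the points from the laws, and the second square is then
    integrated; hence the constant 2A + B. *)
Lemma drift_modulus e : 0 < e -> exists2 A, 0 <= A & forall Y Y' x x',
  rvD Y -> rvD Y' -> D x -> D x' ->
  enorm (drift Y x - drift Y' x') <=
    e + A * (enorm (x - x') ^+ 2 + Ex P (fun w => enorm (Y w - Y' w) ^+ 2)).
Proof.
move=> e0; have e2 : 0 < e / 2 by rewrite divr_gt0.
have [A A0 hA] := compact_quadratic_modulus cU gKc e2.
have [B B0 hB] := compact_quadratic_modulus cD gVc e2.
exists (2 * A + B); first by rewrite addr_ge0// mulr_ge0.
move=> Y Y' x x' bY bY' Dx Dx'.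
set E := Ex P _; have E0 : 0 <= E by apply: Ex_ge0 => w; exact: sqr_ge0.
have X0 : 0 <= enorm (x - x') ^+ 2 by exact: sqr_ge0.
apply: enorm_dual => [|u].
  by apply: addr_ge0; [exact: ltW|apply: mulr_ge0; rewrite addr_ge0// mulr_ge0].
rewrite dotp_driftB//.
have bd := bmeas_dist bY bY'.
have bF : bmeas (fun w => dotp (gK (x - Y w) - gK (x' - Y' w)) u).
  by apply: bmeas_dotp; [apply: bvecB; exact: bvec_gK|exact: bvec_cst].
have h1 : - Ex P (fun w => dotp (gK (x - Y w) - gK (x' - Y' w)) u) <=
    Ex P (fun w => (e / 2 + 2 * A * enorm (x - x') ^+ 2) * enorm u +
      (2 * A * enorm u) * enorm (Y w - Y' w) ^+ 2).
  rewrite -ExN//; apply: Ex_le.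
  - exact: bmeasN.
  - by apply: bmeasD; [exact: bmeas_cst|exact: bmeasZ].
  - move=> w; rewrite -dotpNl; apply: le_trans (dotp_le_enorm _ _) _; rewrite enormN.
    have Yw := bY.2 w; have Yw' := bY'.2 w.
    have := hA _ _ (diff_set_in Dx Yw) (diff_set_in Dx' Yw').
    have -> : x - Y w - (x' - Y' w) = (x - x') - (Y w - Y' w).
      exact: subrACA_rV.
    have := enorm_sqrD (x - x') (- (Y w - Y' w)); rewrite enormN => h2 h3.
    have h4 : enorm (gK (x - Y w) - gK (x' - Y' w)) <=
        e / 2 + 2 * A * enorm (x - x') ^+ 2 + 2 * A * enorm (Y w - Y' w) ^+ 2.
      by apply: le_trans h3 _; have := ler_wpM2l A0 h2; lra.
    by apply: le_trans (ler_wpM2r (enorm_ge0 u) h4) _; lra.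
rewrite ExD ?Ex_cst ?ExZ// in h1; last 2 first.
  exact: bmeas_cst.
  exact: bmeasZ.
have h2 : - dotp (gV x - gV x') u <= (e / 2 + B * enorm (x - x') ^+ 2) * enorm u.
  rewrite -dotpNl; apply: le_trans (dotp_le_enorm _ _) _; rewrite enormN.
  by apply: ler_wpM2r; [exact: enorm_ge0|exact: hB].
have BE : 0 <= B * E * enorm u by rewrite !mulr_ge0 ?enorm_ge0.
rewrite -/E in h1; lra.
Qed.

Lemma drift_bounded : exists2 C, 0 <= C & forall Y x, rvD Y -> D x -> enorm (drift Y x) <= C.
Proof.
have [M M0 hM] := compact_enorm_bounded cU gKc.
have [N N0 hN] := compact_enorm_bounded cD gVc.
exists (M + N) => [|Y x bY Dx]; first exact: addr_ge0.
apply: enorm_dual => [|u]; first exact: addr_ge0.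
rewrite dotp_drift// mulrDl lerD//.
  rewrite -ExN; last by apply: bmeas_dotp; [exact: bvec_gK|exact: bvec_cst].
  rewrite -[leRHS](Ex_cst P); apply: Ex_le.
  - by apply: bmeasN; apply: bmeas_dotp; [exact: bvec_gK|exact: bvec_cst].
  - exact: bmeas_cst.
  - move=> w; rewrite -dotpNl; apply: le_trans (dotp_le_enorm _ _) _; rewrite enormN.
    by apply: ler_wpM2r; [exact: enorm_ge0|apply/hM/diff_set_in => //; exact: bY.2].
rewrite -dotpNl; apply: le_trans (dotp_le_enorm _ _) _; rewrite enormN.
by apply: ler_wpM2r; [exact: enorm_ge0|exact: hN].
Qed.

Lemma drift_continuous Y : rvD Y -> {within D, continuous (drift Y)}.
Proof.
move=> bY; apply: enorm_within_continuous => x Dx e e0.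
have e2 : 0 < e / 2 by rewrite divr_gt0.
have [A A0 hA] := drift_modulus e2.
have A1 : 0 < A + 1 by rewrite ltr_pwDr.
exists (Num.min 1 (e / 2 / (A + 1))); first by rewrite lt_min ltr01 !divr_gt0.
move=> y Dy; rewrite lt_min => /andP[y1 y2].
apply: le_lt_trans (hA _ _ _ _ bY bY Dy Dx) _.
under eq_fun do rewrite subrr enorm0 expr0n.
rewrite Ex_cst addr0 [ltRHS]splitr ltrD2l.
apply: (@le_lt_trans _ _ ((A + 1) * enorm (y - x))); last by rewrite mulrC -ltr_pdivlMr.
have n0 := enorm_ge0 (y - x).
have : enorm (y - x) ^+ 2 <= enorm (y - x).
  by rewrite expr2 -[leRHS]mulr1; apply: ler_wpM2l => //; exact: ltW.
by move=> /(ler_wpM2l A0); lra.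
Qed.

Lemma bvec_drift Y Y' : rvD Y -> rvD Y' -> bvec (fun w => drift Y (Y' w)).
Proof. by move=> bY [mY' Y'D]; exact: (bvec_comp cD (drift_continuous bY)). Qed.

Let L := - (Num.min 0 lamK + Num.min 0 lamV).

Lemma drift_rate_ge0 : 0 <= L.
Proof. by rewrite /L oppr_ge0 -[leRHS]addr0 lerD// ge_min lexx. Qed.

Lemma gK_monotone p q : diff_set D p -> diff_set D q ->
  Num.min 0 lamK * enorm (p - q) ^+ 2 <= dotp (gK p - gK q) (p - q).
Proof.
move=> Up Uq; apply: le_trans (gKm Up Uq); apply: ler_wpM2r; first exact: sqr_ge0.
by rewrite ge_min lexx orbT.
Qed.

Lemma gV_monotone p q : D p -> D q ->
  Num.min 0 lamV * enorm (p - q) ^+ 2 <= dotp (gV p - gV q) (p - q).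
Proof.
move=> Up Uq; apply: le_trans (gVm Up Uq); apply: ler_wpM2r; first exact: sqr_ge0.
by rewrite ge_min lexx orbT.
Qed.

Lemma drift_one_sided Y x x' : rvD Y -> D x -> D x' ->
  dotp (drift Y x - drift Y x') (x - x') <= L * enorm (x - x') ^+ 2.
Proof.
move=> bY Dx Dx'; rewrite dotp_driftB//.
have bF : bmeas (fun w => dotp (gK (x - Y w) - gK (x' - Y w)) (x - x')).
  by apply: bmeas_dotp; [apply: bvecB; exact: bvec_gK|exact: bvec_cst].
have : Ex P (fun=> Num.min 0 lamK * enorm (x - x') ^+ 2) <=
    Ex P (fun w => dotp (gK (x - Y w) - gK (x' - Y w)) (x - x')).
  apply: Ex_le => // [|w]; first exact: bmeas_cst.
  have Yw := bY.2 w.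
  have -> : x - x' = (x - Y w) - (x' - Y w) by rewrite opprB addrA subrK.
  by apply: gK_monotone; exact: diff_set_in.
rewrite Ex_cst /L; have := gV_monotone Dx Dx'; lra.
Qed.

(** For fixed points there is no exchange of copies. Moving the point under a fixed law is one-sided
    Lipschitz; changing the law at a fixed point is charged to the modulus, multiplied by the
    diameter of D. *)
Lemma drift_pathwise e : 0 < e -> exists2 A, 0 <= A & forall Y Y' x x',
  rvD Y -> rvD Y' -> D x -> D x' ->
  dotp (drift Y x - drift Y' x') (x - x') <= L * enorm (x - x') ^+ 2 +
    e + A * Ex P (fun w => enorm (Y w - Y' w) ^+ 2).
Proof.
move=> e0; have [M M0 hM] := compact_diameter.
have M1 : 0 < M + 1 by rewrite ltr_pwDr.
have [A A0 hA] := drift_modulus (divr_gt0 e0 M1).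
exists (A * (M + 1)); first by rewrite mulr_ge0// ltW.
move=> Y Y' x x' bY bY' Dx Dx'.
have -> : drift Y x - drift Y' x' = (drift Y x - drift Y x') + (drift Y x' - drift Y' x').
  by rewrite addrA subrK.
rewrite dotpDl -addrA lerD//; first exact: drift_one_sided.
apply: le_trans (dotp_le_enorm _ _) _.
have := hA _ _ _ _ bY bY' Dx' Dx'; rewrite subrr enorm0 expr0n add0r.
set E := Ex P _; set a := enorm _ => ha.
have a0 : 0 <= a by exact: enorm_ge0.
have E0 : 0 <= E by apply: Ex_ge0 => w; exact: sqr_ge0.
apply: (@le_trans _ _ ((e / (M + 1) + A * E) * (M + 1))).
  apply: ler_pM => //; first exact: enorm_ge0.
  by apply: le_trans (hM _ _ Dx Dx') _; rewrite lerDl.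
by rewrite mulrDl divfK ?gt_eqF//; lra.
Qed.

(* Exchanging the two copies symmetrises the interaction; the cross term
   |E Z|^2 that appears is discarded, which is harmless as min(0, lamK) <= 0. *)
Lemma drift_monotone Y Y' : rvD Y -> rvD Y' ->
  Ex P (fun w => dotp (drift Y (Y w) - drift Y' (Y' w)) (Y w - Y' w)) <=
  L * Ex P (fun w => enorm (Y w - Y' w) ^+ 2).
Proof.
have aux (a s f e : R) : a <= 0 -> a * s <= 2 * f -> s <= 2 * e -> a * e <= f.
  by move=> a0 h1 h2; have := ler_wnM2l a0 h2; lra.
move=> bY bY'; pose Z w := Y w - Y' w.
have bZ : bvec Z by apply: bvecB; exact: rvD_bvec.
have bZi i := bmeas_coord i bZ.
pose k (z : T * T) := gK (Y z.1 - Y z.2) - gK (Y' z.1 - Y' z.2).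
have mfst (f : T -> 'rV[R]_d) : bvec f -> bvec (fun z : T * T => f z.1).
  move=> [mf [M fM]]; split; last by exists M.
  exact: (measurableT_comp mf measurable_fst).
have msnd (f : T -> 'rV[R]_d) : bvec f -> bvec (fun z : T * T => f z.2).
  move=> [mf [M fM]]; split; last by exists M.
  exact: (measurableT_comp mf measurable_snd).
have bgK (X : T -> 'rV[R]_d) : rvD X -> bvec (fun z : T * T => gK (X z.1 - X z.2)).
  move=> bX; apply: (bvec_comp cU gKc) => [|z]; last by apply: diff_set_in; exact: bX.2.
  by have [] := bvecB (mfst _ (rvD_bvec bX)) (msnd _ (rvD_bvec bX)).
have bk : bvec k by apply: bvecB; exact: bgK.
pose F (z : T * T) := dotp (k z) (Z z.1).
pose G (z : T * T) := dotp (k z) (Z z.2).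
have bF : bmeas F by apply: bmeas_dotp => //; exact: mfst.
have bG : bmeas G by apply: bmeas_dotp => //; exact: msnd.
have kN w w' : k (w', w) = - k (w, w').
  rewrite /k /= -(opprB (Y w)) -(opprB (Y' w)) !gKodd ?opprD//.
    by apply: diff_set_in; exact: bY'.2.
  by apply: diff_set_in; exact: bY.2.
have FG w w' : F (w', w) = - G (w, w') by rewrite /F /G /= kN dotpNl.
(* The kernel k is antisymmetric, so renaming the copies turns F into -G. Thus 2 EE F = EE (F - G)
   pairs k with Z w - Z w', exactly the increment to which monotonicity of [gK] applies. *)
have swap : Ex P (fun w => Ex P (fun w' => F (w, w'))) =
    - Ex P (fun w => Ex P (fun w' => G (w, w'))).
  rewrite (Ex_Fubini P bF) -ExN; last exact: bmeas_Ex.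
  congr (Ex P _); apply/funext => w; rewrite -ExN; last exact: bmeas_slice bG.
  by congr (Ex P _); apply/funext => w'; rewrite FG.
pose S (z : T * T) := enorm (Z z.1 - Z z.2) ^+ 2.
have bS : bmeas S by apply: bmeas_enorm_sqr; apply: bvecB; [exact: mfst|exact: msnd].
have sym : Num.min 0 lamK * Ex P (fun w => Ex P (fun w' => S (w, w'))) <=
    2 * Ex P (fun w => Ex P (fun w' => F (w, w'))).
  have -> : 2 * Ex P (fun w => Ex P (fun w' => F (w, w'))) =
      Ex P (fun w => Ex P (fun w' => F (w, w') - G (w, w'))).
    rewrite mulr_natl mulr2n {2}swap -ExB; [|exact: bmeas_Ex..].
    congr (Ex P _); apply/funext => w; rewrite ExB//; exact: bmeas_slice.
  rewrite -ExZ; last exact: bmeas_Ex.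
  have bFG : bmeas (fun z => F z - G z) by exact: bmeasB.
  apply: Ex_le; [by apply: bmeasZ; exact: bmeas_Ex|exact: (bmeas_Ex P bFG)|move=> w].
  rewrite -ExZ; last exact: bmeas_slice bS.
  apply: Ex_le; [by apply: bmeasZ; exact: bmeas_slice bS|exact: (bmeas_slice w bFG)|move=> w'].
  rewrite /F /G -dotpNr -dotpDr /S /k /=.
  have -> : Z w - Z w' = (Y w - Y w') - (Y' w - Y' w').
    exact: subrACA_rV.
  by apply: gK_monotone; apply: diff_set_in; (exact: bY.2 || exact: bY'.2).
pose E := Ex P (fun w => enorm (Z w) ^+ 2).
have bZ2 : bmeas (fun w => enorm (Z w) ^+ 2) by exact: bmeas_enorm_sqr.
have SE : Ex P (fun w => Ex P (fun w' => S (w, w'))) <= 2 * E.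
  (* The variance identity: for independent copies, E|Z - Z'|^2 = 2 E|Z|^2 - 2 |E Z|^2. *)
  have -> : Ex P (fun w => Ex P (fun w' => S (w, w'))) =
      2 * E - 2 * \sum_(i < d) Ex P (fun w => Z w 0 i) ^+ 2.
    have inner w : Ex P (fun w' => S (w, w')) =
        enorm (Z w) ^+ 2 + E - 2 * \sum_(i < d) Z w 0 i * Ex P (fun w' => Z w' 0 i).
      have -> : (fun w' => S (w, w')) = (fun w' => enorm (Z w) ^+ 2 + enorm (Z w') ^+ 2 -
          2 * \sum_(i < d) Z w 0 i * Z w' 0 i).
        apply/funext => w'; rewrite /S /= !enorm_sqr; move: (Z w) (Z w') => a b.
        rewrite !dotpE (dotpC b a) /dotp; ring.
      rewrite ExB ?ExD ?Ex_cst ?ExZ ?Ex_sum//.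
      - by congr (_ - 2 * _); apply: eq_bigr => i _; rewrite ExZ.
      - by move=> i; exact: bmeasZ.
      - by apply: bmeas_sum => i; exact: bmeasZ.
      - exact: bmeas_cst.
      - by apply: bmeasD => //; exact: bmeas_cst.
      - by apply: bmeasZ; apply: bmeas_sum => i; exact: bmeasZ.
    under eq_fun do rewrite inner.
    have bZc i c : bmeas (fun w => Z w 0 i * c).
      by under eq_fun do rewrite mulrC; exact: bmeasZ.
    rewrite ExB ?ExD ?Ex_cst ?ExZ ?Ex_sum//.
    - rewrite -/E [2 * E]mulr_natl mulr2n; congr (_ - 2 * _); apply: eq_bigr => i _.
      by under eq_fun do rewrite mulrC; rewrite ExZ// expr2.
    - exact: bmeas_sum.
    - exact: bmeas_cst.
    - by apply: bmeasD => //; exact: bmeas_cst.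
    - by apply: bmeasZ; exact: bmeas_sum.
  by rewrite gerBl mulr_ge0// sumr_ge0// => i _; exact: sqr_ge0.
have K0 : Num.min 0 lamK <= 0 by rewrite ge_min lexx.
have step : Num.min 0 lamK * E <= Ex P (fun w => Ex P (fun w' => F (w, w'))).
  exact: aux K0 sym SE.
have bV : bmeas (fun w => dotp (gV (Y w) - gV (Y' w)) (Z w)).
  by apply: bmeas_dotp => //; apply: bvecB; apply: (bvec_comp cD gVc); case: bY; case: bY'.
have -> : (fun w => dotp (drift Y (Y w) - drift Y' (Y' w)) (Y w - Y' w)) =
    (fun w => - Ex P (fun w' => F (w, w')) - dotp (gV (Y w) - gV (Y' w)) (Z w)).
  by apply/funext => w; rewrite dotp_driftB//; [exact: bY.2|exact: bY'.2].
rewrite ExB//; last by apply: bmeasN; exact: bmeas_Ex.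
rewrite ExN; last exact: bmeas_Ex.
have stepV : Num.min 0 lamV * E <= Ex P (fun w => dotp (gV (Y w) - gV (Y' w)) (Z w)).
  rewrite -ExZ//; apply: Ex_le => //; first exact: bmeasZ.
  by move=> w; apply: gV_monotone; [exact: bY.2|exact: bY'.2].
by rewrite /L opprD mulrDl !mulNr lerD// lerN2.
Qed.

End Drift.

(** * Gronwall estimates *)

Section Gronwall.
Context {R : realType}.

Lemma discrete_gronwall (q r : R) (a : nat -> R) n :
  0 <= q -> 0 <= r -> 0 <= a 0%N ->
  (forall j, (j < n)%N -> a j.+1 <= (1 + q) * a j + r) ->
  a n <= expR (q * n%:R) * (a 0%N + n%:R * r).
Proof.
move=> q0 r0 a0 step.
have q1 : 1 <= 1 + q by rewrite lerDl.
(* The new error r is absorbed because (1 + q)^(j+1) >= 1. *)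
have main j : (j <= n)%N -> a j <= (1 + q) ^+ j * (a 0%N + j%:R * r).
  elim: j => [|j IH] jn; first by rewrite expr0 mul1r mul0r addr0.
  apply: le_trans (step j jn) _.
  have := IH (ltnW jn) => /(ler_wpM2l (le_trans ler01 q1)) h.
  have h2 : 1 <= (1 + q) ^+ j.+1 by exact: exprn_ege1.
  rewrite exprS -[j.+1]addn1 natrD in h2 *.
  have := ler_wpM2r r0 h2; rewrite mul1r; lra.
apply: le_trans (main n (leqnn n)) _; apply: ler_wpM2r.
  by rewrite addr_ge0// mulr_ge0.
rewrite mulrC expRM_natl lerXn2r ?nnegrE ?expR_ge0//.
  exact: le_trans ler01 q1.
exact: expR_ge1Dx.
Qed.

(** With N equal steps of length h, the errors add up to about tau k, C^2 tau^2 / N and N eps. After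
    multiplication by M = e^(2 tau L) each is given a third of eta: k depends on eta alone, N also
    on h0, and eps0 on N. All choices precede the function [a], so the bound is uniform over it. *)
Lemma approximate_gronwall (L C tau eta : R) : 0 <= L -> 0 <= C -> 0 <= tau -> 0 < eta ->
  exists2 k, 0 < k & forall h0, 0 < h0 -> exists2 eps0, 0 < eps0 &
  forall eps, 0 <= eps -> eps <= eps0 -> forall a : R -> R, 0 <= a 0 ->
    (forall s t, 0 <= s -> s <= t -> t <= tau -> t - s <= h0 ->
      a t <= a s + 2 * (t - s) * (L * a s) +
        4 * ((t - s) * k + eps) + 4 * (C * (t - s) + eps) ^+ 2) ->
  forall t, 0 <= t -> t <= tau -> a t <= expR (2 * t * L) * a 0 + eta.
Proof.
move=> L0 C0 tau0 eta0; pose M := expR (2 * tau * L).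
have M1 : 1 <= M by rewrite -expR0 ler_expR !mulr_ge0.
have M0 : 0 < M by exact: lt_le_trans ltr01 M1.
have tau1 : 0 < tau + 1 by rewrite ltr_pwDr.
(* The accumulated linear error is 4 tau k, and 12 = 3 * 4; [tau + 1] allows tau = 0. *)
exists (eta / (12 * M * (tau + 1))); first by rewrite divr_gt0// !mulr_gt0.
set k := eta / _ => h0 h00.
have k0 : 0 <= k by rewrite divr_ge0// ltW// !mulr_gt0.
have Mk : M * (4 * (tau * k)) <= eta / 3.
  have : k * (12 * M * (tau + 1)) = eta by rewrite divfK// gt_eqF// !mulr_gt0.
  have : 0 <= k * M by rewrite mulr_ge0// ltW.
  lra.
(* The first summand forces h <= h0, the second brings M * 8 C^2 tau^2 / N below eta / 3. *)
pose X := tau / h0 + 24 * C ^+ 2 * tau ^+ 2 * M / eta.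
have X1 : 0 <= 24 * C ^+ 2 * tau ^+ 2 * M / eta.
  by rewrite divr_ge0 ?(ltW eta0)// !mulr_ge0 ?sqr_ge0// ltW.
have X2 : 0 <= tau / h0 by rewrite divr_ge0// ltW.
pose N := (Num.truncn X).+1.
have NX : X < N%:R by exact: truncnS_gt.
have N0 : (0 : R) < N%:R by rewrite ltr0n.
have Nh : tau <= N%:R * h0.
  by rewrite -ler_pdivrMr//; apply: le_trans (ltW NX); rewrite lerDl.
have NC : M * (8 * C ^+ 2 * tau ^+ 2 / N%:R) <= eta / 3.
  rewrite mulrA ler_pdivrMr//.
  have : 24 * C ^+ 2 * tau ^+ 2 * M / eta <= N%:R.
    by apply: le_trans (ltW NX); rewrite lerDr.
  rewrite ler_pdivrMr//; lra.
(* Since eps <= 1 gives eps^2 <= eps, a step costs 4 eps + 8 eps, in total 12 N eps; 36 = 3 * 12. *)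
pose e0 := Num.min 1 (eta / (36 * M * N%:R)).
have e00 : 0 < e0 by rewrite lt_min ltr01 divr_gt0// !mulr_gt0.
exists e0 => // eps eps0 epse a a0 step t t0 tt.
have eps1 : eps <= 1 by apply: le_trans epse _; rewrite ge_min lexx.
have Ne : M * (12 * N%:R * eps) <= eta / 3.
  have : eps <= eta / (36 * M * N%:R) by apply: le_trans epse _; rewrite ge_min lexx orbT.
  rewrite ler_pdivlMr ?mulr_gt0//; lra.
pose h := t / N%:R.
have hh : 0 <= h by rewrite divr_ge0// ltW.
have hN : h * N%:R = t by rewrite divfK// gt_eqF.
have h_h0 : h <= h0 by rewrite ler_pdivrMr//; apply: le_trans tt _; rewrite mulrC.
pose r := 4 * (h * k + eps) + 4 * (C * h + eps) ^+ 2.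
have r0 : 0 <= r.
  by apply: addr_ge0; apply: mulr_ge0 => //; rewrite ?sqr_ge0 ?addr_ge0// mulr_ge0.
have q0 : 0 <= 2 * h * L by rewrite !mulr_ge0.
have := @discrete_gronwall (2 * h * L) r (fun j => a (j%:R * h)) N q0 r0.
rewrite mul0r => /(_ a0) H.
have {}H : a (N%:R * h) <= expR (2 * h * L * N%:R) * (a 0 + N%:R * r).
  apply: H => j jN.
  have jh : j.+1%:R * h - j%:R * h = h.
    by rewrite -mulrBl -natrB// subSnn mul1r.
  have := step (j%:R * h) (j.+1%:R * h); rewrite jh => /(_ _ _ _ h_h0) H.
  have : a (j.+1%:R * h) <= a (j%:R * h) + 2 * h * (L * a (j%:R * h)) +
      4 * (h * k + eps) + 4 * (C * h + eps) ^+ 2.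
    apply: H; first by rewrite mulr_ge0.
    - by rewrite ler_wpM2r// ler_nat.
    - apply: le_trans tt; rewrite -hN mulrC; apply: ler_wpM2l => //.
      by rewrite ler_nat.
  rewrite /r; lra.
rewrite mulrC hN in H.
have -> : expR (2 * t * L) = expR (2 * h * L * N%:R) by rewrite -hN; congr expR; ring.
apply: le_trans H _; rewrite mulrDr lerD2l.
have EM : expR (2 * h * L * N%:R) <= M.
  rewrite ler_expR (_ : 2 * h * L * N%:R = 2 * t * L); last by rewrite -hN; ring.
  by apply: ler_wpM2r => //; apply: ler_wpM2l.
have Nr0 : 0 <= N%:R * r by rewrite mulr_ge0// ltW.
apply: le_trans (ler_wpM2r Nr0 EM) _.
have Nr : N%:R * r <= 4 * (tau * k) + 8 * C ^+ 2 * tau ^+ 2 / N%:R + 12 * N%:R * eps.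
  have sq : (C * h + eps) ^+ 2 <= 2 * C ^+ 2 * h ^+ 2 + 2 * eps.
    have : eps ^+ 2 <= eps by rewrite expr2 -[leRHS]mulr1 ler_wpM2l.
    have := sqr_ge0 (C * h - eps); rewrite sqrrB sqrrD exprMn; lra.
  have h2 : N%:R * (C ^+ 2 * h ^+ 2) <= C ^+ 2 * tau ^+ 2 / N%:R.
    rewrite ler_pdivlMr// (_ : N%:R * (C ^+ 2 * h ^+ 2) * N%:R = C ^+ 2 * (h * N%:R) ^+ 2); last ring.
    by rewrite hN; apply: ler_wpM2l; [exact: sqr_ge0|rewrite ler_pXn2r].
  have h3 : N%:R * (h * k) <= tau * k.
    by rewrite mulrA (mulrC _ h) hN; apply: ler_wpM2r.
  have h4 := ler_wpM2l (ltW N0) sq.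
  rewrite /r; lra.
apply: le_trans (ler_wpM2l (ltW M0) Nr) _; lra.
Qed.

End Gronwall.

(** * Stability of approximate solutions, in mean and along paths *)

Section MeanFieldDrift.
Context {R : realType} {d : nat} (D : set 'rV[R]_d) {disp : measure_display}
  {T : measurableType disp} (P : probability T R).

(** What the comparison arguments require of the drift. It is stated over an arbitrary probability
    space because it is instantiated twice: on the given sample space, and on the state space
    carrying the law of the initial datum. *)
Record mean_field_drift (L C : R) (b : (T -> 'rV[R]_d) -> 'rV[R]_d -> 'rV[R]_d) : Prop :=
  MeanFieldDrift {
    mfd_rate : 0 <= L;
    mfd_speed : 0 <= C;
    mfd_bounded : forall (Y : T -> 'rV[R]_d) x, rvD D Y -> D x -> enorm (b Y x) <= C;
    mfd_modulus : forall e, 0 < e -> exists2 A, 0 <= A &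
      forall (Y Y' : T -> 'rV[R]_d) (x x' : 'rV[R]_d),
      rvD D Y -> rvD D Y' -> D x -> D x' -> enorm (b Y x - b Y' x') <=
        e + A * (enorm (x - x') ^+ 2 + Ex P (fun w => enorm (Y w - Y' w) ^+ 2));
    mfd_monotone : forall Y Y' : T -> 'rV[R]_d, rvD D Y -> rvD D Y' ->
      Ex P (fun w => dotp (b Y (Y w) - b Y' (Y' w)) (Y w - Y' w)) <=
      L * Ex P (fun w => enorm (Y w - Y' w) ^+ 2);
    mfd_pathwise : forall e, 0 < e -> exists2 A, 0 <= A &
      forall (Y Y' : T -> 'rV[R]_d) (x x' : 'rV[R]_d),
      rvD D Y -> rvD D Y' -> D x -> D x' ->
      dotp (b Y x - b Y' x') (x - x') <= L * enorm (x - x') ^+ 2 +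
        e + A * Ex P (fun w => enorm (Y w - Y' w) ^+ 2);
    mfd_bvec : forall Y Y' : T -> 'rV[R]_d, rvD D Y -> rvD D Y' -> bvec (fun w => b Y (Y' w)) }.

Context (L C : R) (b : (T -> 'rV[R]_d) -> 'rV[R]_d -> 'rV[R]_d)
  (Hb : mean_field_drift L C b) (cD : compact D).
Implicit Types (Y : R -> T -> 'rV[R]_d).

(* A variational-inequality formulation, with additive slack [eps], shared by
   the Euler scheme and by the solutions of the projected equation. *)
Definition approx_path (tau h0 k eps : R) Y w :=
  forall s t, 0 <= s -> s <= t -> t <= tau -> t - s <= h0 ->
    enorm (Y t w - Y s w) <= C * (t - s) + eps /\
    forall z, D z -> dotp (Y t w - Y s w - (t - s) *: b (Y s) (Y s w)) (Y s w - z) <=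
      (t - s) * k + eps.

(** Each inequality is tested at the position of the other path at time s, and the square of the
    distance is expanded. The cross term collects both slacks twice, and the increments differ by at
    most 2 (C (t - s) + eps); both factors 4 come from here. *)
Lemma approx_path_step tau h0 k eps Y Y' w s t :
  approx_path tau h0 k eps Y w -> approx_path tau h0 k eps Y' w ->
  D (Y s w) -> D (Y' s w) -> 0 <= s -> s <= t -> t <= tau -> t - s <= h0 ->
  enorm (Y t w - Y' t w) ^+ 2 <= enorm (Y s w - Y' s w) ^+ 2 +
    2 * (t - s) * dotp (b (Y s) (Y s w) - b (Y' s) (Y' s w)) (Y s w - Y' s w) +
    4 * ((t - s) * k + eps) + 4 * (C * (t - s) + eps) ^+ 2.
Proof.
move=> hY hY' DY DY' s0 st tt th.
have [n1 /(_ _ DY') v1] := hY s t s0 st tt th.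
have [n2 /(_ _ DY) v2] := hY' s t s0 st tt th.
have dn : enorm ((Y t w - Y s w) - (Y' t w - Y' s w)) <= 2 * (C * (t - s) + eps).
  by apply: le_trans (enormD _ _) _; rewrite enormN; lra.
have dn2 : enorm ((Y t w - Y s w) - (Y' t w - Y' s w)) ^+ 2 <= 4 * (C * (t - s) + eps) ^+ 2.
  rewrite (_ : 4 * _ ^+ 2 = (2 * (C * (t - s) + eps)) ^+ 2); last by ring.
  by rewrite ler_pXn2r ?nnegrE ?enorm_ge0//; exact: le_trans (enorm_ge0 _) dn.
have -> : Y t w - Y' t w = (Y s w - Y' s w) + ((Y t w - Y s w) - (Y' t w - Y' s w)).
  by apply/rowP => i; rewrite !mxE; ring.
have -> : forall u v : 'rV[R]_d, enorm (u + v) ^+ 2 = enorm u ^+ 2 + 2 * dotp v u + enorm v ^+ 2.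
  by move=> u v; rewrite !enorm_sqr !dotpE (dotpC u v); ring.
have key : dotp (Y t w - Y s w - (Y' t w - Y' s w)) (Y s w - Y' s w) =
  dotp (Y t w - Y s w - (t - s) *: b (Y s) (Y s w)) (Y s w - Y' s w) +
  dotp (Y' t w - Y' s w - (t - s) *: b (Y' s) (Y' s w)) (Y' s w - Y s w) +
  (t - s) * dotp (b (Y s) (Y s w) - b (Y' s) (Y' s w)) (Y s w - Y' s w).
  move: (Y t w - Y s w) (Y' t w - Y' s w) (b (Y s) _) (b (Y' s) _) => u v p q.
  by rewrite -(opprB (Y s w) (Y' s w)); move: (Y s w - Y' s w) => x; rewrite !dotpE; ring.
rewrite key; lra.
Qed.

Lemma mean_stability tau eta : 0 <= tau -> 0 < eta ->
  exists2 k, 0 < k & forall h0, 0 < h0 -> exists2 eps0, 0 < eps0 &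
  forall eps, 0 <= eps -> eps <= eps0 -> forall Y Y',
    (forall t, 0 <= t -> t <= tau -> rvD D (Y t)) ->
    (forall t, 0 <= t -> t <= tau -> rvD D (Y' t)) ->
    {ae P, forall w, approx_path tau h0 k eps Y w} ->
    {ae P, forall w, approx_path tau h0 k eps Y' w} ->
  forall t, 0 <= t -> t <= tau ->
    Ex P (fun w => enorm (Y t w - Y' t w) ^+ 2) <=
    expR (2 * t * L) * Ex P (fun w => enorm (Y 0 w - Y' 0 w) ^+ 2) + eta.
Proof.
move=> tau0 eta0.
have [k k0 H] := approximate_gronwall (mfd_rate Hb) (mfd_speed Hb) tau0 eta0.
exists k => // h0 h00; have [eps0 eps00 {}H] := H h0 h00.
exists eps0 => // eps e0 ee Y Y' rY rY' aY aY'.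
apply: (H eps e0 ee (fun t => Ex P (fun w => enorm (Y t w - Y' t w) ^+ 2))).
  by apply: Ex_ge0 => w; exact: sqr_ge0.
move=> s t s0 st tt th.
have stau : s <= tau by exact: le_trans st tt.
have t0 : 0 <= t by exact: le_trans s0 st.
have bs := bmeas_dist cD (rY s s0 stau) (rY' s s0 stau).
have bt := bmeas_dist cD (rY t t0 tt) (rY' t t0 tt).
have bb : bmeas (fun w => dotp (b (Y s) (Y s w) - b (Y' s) (Y' s w)) (Y s w - Y' s w)).
  apply: bmeas_dotp; apply: bvecB; try exact: rvD_bvec (rY s s0 stau);
    try exact: rvD_bvec (rY' s s0 stau).
  by apply: (mfd_bvec Hb); exact: rY.
  by apply: (mfd_bvec Hb); exact: rY'.
apply: (@le_trans _ _ (Ex P (fun w => enorm (Y s w - Y' s w) ^+ 2 +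
    2 * (t - s) * dotp (b (Y s) (Y s w) - b (Y' s) (Y' s w)) (Y s w - Y' s w) +
    (4 * ((t - s) * k + eps) + 4 * (C * (t - s) + eps) ^+ 2)))).
  apply: Ex_le_ae => //.
    by apply: bmeasD; [apply: bmeasD => //; exact: bmeasZ|exact: bmeas_cst].
  apply: filterS2 aY aY' => w hw hw'; rewrite addrA.
  by apply: (approx_path_step hw hw') => //; [exact: (rY s s0 stau).2|exact: (rY' s s0 stau).2].
have bbZ := bmeasZ (2 * (t - s)) bb.
rewrite ExD; [|exact: bmeasD bs bbZ|exact: bmeas_cst].
rewrite ExD// ExZ// Ex_cst.
rewrite addrA !lerD2r lerD2l; apply: ler_wpM2l; first by rewrite mulr_ge0// subr_ge0.
by apply: (mfd_monotone Hb); [exact: rY|exact: rY'].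
Qed.

(** Once the laws are within rho in mean square, their difference acts on each path as one more
    small rate, so Gronwall applies for each fixed w. *)
Lemma path_stability tau eta : 0 <= tau -> 0 < eta ->
  exists2 k, 0 < k & exists2 rho, 0 < rho & forall h0, 0 < h0 -> exists2 eps0, 0 < eps0 &
  forall eps, 0 <= eps -> eps <= eps0 -> forall Y Y',
    (forall t, 0 <= t -> t <= tau -> rvD D (Y t)) ->
    (forall t, 0 <= t -> t <= tau -> rvD D (Y' t)) ->
    (forall t, 0 <= t -> t <= tau -> Ex P (fun w => enorm (Y t w - Y' t w) ^+ 2) <= rho) ->
  forall w, approx_path tau h0 k eps Y w -> approx_path tau h0 k eps Y' w ->
  forall t, 0 <= t -> t <= tau ->
    enorm (Y t w - Y' t w) ^+ 2 <=
    expR (2 * t * L) * enorm (Y 0 w - Y' 0 w) ^+ 2 + eta.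
Proof.
move=> tau0 eta0.
have [k k0 H] := approximate_gronwall (mfd_rate Hb) (mfd_speed Hb) tau0 eta0.
(* The budget 4 (t - s) k of Gronwall is shared: the paths with slack k / 2 use half of it, and the
   error and law terms of the drift bound, each at most k / 2, use a quarter each. *)
have k2 : 0 < k / 2 by rewrite divr_gt0.
exists (k / 2) => //; have [A A0 hA] := mfd_pathwise Hb k2.
have A1 : 0 < A + 1 by rewrite ltr_pwDr.
exists (k / 2 / (A + 1)); first by rewrite divr_gt0.
move=> h0 h00; have [eps0 eps00 {}H] := H h0 h00.
exists eps0 => // eps e0 ee Y Y' rY rY' er w hw hw'.
apply: (H eps e0 ee (fun t => enorm (Y t w - Y' t w) ^+ 2)); first exact: sqr_ge0.
move=> s t s0 st tt th.
have stau : s <= tau by exact: le_trans st tt.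
have DY := (rY s s0 stau).2 w; have DY' := (rY' s s0 stau).2 w.
apply: le_trans (approx_path_step hw hw' DY DY' s0 st tt th) _.
have := hA _ _ _ _ (rY s s0 stau) (rY' s s0 stau) DY DY'.
have := er s s0 stau; set E := Ex P _; rewrite ler_pdivlMr// => hE.
have E0 : 0 <= E by apply: Ex_ge0 => w'; exact: sqr_ge0.
have ts : 0 <= 2 * (t - s) by rewrite mulr_ge0// subr_ge0.
move=> /(ler_wpM2l ts); have := ler_wpM2l ts hE; have := mulr_ge0 ts E0.
move: (dotp _ _) (enorm _) => u v; lra.
Qed.

End MeanFieldDrift.

(** * Euler scheme *)

(** Coordinatewise convergence is recorded as well, because measurability of the limit process is
    obtained coordinate by coordinate. *)
Lemma enorm_cauchy_cvg {R : realType} {d : nat} (u : nat -> 'rV[R]_d) :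
  (forall e, 0 < e -> exists N, forall n m, (N <= n)%N -> (N <= m)%N ->
     enorm (u n - u m) <= e) ->
  exists l : 'rV[R]_d, (forall i, u n 0 i @[n --> \oo] --> l 0 i) /\
    forall e, 0 < e -> exists N, forall n, (N <= n)%N -> enorm (u n - l) <= e.
Proof.
move=> cu.
have cvg_i i : exists li : R, u n 0 i @[n --> \oo] --> li.
  apply/cvg_ex; apply: (@cauchy_cvg R ((fun n => u n 0 i) @ \oo)); apply: cauchy_exP => e e0.
  have e2 : 0 < e / 2 by rewrite divr_gt0.
  have [N hN] := cu _ e2; exists (u N 0 i); exists N => // n /= Nn.
  rewrite /ball /=; have := normr_coord_le_enorm (u N - u n) i; rewrite !mxE => h.
  by have := hN N n (leqnn N) Nn; lra.
pose l : 'rV[R]_d := \row_i projT1 (cid (cvg_i i)).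
have li i : u n 0 i @[n --> \oo] --> l 0 i by rewrite mxE; case: cid.
exists l; split => // e e0.
have [N hN] := cu _ e0; exists N => n Nn.
have ed : 0 < e / d.+1%:R by rewrite divr_gt0.
apply/ler_addgt0Pr => e1 e10.
have ed1 : 0 < e1 / d.+1%:R by rewrite divr_gt0.
have : \forall m \near \oo, (N <= m)%N /\ forall i, `|l 0 i - u m 0 i| < e1 / d.+1%:R.
  near=> m; split; first by near: m; exact: nbhs_infty_ge.
  near: m; apply: filter_forall => i.
  by move/cvgrPdist_lt: (li i) => /(_ _ ed1).
move=> /filter_ex[m [Nm hm]].
have -> : u n - l = (u n - u m) + (u m - l) by rewrite addrA subrK.
apply: le_trans (enormD _ _) _; rewrite lerD//; first exact: hN.
rewrite enormB; apply: le_trans (@enorm_le_bound _ _ _ (e1 / d.+1%:R) _ _) _.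
- by move=> i; rewrite [(l - u m) 0 i]mxE [(- u m) 0 i]mxE; apply/ltW/hm.
- exact: ltW.
- rewrite mulrA ler_pdivrMr// mulrC; apply: ler_wpM2l; first exact: ltW.
  by rewrite ler_nat.
Unshelve. all: by end_near. Qed.

Section Euler.
Context {R : realType} {d : nat} (D : set 'rV[R]_d) {disp : measure_display}
  {T : measurableType disp} (P : probability T R).
Context (L C : R) (b : (T -> 'rV[R]_d) -> 'rV[R]_d -> 'rV[R]_d)
  (Hb : mean_field_drift D P L C b).
Hypotheses (cD : compact D) (vD : convex_set D) (D0 : D !=set0).
Context (X0 : T -> 'rV[R]_d) (rX0 : rvD D X0).

Fixpoint euler (dt : R) (j : nat) : T -> 'rV[R]_d :=
  if j is i.+1 then fun w => nearest D (euler dt i w + dt *: b (euler dt i) (euler dt i w))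
  else X0.

Lemma rvD_euler dt j : rvD D (euler dt j).
Proof.
elim: j => [//|j IH] /=; split; last first.
  move=> w; set y := euler dt j w + _.
  by have [] := nearestP y cD vD D0.
apply: (measurable_continuous_rV (nearest_continuous cD vD D0)).
apply: measurable_funD_rV; first exact: IH.1.
apply: measurable_funZ_rV; exact: (mfd_bvec Hb IH IH).1.
Qed.

(** The obtuse-angle property of the projection. It pairs with the new position, whereas
    [approx_path] pairs with the old one; the difference is paid for in [euler_path_approx]. *)
Lemma euler_variational dt j w z : D z ->
  dotp (euler dt j.+1 w - euler dt j w - dt *: b (euler dt j) (euler dt j w))
    (euler dt j.+1 w - z) <= 0.
Proof.
move=> Dz /=; set y := euler dt j w + _.
have [_ /(_ z Dz)] := nearestP y cD vD D0.
have -> : nearest D y - euler dt j w - dt *: b (euler dt j) (euler dt j w) =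
    - (y - nearest D y) by rewrite opprB -addrA -opprD.
by rewrite dotpNl -dotpNr opprB.
Qed.

Lemma euler_step dt j w : 0 <= dt -> enorm (euler dt j.+1 w - euler dt j w) <= dt * C.
Proof.
move=> dt0; have Dj := (rvD_euler dt j).2 w.
have := nearest_lipschitz (euler dt j w + dt *: b (euler dt j) (euler dt j w))
  (euler dt j w) cD vD D0.
rewrite (nearest_id cD vD Dj) => h; apply: le_trans h _.
rewrite addrAC subrr add0r enormZ ger0_norm// ler_wpM2l//.
by apply: (mfd_bounded Hb) => //; exact: rvD_euler.
Qed.

Lemma euler_lipschitz dt j i w : 0 <= dt ->
  enorm (euler dt (j + i) w - euler dt j w) <= i%:R * (dt * C).
Proof.
move=> dt0; elim: i => [|i IH]; first by rewrite addn0 subrr enorm0 mul0r.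
rewrite addnS -[X in X - _](subrK (euler dt (j + i) w)) -addrA.
apply: le_trans (enormD _ _) _; rewrite -[i.+1]add1n natrD mulrDl mul1r.
by rewrite lerD//; exact: euler_step.
Qed.

(** Piecewise constant in time; its jumps, of size at most dt * C, and the rounding of times to the
    grid are what the slack [eps] absorbs. *)
Definition euler_path dt (t : R) : T -> 'rV[R]_d := euler dt (Num.truncn (t / dt)).

(** The window h0 depends on k only and the mesh dt0 also on eps, which matches the order of
    quantifiers in the stability lemmas. *)
Lemma euler_path_approx k : 0 < k -> exists2 h0, 0 < h0 & forall eps, 0 < eps ->
  exists2 dt0, 0 < dt0 & forall dt, 0 < dt -> dt <= dt0 -> forall tau w,
    approx_path D C b tau h0 k eps (euler_path dt) w.
Proof.
move=> k0; have C0 := mfd_speed Hb.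
have [M M0 hM] := compact_diameter cD.
have M1 : 0 < M + 1 by rewrite ltr_pwDr.
have kap0 : 0 < k / 2 / (M + 1) by rewrite !divr_gt0.
have [A A0 hA] := mfd_modulus Hb kap0.
pose B := 4 * C ^+ 2 + 8 * A * C ^+ 2 * M.
have B0 : 0 <= B by rewrite addr_ge0// !mulr_ge0// sqr_ge0.
have B1 : 0 < B + 1 by rewrite ltr_pwDr.
pose h0 := Num.min 1 (k / 2 / (B + 1)).
have h00 : 0 < h0 by rewrite lt_min ltr01 !divr_gt0.
have h01 : h0 <= 1 by rewrite ge_min lexx.
have hB : h0 * (B + 1) <= k / 2.
  by rewrite -ler_pdivlMr// ge_min lexx orbT.
(* Error rate within a window: the first term moves the test point back to the start, the second
   freezes the drift there. The choice of h0 makes it at most k. *)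
pose q := 4 * C ^+ 2 * h0 + M * (k / 2 / (M + 1) + A * (2 * (2 * h0 * C) ^+ 2)).
have qk : q <= k.
  have h1 : M * (k / 2 / (M + 1)) <= k / 2.
    rewrite mulrA ler_pdivrMr//; lra.
  have h2 : h0 ^+ 2 <= h0 by rewrite expr2 -[leRHS]mulr1 ler_wpM2l// ltW.
  have h3 : 8 * A * C ^+ 2 * M * h0 ^+ 2 <= 8 * A * C ^+ 2 * M * h0.
    by apply: ler_wpM2l => //; rewrite !mulr_ge0// sqr_ge0.
  by move: hB; rewrite /q /B !exprMn; lra.
have q0 : 0 <= q.
  rewrite addr_ge0// ?mulr_ge0 ?sqr_ge0// ?(ltW h00)// addr_ge0 ?(ltW kap0)//.
  by do 2 apply: mulr_ge0 => //; exact: sqr_ge0.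
exists h0 => // eps eps0.
(* Coefficients of dt in the errors made by rounding s and t to the grid. *)
pose Q := k + C * M + C + 1.
have Q0 : 0 < Q by rewrite ltr_pwDr// !addr_ge0 ?mulr_ge0// ltW.
exists (Num.min h0 (eps / Q)); first by rewrite lt_min h00 divr_gt0.
move=> dt dt0; rewrite le_min => /andP[dth]; rewrite ler_pdivlMr// => dtQ tau w.
move=> s t s0 st tt th; rewrite /euler_path.
have s'0 : 0 <= s / dt by rewrite divr_ge0// ltW.
have t'0 : 0 <= t / dt by rewrite divr_ge0 ?(le_trans s0 st)// ltW.
set a := Num.truncn (s / dt); set l := Num.truncn (t / dt).
have al : (a <= l)%N by apply: le_truncn; apply: ler_wpM2r => //; rewrite invr_ge0 ltW.
have [i li] : exists i, l = (a + i)%N by exists (l - a)%N; rewrite subnKC.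
have := truncn_itv s'0; have := truncn_itv t'0; rewrite -/a -/l.
rewrite !ler_pdivlMr// !ltr_pdivrMr// => /andP[l1 l2] /andP[a1 a2].
have iE : i%:R * dt = l%:R * dt - a%:R * dt by rewrite li natrD mulrDl addrC addKr.
have SE (n : nat) : n.+1%:R * dt = n%:R * dt + dt by rewrite -[n.+1]addn1 natrD mulrDl mul1r.
rewrite !SE in l2 a2.
have i_ub : i%:R * dt <= t - s + dt by rewrite iE; lra.
have i_lb : t - s - dt <= i%:R * dt by rewrite iE; lra.
have kC0 : 0 <= k * dt by rewrite mulr_ge0// ltW.
have CC0 : 0 <= C * dt by rewrite mulr_ge0// ltW.
have CM0 : 0 <= C * M * dt by rewrite !mulr_ge0// ltW.
have Cdt : C * dt <= eps by move: dtQ; rewrite /Q; lra.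
have CMk : k * dt + C * M * dt <= eps by move: dtQ; rewrite /Q; lra.
(* The grid window has length at most t - s + dt, and both t - s and dt are at most h0. *)
have lip w' j : (j <= i)%N -> enorm (euler dt (a + j) w' - euler dt a w') <= 2 * h0 * C.
  move=> ji; apply: le_trans (euler_lipschitz _ _ _ (ltW dt0)) _.
  rewrite mulrA; apply: ler_wpM2r => //.
  have : j%:R * dt <= i%:R * dt by rewrite ler_wpM2r ?ler_nat// ltW.
  lra.
split.
  rewrite li; apply: le_trans (euler_lipschitz _ _ _ (ltW dt0)) _.
  have := ler_wpM2l C0 i_ub; lra.
move=> z Dz; rewrite li.
set va := b (euler dt a) (euler dt a w); set ya := euler dt a w.
have Dya : D ya by exact: (rvD_euler dt a).2.
have main j : (j <= i)%N ->
    dotp (euler dt (a + j) w - ya - (j%:R * dt) *: va) (ya - z) <= j%:R * dt * q.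
  elim: j => [|j IH] ji; first by rewrite addn0 subrr !mul0r scale0r subr0 dotp0l.
  rewrite addnS; set y' := euler dt (a + j).+1 w; set y := euler dt (a + j) w.
  set v := b (euler dt (a + j)) y.
  have Dy : D y by exact: (rvD_euler dt _).2.
  have Dy' : D y' by exact: (rvD_euler dt _).2.
  have -> : y' - ya - (j.+1%:R * dt) *: va =
      (y - ya - (j%:R * dt) *: va) + (y' - y - dt *: va).
    by rewrite SE scalerDl; apply/rowP => i'; rewrite !mxE; ring.
  rewrite dotpDl SE mulrDl lerD//; first exact: IH (ltnW ji).
  (* One step splits into the projection inequality at the new point y', the move of the test point
     from y' to ya, and the change of drift from v to va. *)
  have -> : dotp (y' - y - dt *: va) (ya - z) =
      dotp (y' - y - dt *: v) (y' - z) + dotp (y' - y - dt *: v) (ya - y') +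
      dt * dotp (v - va) (ya - z).
    by rewrite !dotpE; ring.
  have t1 : dotp (y' - y - dt *: v) (y' - z) <= 0 by exact: euler_variational.
  have t2 : dotp (y' - y - dt *: v) (ya - y') <= 2 * (dt * C) * (2 * h0 * C).
    apply: le_trans (dotp_le_enorm _ _) _; apply: ler_pM; rewrite ?enorm_ge0//.
      apply: le_trans (enormD _ _) _; rewrite enormN enormZ gtr0_norm//.
      have := euler_step (a + j) w (ltW dt0).
      have : enorm v <= C by apply: (mfd_bounded Hb) => //; exact: rvD_euler.
      move=> /(ler_wpM2l (ltW dt0)); rewrite -/y -/y'; lra.
    by rewrite enormB /y' -addnS; exact: lip.
  have t3 : dotp (v - va) (ya - z) <= (k / 2 / (M + 1) + A * (2 * (2 * h0 * C) ^+ 2)) * M.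
    apply: le_trans (dotp_le_enorm _ _) _; apply: ler_pM; rewrite ?enorm_ge0//; last exact: hM.
    apply: le_trans (hA _ _ _ _ (rvD_euler dt (a + j)) (rvD_euler dt a) Dy Dya) _.
    rewrite lerD2l; apply: ler_wpM2l => //.
    have sq w' : enorm (euler dt (a + j) w' - euler dt a w') ^+ 2 <= (2 * h0 * C) ^+ 2.
      rewrite ler_pXn2r ?nnegrE ?enorm_ge0//; first exact: (lip w' j (ltnW ji)).
      by rewrite !mulr_ge0// ltW.
    have : Ex P (fun w => enorm (euler dt (a + j) w - euler dt a w) ^+ 2) <= (2 * h0 * C) ^+ 2.
      rewrite -[leRHS](Ex_cst P); apply: Ex_le => //; last exact: bmeas_cst.
      by apply: (bmeas_dist cD); exact: rvD_euler.
    have := sq w; rewrite -/y -/ya; lra.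
  have := ler_wpM2l (ltW dt0) t3; rewrite /q; lra.
have := main i (leqnn i).
have -> : euler dt (a + i) w - ya - (t - s) *: va =
    (euler dt (a + i) w - ya - (i%:R * dt) *: va) + (i%:R * dt - (t - s)) *: va.
  by apply/rowP => i'; rewrite !mxE; ring.
move=> hm; rewrite dotpDl dotpZl.
have hc : (i%:R * dt - (t - s)) * dotp va (ya - z) <= dt * (C * M).
  apply: le_trans (ler_norm _) _; rewrite normrM; apply: ler_pM => //.
    by rewrite ler_norml; apply/andP; split; lra.
  apply: le_trans (dotp_le _ _) _; apply: ler_pM; rewrite ?enorm_ge0//; last exact: hM.
  by apply: (mfd_bounded Hb) => //; exact: rvD_euler.
have h5 := ler_wpM2r q0 i_ub.
have h6 : (t - s + dt) * q <= (t - s + dt) * k.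
  by apply: ler_wpM2l => //; lra.
lra.
Qed.

Let dt_ (n : nat) : R := n.+1%:R^-1.

Let dt_gt0 n : 0 < dt_ n. Proof. by rewrite /dt_ invr_gt0. Qed.

Let dt_small e : 0 < e -> exists N, forall n, (N <= n)%N -> dt_ n <= e.
Proof.
move=> e0; exists (Num.truncn e^-1) => n Nn.
rewrite /dt_ -[e]invrK lef_pV2 ?posrE ?invr_gt0//.
apply: le_trans (ltW (truncnS_gt _)) _; by rewrite ler_nat.
Qed.

Lemma rvD_euler_path dt t : rvD D (euler_path dt t).
Proof. exact: rvD_euler. Qed.

Lemma euler_path0 dt w : euler_path dt 0 w = X0 w.
Proof. by rewrite /euler_path mul0r truncn0. Qed.

(** [mean_stability] brings the laws of two schemes within the rho required by [path_stability]. All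
    schemes start at X0, so no initial error remains, and the estimate holds for every w, without an
    exceptional set. *)
Lemma euler_path_cauchy tau e : 0 <= tau -> 0 < e -> exists N, forall n m,
  (N <= n)%N -> (N <= m)%N -> forall t, 0 <= t -> t <= tau -> forall w,
  enorm (euler_path (dt_ n) t w - euler_path (dt_ m) t w) <= e.
Proof.
move=> tau0 e0; have e2 : 0 < e ^+ 2 by rewrite exprn_gt0.
have [k1 k10 [rho rho0 H1]] := path_stability Hb tau0 e2.
have [k2 k20 H2] := mean_stability Hb cD tau0 rho0.
have [h1 h10 E1] := euler_path_approx k10; have [eps1 eps10 {}H1] := H1 h1 h10.
have [h2 h20 E2] := euler_path_approx k20; have [eps2 eps20 {}H2] := H2 h2 h20.
have [d1 d10 {}E1] := E1 eps1 eps10; have [d2 d20 {}E2] := E2 eps2 eps20.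
have [N1 hN1] := dt_small d10; have [N2 hN2] := dt_small d20.
exists (maxn N1 N2) => n m; rewrite !geq_max => /andP[n1 n2] /andP[m1 m2] t t0 tt w.
have mean s : 0 <= s -> s <= tau ->
    Ex P (fun w => enorm (euler_path (dt_ n) s w - euler_path (dt_ m) s w) ^+ 2) <= rho.
  move=> s0 st.
  have := H2 eps2 (ltW eps20) (lexx _) (euler_path (dt_ n)) (euler_path (dt_ m)).
  move=> /(_ (fun _ _ _ => rvD_euler_path _ _) (fun _ _ _ => rvD_euler_path _ _)) H.
  have := H (aeW _ (fun w => E2 _ (dt_gt0 n) (hN2 n n2) tau w))
    (aeW _ (fun w => E2 _ (dt_gt0 m) (hN2 m m2) tau w)) s s0 st.
  under [X in _ * X]eq_Rintegral do rewrite !euler_path0 subrr enorm0 expr0n.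
  by rewrite -/(Ex P (fun=> 0)) Ex_cst mulr0 add0r.
have := H1 eps1 (ltW eps10) (lexx _) (euler_path (dt_ n)) (euler_path (dt_ m)).
move=> /(_ (fun _ _ _ => rvD_euler_path _ _) (fun _ _ _ => rvD_euler_path _ _) mean w) H.
have := H (E1 _ (dt_gt0 n) (hN1 n n1) tau w) (E1 _ (dt_gt0 m) (hN1 m m1) tau w) t t0 tt.
rewrite !euler_path0 subrr enorm0 expr0n mulr0 add0r.
by rewrite ler_pXn2r ?nnegrE ?enorm_ge0// ltW.
Qed.

(** For fixed k the window h0 does not depend on eps, so eps can tend to 0 along the schemes. Half
    of k is left to the scheme; the other half covers the constant term of the drift modulus when
    the scheme is replaced by its limit. *)
Lemma variational_solution_exists tau : 0 <= tau -> exists Y : R -> T -> 'rV[R]_d,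
  [/\ forall t, 0 <= t -> t <= tau -> rvD D (Y t),
      forall w, Y 0 w = X0 w
    & forall k, 0 < k -> exists2 h0, 0 < h0 & forall w, approx_path D C b tau h0 k 0 Y w].
Proof.
move=> tau0.
have lim_ex (t : R) (w : T) : exists l : 'rV[R]_d, 0 <= t -> t <= tau ->
    (forall i, euler_path (dt_ n) t w 0 i @[n --> \oo] --> l 0 i) /\
    forall e, 0 < e -> exists N, forall n, (N <= n)%N -> enorm (euler_path (dt_ n) t w - l) <= e.
  have [/andP[t0 tt]|ht] := pselect (0 <= t <= tau); last first.
    by exists 0 => t0 tt; case: ht; rewrite t0.
  have [|l hl] := @enorm_cauchy_cvg _ _ (fun n => euler_path (dt_ n) t w); last by exists l.
  move=> e e0; have [N hN] := euler_path_cauchy tau0 e0.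
  by exists N => n m Nn Nm; exact: hN.
pose Y t w := projT1 (cid (lim_ex t w)).
have YP t w : 0 <= t -> t <= tau ->
    (forall i, euler_path (dt_ n) t w 0 i @[n --> \oo] --> Y t w 0 i) /\
    forall e, 0 < e -> exists N, forall n, (N <= n)%N -> enorm (euler_path (dt_ n) t w - Y t w) <= e.
  by rewrite /Y; case: cid.
have unif e : 0 < e -> exists N, forall n, (N <= n)%N -> forall t, 0 <= t -> t <= tau ->
    forall w, enorm (euler_path (dt_ n) t w - Y t w) <= e.
  move=> e0; have [N hN] := euler_path_cauchy tau0 e0; exists N => n Nn t t0 tt w.
  apply/ler_addgt0Pr => e1 e10; have [N1 hN1] := (YP t w t0 tt).2 e1 e10.
  have -> : euler_path (dt_ n) t w - Y t w =
    (euler_path (dt_ n) t w - euler_path (dt_ (maxn N N1)) t w) +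
    (euler_path (dt_ (maxn N N1)) t w - Y t w) by rewrite addrA subrK.
  apply: le_trans (enormD _ _) (lerD _ _).
    by apply: hN => //; rewrite leq_maxl.
  by apply: hN1; rewrite leq_maxr.
have rY t : 0 <= t -> t <= tau -> rvD D (Y t).
  move=> t0 tt; split.
    apply/measurable_rowP => i.
    apply: (@measurable_fun_cvg _ _ _ setT (fun n w => euler_path (dt_ n) t w 0 i)) => [n|w _].
      by move: (rvD_euler_path (dt_ n) t) => [/measurable_rowP]; exact.
    exact: (YP t w t0 tt).1.
  move=> w; have clD := compact_closed_rV cD; apply: contrapT => nD.
  have := closed_openC clD; rewrite openE => /(_ _ nD) /nbhs_enormP[r r0 hr].
  have r2 : 0 < r / 2 by rewrite divr_gt0.
  have [N hN] := unif _ r2; apply: (hr (euler_path (dt_ N) t w)).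
    by have := hN N (leqnn N) t t0 tt w; lra.
  exact: (rvD_euler_path _ _).2.
exists Y; split => //.
  move=> w; have [+ _] := YP 0 w (lexx _) tau0 => h; apply/rowP => i.
  have : euler_path (dt_ n) 0 w 0 i @[n --> \oo] --> X0 w 0 i.
    by under eq_fun do rewrite euler_path0; exact: cvg_cst.
  by move=> h2; have := cvg_unique _ (h i) h2; exact.
move=> k k0; have C0 := mfd_speed Hb.
have [M M0 hM] := compact_diameter cD.
have M1 : 0 < M + 1 by rewrite ltr_pwDr.
have k2 : 0 < k / 2 by rewrite divr_gt0.
have kM : 0 < k / 2 / (M + 1) by rewrite divr_gt0.
have [h0 h00 E1] := euler_path_approx k2.
have [A A0 hA] := mfd_modulus Hb kM.
exists h0 => // w s t s0 st tt th.
have t0 : 0 <= t by exact: le_trans s0 st.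
have stau : s <= tau by exact: le_trans st tt.
have ts0 : 0 <= t - s by rewrite subr_ge0.
(* Bounds the sum of the coefficients of e: the slack of the scheme and the replacement of
   positions, drift and test point by those of the limit. *)
pose Q := 2 * M + h0 * M * (2 * A) + 2 * C * h0 + 4.
have Q0 : 0 < Q.
  have := mulr_ge0 (mulr_ge0 (ltW h00) M0) A0; have := mulr_ge0 C0 (ltW h00).
  rewrite /Q; lra.
have close e : 0 < e -> exists n,
    (forall t, 0 <= t -> t <= tau -> forall w, enorm (euler_path (dt_ n) t w - Y t w) <= e) /\
    approx_path D C b tau h0 (k / 2) e (euler_path (dt_ n)) w.
  move=> e0; have [d1 d10 hd1] := E1 e e0.
  have [N1 hN1] := dt_small d10; have [N2 hN2] := unif e e0.
  exists (maxn N1 N2); split.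
    by apply: hN2; rewrite leq_maxr.
  by apply: hd1 => //; apply: hN1; rewrite leq_maxl.
rewrite !addr0; split.
  apply/ler_addgt0Pr => e e0; have e3 : 0 < e / 3 by rewrite divr_gt0.
  have [n [hn /(_ s t s0 st tt th)[an _]]] := close _ e3.
  have -> : Y t w - Y s w = (euler_path (dt_ n) t w - euler_path (dt_ n) s w) -
      (euler_path (dt_ n) t w - Y t w) + (euler_path (dt_ n) s w - Y s w).
    by apply/rowP => i; rewrite !mxE; ring.
  apply: le_trans (enormD _ _) _.
  have := enormD (euler_path (dt_ n) t w - euler_path (dt_ n) s w) (- (euler_path (dt_ n) t w - Y t w)).
  rewrite enormN; have := hn t t0 tt w; have := hn s s0 stau w; lra.
move=> z Dz; apply/ler_addgt0Pr => eta eta0.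
pose e := Num.min 1 (eta / Q).
have e0 : 0 < e by rewrite lt_min ltr01 divr_gt0.
have e1 : e <= 1 by rewrite ge_min lexx.
have eQ : e * Q <= eta by rewrite -ler_pdivlMr// ge_min lexx orbT.
have [n [hn /(_ s t s0 st tt th)[an /(_ z Dz) vn]]] := close _ e0.
set ys := euler_path (dt_ n) s w in vn an; set yt := euler_path (dt_ n) t w in vn an.
set vs := b (euler_path (dt_ n) s) ys in vn; set v := b (Y s) (Y s w).
have Dys : D ys by exact: (rvD_euler_path _ _).2.
have DYs : D (Y s w) by exact: (rY s s0 stau).2.
have hs := hn s s0 stau w; have ht := hn t t0 tt w; rewrite -/ys in hs; rewrite -/yt in ht.
have hv : enorm (vs - v) <= k / 2 / (M + 1) + A * (2 * e).
  apply: le_trans (hA _ _ _ _ (rvD_euler_path (dt_ n) s) (rY s s0 stau) Dys DYs) _.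
  rewrite lerD2l; apply: ler_wpM2l => //.
  have sq w' : enorm (euler_path (dt_ n) s w' - Y s w') ^+ 2 <= e.
    have h := hn s s0 stau w'; apply: (@le_trans _ _ (e ^+ 2)).
      by rewrite ler_pXn2r ?nnegrE ?enorm_ge0// ltW.
    by rewrite expr2 -[leRHS]mulr1 ler_wpM2l// ltW.
  have : Ex P (fun w => enorm (euler_path (dt_ n) s w - Y s w) ^+ 2) <= e.
    rewrite -[leRHS](Ex_cst P); apply: Ex_le => //; last exact: bmeas_cst.
    by apply: (bmeas_dist cD); [exact: rvD_euler_path|exact: rY].
  have := sq w; rewrite -/ys; lra.
have hvs : enorm vs <= C by apply: (mfd_bounded Hb) => //; exact: rvD_euler_path.
have -> : dotp (Y t w - Y s w - (t - s) *: v) (Y s w - z) =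
    dotp (yt - ys - (t - s) *: vs) (ys - z) +
    dotp (ys - Y s w - (yt - Y t w) + (t - s) *: (vs - v)) (Y s w - z) -
    dotp (yt - ys - (t - s) *: vs) (ys - Y s w).
  by move: (Y t w) (Y s w) => yt' ys'; rewrite !dotpE; ring.
have b1 : dotp (ys - Y s w - (yt - Y t w) + (t - s) *: (vs - v)) (Y s w - z) <=
    (2 * e + (t - s) * (k / 2 / (M + 1) + A * (2 * e))) * M.
  apply: le_trans (dotp_le_enorm _ _) _; apply: ler_pM; rewrite ?enorm_ge0//; last exact: hM.
  apply: le_trans (enormD _ _) _; rewrite enormZ ger0_norm//; apply: lerD; last exact: ler_wpM2l.
  by apply: le_trans (enormD _ _) _; rewrite enormN; lra.
have b2 : - dotp (yt - ys - (t - s) *: vs) (ys - Y s w) <= (2 * C * h0 + 1) * e.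
  rewrite -dotpNl; apply: le_trans (dotp_le_enorm _ _) _; rewrite enormN.
  apply: ler_pM; rewrite ?enorm_ge0//.
  apply: le_trans (enormD _ _) _; rewrite enormN enormZ ger0_norm//.
  have := ler_wpM2l ts0 hvs; have := ler_wpM2l C0 th; lra.
have b3 : (t - s) * (k / 2 / (M + 1)) * M <= (t - s) * (k / 2).
  rewrite -mulrA; apply: ler_wpM2l => //; rewrite mulrAC ler_pdivrMr//; apply: ler_wpM2l.
    exact: ltW.
  by rewrite lerDl.
have b4 : (t - s) * (A * (2 * e)) * M <= h0 * (A * (2 * e)) * M.
  do 2 apply: ler_wpM2r => //; by rewrite !mulr_ge0// ltW.
move: eQ; rewrite /Q; lra.
Qed.

End Euler.

(** * From the variational inequality to the integral equation *)

Section RightDerivative.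
Context {R : realType}.
Notation mu := (@lebesgue_measure R).

(** Freezing time outside [[0, tau]] extends a path to all real times, so that shifted arguments
    make sense and Lipschitz bounds survive. *)
Definition clamp (tau s : R) : R := Num.min (Num.max s 0) tau.

Lemma clamp_itv tau s : 0 <= tau -> 0 <= clamp tau s <= tau.
Proof. by move=> t0; rewrite /clamp le_min le_max lexx orbT t0 ge_min lexx orbT. Qed.

Lemma clamp_id tau s : 0 <= s -> s <= tau -> clamp tau s = s.
Proof. by move=> s0 st; rewrite /clamp max_l// min_l. Qed.

Lemma clamp_le tau s t : s <= t -> clamp tau s <= clamp tau t.
Proof.
move=> st; rewrite /clamp le_min; apply/andP; split; last by rewrite ge_min lexx orbT.
rewrite ge_min; apply/orP; left; rewrite ge_max !le_max st lexx orbT andbT//.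
Qed.

Lemma clamp_dist tau s t : s <= t -> clamp tau t - clamp tau s <= t - s.
Proof.
move=> st; rewrite /clamp /Num.min /Num.max.
case: (ltP s 0) => h1; case: (ltP t 0) => h2; repeat case: ltP => *; lra.
Qed.

Lemma continuous_primitive (F : R -> R) : continuous F -> exists Phi : R -> R,
  forall s : R, 0 <= s -> is_derive s (1 : R) Phi (F s).
Proof.
move=> cF; exists (fun x => \int[mu]_(t in `[-1, x]) F t) => s s0.
have iF : mu.-integrable `[-1, s + 1] (EFin \o F).
  apply: continuous_compact_integrable; first exact: segment_compact.
  exact: continuous_subspaceT.
have s1 : s < s + 1 by rewrite ltrDl.
have s2 : -1 < s by lra.
have [d1 d2] := continuous_FTC1_closed s1 iF s2 (cF s).
by rewrite derive1E in d2; exact: (DeriveDef d1 d2).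
Qed.

Lemma is_derive_shift (Phi : R -> R) (s h l : R) :
  is_derive (s + h) (1 : R) Phi l -> is_derive s (1 : R) (fun x => Phi (x + h)) l.
Proof.
move=> [dP lP].
have E : (fun k => k^-1 *: (((fun x => Phi (x + h)) \o shift s) (k *: (1 : R)) - Phi (s + h))) =
    (fun k => k^-1 *: ((Phi \o shift (s + h)) (k *: (1 : R)) - Phi (s + h))).
  by apply/funext => k /=; rewrite addrA.
by apply: DeriveDef; [rewrite /derivable E|rewrite /derive E].
Qed.

(** An antiderivative of the quotient is s -> (Phi (s + h) - Phi s) / h, so the integral is the mean
    of F over [t, t + h] minus its mean over [0, h]. *)
Lemma integral_difference_quotient (F Phi : R -> R) (t h : R) : 0 < t -> 0 < h ->
  continuous F -> (forall s : R, 0 <= s -> is_derive s (1 : R) Phi (F s)) ->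
  (\int[mu]_(s in `[0%R, t]) ((F (s + h) - F s) / h)%:E =
   (((Phi (t + h) - Phi t) / h) - ((Phi h - Phi 0) / h))%:E)%E.
Proof.
move=> t0 h0 cF dP.
pose G s := h^-1 * (Phi (s + h) - Phi s).
have dG (s : R) : 0 <= s -> is_derive s (1 : R) G (h^-1 * (F (s + h) - F s)).
  move=> s0; have sh : 0 <= s + h by rewrite addr_ge0// ltW.
  have d1 := is_derive_shift (dP (s + h) sh).
  have d2 := dP s s0.
  exact: is_deriveZ.
have cG s : 0 <= s -> {for s, continuous G}.
  move=> s0; have [dGs _] := dG s s0.
  by apply: differentiable_continuous; exact/derivable1_diffP.
rewrite (@continuous_FTC2 _ _ G)//.
- by rewrite /G add0r -EFinB !(mulrC h^-1).
- apply: continuous_subspaceT => s; apply: cvgM; last exact: cvg_cst.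
  apply: cvgB; last exact: cF.
  apply: continuous_comp; last exact: cF.
  by apply: cvgD; [exact: cvg_id|exact: cvg_cst].
- split.
  + by move=> s; rewrite in_itv /= => /andP[s0 _]; have [] := dG s (ltW s0).
  + by apply: cvg_at_right_filter; exact: cG.
  + by apply: cvg_at_left_filter; apply: cG; exact: ltW.
- move=> s; rewrite in_itv /= => /andP[s0 _]; rewrite derive1E.
  by have [_ ->] := dG s (ltW s0); rewrite mulrC.
Qed.

Lemma difference_quotient_cvg (Phi : R -> R) (s l h0 : R) : 0 < h0 ->
  is_derive s (1 : R) Phi l ->
  ((Phi (s + h0 / n.+1%:R) - Phi s) / (h0 / n.+1%:R)) @[n --> \oo] --> l.
Proof.
move=> h00 [dP <-]; apply/cvgrPdist_lt => e e0.
have [r /= r0 hr] := proj1 (@cvgrPdist_lt _ _ _ _ _ _ _) dP e e0.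
near=> n.
have hn : 0 < h0 / n.+1%:R by rewrite divr_gt0.
have hnr : h0 / n.+1%:R < r.
  rewrite ltr_pdivrMr// mulrC -ltr_pdivrMr//.
  apply: (@lt_le_trans _ _ (Num.truncn (h0 / r)).+1%:R); first exact: truncnS_gt.
  by rewrite ler_nat ltnS; near: n; exact: nbhs_infty_ge.
have /hr : ball_ [eta Num.norm] 0 r (h0 / n.+1%:R).
  by rewrite /ball_ /= sub0r normrN gtr0_norm.
move=> /(_ (lt0r_neq0 hn)); rewrite /= -[_ *: (_ - _)]/(_ * _) -[_ *: 1]/(_ * 1) mulr1.
by rewrite (addrC s) mulrC.
Unshelve. all: by end_near. Qed.

(** The right difference quotients of a Lipschitz function are bounded by C and here converge to g
    at every time before tau. Dominated convergence on one side and convergence of the means of f on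
    the other give the formula, without differentiating f almost everywhere. *)
Lemma integral_right_derivative (f g : R -> R) (tau C h0 : R) :
  0 < tau -> 0 < h0 -> 0 <= C ->
  (forall s t, 0 <= s -> s <= t -> t <= tau -> t - s <= h0 -> `|f t - f s| <= C * (t - s)) ->
  (forall s, 0 <= s -> s < tau -> forall e, 0 < e -> exists2 r, 0 < r &
     forall h, 0 < h -> h < r -> s + h <= tau -> `|f (s + h) - f s - h * g s| <= e * h) ->
  mu.-integrable `[0, tau] (EFin \o g) /\
  forall t, 0 <= t -> t <= tau -> f t = f 0 + \int[mu]_(s in `[0, t]) g s.
Proof.
move=> tau0 h00 C0 fL fR.
pose F s := f (clamp tau s).
have FE s : 0 <= s -> s <= tau -> F s = f s by move=> s0 st; rewrite /F clamp_id.
have FL s t : s <= t -> t - s <= h0 -> `|F t - F s| <= C * (t - s).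
  move=> st th; have /andP[c0 _] := clamp_itv s (ltW tau0).
  have /andP[_ ct] := clamp_itv t (ltW tau0).
  have cd := clamp_dist tau st.
  apply: le_trans (fL _ _ c0 (clamp_le tau st) ct (le_trans cd th)) _.
  exact: ler_wpM2l.
have cF : continuous F.
  move=> x; apply/cvgrPdist_lt => e e0; apply/nbhs_ballP.
  have C1 : 0 < C + 1 by rewrite ltr_pwDr.
  exists (Num.min h0 (e / (C + 1))); first by rewrite /= lt_min h00 divr_gt0.
  move=> y; rewrite /ball /= lt_min ltr_pdivlMr// => /andP[y1 y2].
  have : `|F x - F y| <= C * `|x - y|.
    have [xy|/ltW xy] := leP x y.
      move: y1; rewrite (distrC (F x)) (distrC x) (@ger0_norm _ (y - x)) ?subr_ge0//.
      by move=> /ltW; exact: FL.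
    by move: y1; rewrite (@ger0_norm _ (x - y)) ?subr_ge0// => /ltW; exact: FL.
  have := normr_ge0 (x - y); lra.
pose hn (n : nat) : R := h0 / n.+1%:R.
have hn0 n : 0 < hn n by rewrite divr_gt0.
have hnh n : hn n <= h0.
  by rewrite ler_pdivrMr// ler_peMr ?(ltW h00)// ler1n.
pose q n s := (F (s + hn n) - F s) / hn n.
have qC n s : `|q n s| <= C.
  rewrite normrM normfV (gtr0_norm (hn0 n)) ler_pdivrMr//.
  have := @FL s (s + hn n); rewrite addrAC subrr add0r; apply => //.
  by rewrite lerDl ltW.
have mq n : measurable_fun setT (q n).
  apply: continuous_measurable_fun => s; apply: cvgM; last exact: cvg_cst.
  apply: cvgB; last exact: cF.
  apply: continuous_comp; last exact: cF.
  by apply: cvgD; [exact: cvg_id|exact: cvg_cst].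
have hn_small r : 0 < r -> \forall n \near \oo, hn n < r.
  move=> r0; near=> n; rewrite ltr_pdivrMr// mulrC -ltr_pdivrMr//.
  apply: (@lt_le_trans _ _ (Num.truncn (h0 / r)).+1%:R); first exact: truncnS_gt.
  by rewrite ler_nat ltnS; near: n; exact: nbhs_infty_ge.
have qg s : 0 <= s -> s < tau -> q n s @[n --> \oo] --> g s.
  move=> s0 st; apply/cvgrPdist_lt => e e0.
  have e2 : 0 < e / 2 by rewrite divr_gt0.
  have [r r0 hr] := fR s s0 st _ e2.
  have r1 : 0 < Num.min r (tau - s) by rewrite lt_min r0 subr_gt0.
  near=> n.
  have : hn n < Num.min r (tau - s) by near: n; exact: hn_small.
  rewrite lt_min => /andP[nr nt].
  have sn : s + hn n <= tau by lra.
  have := hr (hn n) (hn0 n) nr sn.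
  rewrite /q !FE ?(ltW st)//; last by rewrite addr_ge0// ltW.
  set u := f (s + hn n) - f s => hu.
  have -> : g s - u / hn n = - ((u - hn n * g s) / hn n).
    have aux (x y z : R) : z != 0 -> x - y / z = - ((y - z * x) / z).
      by move=> z0; rewrite mulrBl mulrAC divff// mul1r opprB.
    by apply: aux; rewrite gt_eqF.
  rewrite normrN normrM normfV (gtr0_norm (hn0 n)) ltr_pdivrMr//.
  apply: le_lt_trans hu _; rewrite ltr_pM2r//; lra.
(* Nothing is known of g at tau, so it is a limit of the quotients only on the half-open interval;
   adding one endpoint preserves measurability. *)
have mg t : t <= tau -> measurable_fun `[0, t] g.
  move=> tt; apply/measurable_fun_itv_bndo_bndcP.
  apply: (@measurable_fun_cvg _ _ _ _ q) => [n|s]; first exact: measurable_funTS.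
  by rewrite /= in_itv /= => /andP[s0 st]; apply: qg => //; exact: lt_le_trans st tt.
have gC s : 0 <= s -> s < tau -> `|g s| <= C.
  move=> s0 st; apply/ler_addgt0Pr => e e0.
  have /cvgrPdist_lt/(_ e e0)/filter_ex[n gq] := qg s s0 st.
  rewrite -(subrK (q n s) (g s)); apply: le_trans (ler_normD _ _) _.
  by rewrite addrC lerD ?qC// ltW.
have ig t : 0 <= t -> t <= tau -> mu.-integrable `[0, t[ (EFin \o g).
  move=> t0 tt; apply: measurable_bounded_integrable => //.
  - by rewrite /= lebesgue_measure_itv/=; case: ifP => _; rewrite ?ltry// -EFinB ltry.
  - by apply/measurable_fun_itv_bndo_bndcP; exact: mg.
  - exists C; split; rewrite ?num_real// => x Cx s; rewrite /= in_itv /= => /andP[s0 st].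
    by apply: le_trans (ltW Cx); apply: gC => //; exact: lt_le_trans st tt.
have igc t : 0 <= t -> t <= tau -> mu.-integrable `[0, t] (EFin \o g).
  move=> t0 tt; apply/integrableP; split; first by apply/measurable_EFinP; exact: mg.
  have /integrableP[_] := ig t t0 tt.
  rewrite integral_itv_bndo_bndc//.
  apply: measurableT_comp => //; apply/measurable_EFinP/measurable_fun_itv_bndo_bndcP.
  exact: mg.
split; first by apply: igc; rewrite ?lexx// ltW.
move=> t; rewrite le_eqVlt => /predU1P[<- _|t0 tt].
  by rewrite set_itv1 Rintegral_set1 addr0.
have [Phi dPhi] := continuous_primitive cF.
have Gcvg : ((Phi (t + hn n) - Phi t) / hn n) - ((Phi (hn n) - Phi 0) / hn n) @[n --> \oo] -->
    f t - f 0.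
  rewrite -(FE t (ltW t0) tt) -(FE 0 (lexx _) (ltW tau0)).
  apply: cvgB; first exact: (difference_quotient_cvg h00 (dPhi t (ltW t0))).
  have := difference_quotient_cvg h00 (dPhi 0 (lexx _)).
  by under eq_fun do rewrite add0r.
have intq n : (\int[mu]_(s in `[0%R, t[) (q n s)%:E)%E =
    (((Phi (t + hn n) - Phi t) / hn n) - ((Phi (hn n) - Phi 0) / hn n))%:E.
  rewrite integral_itv_bndo_bndc; first exact: integral_difference_quotient.
  by apply/measurable_EFinP; exact: measurable_funTS.
have iC : mu.-integrable `[0, t[ (EFin \o cst C).
  apply: measurable_bounded_integrable => //; last exact: bounded_cst.
  by rewrite /= lebesgue_measure_itv/=; case: ifP => _; rewrite ?ltry// -EFinB ltry.
have [|||||_ _ dct] := @dominated_convergence _ _ _ mu `[0, t[ _ (fun n => EFin \o q n)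
  (EFin \o g) (EFin \o cst C) _ _ _ iC _.
- exact: measurable_itv.
- by move=> n; apply/measurable_EFinP; exact: (measurable_funTS (mq n)).
- by apply/measurable_EFinP/measurable_fun_itv_bndo_bndcP; exact: mg.
- apply: aeW => s; rewrite /= in_itv /= => /andP[s0 st].
  by apply: cvg_EFin; [exact: nearW|apply: qg => //; exact: lt_le_trans st tt].
- by apply: aeW => s n _; rewrite /= lee_fin.
have dct' : (((Phi (t + hn n) - Phi t) / hn n) - ((Phi (hn n) - Phi 0) / hn n))%:E @[n --> \oo] -->
    (f t - f 0)%:E by apply: cvg_EFin => //; exact: nearW.
have E : ((f t - f 0)%:E = \int[mu]_(s in `[0%R, t[) (g s)%:E)%E.
  apply: cvg_unique dct' _; first exact: ereal_hausdorff.
  by move: dct; under eq_fun do rewrite intq.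
rewrite -Rintegral_itv_bndo_bndc; last exact: ig (ltW t0) tt.
by rewrite /Rintegral -E /= addrC subrK.
Unshelve. all: by end_near. Qed.

End RightDerivative.

Section VariationalSolution.
Context {R : realType} {d : nat} (D : set 'rV[R]_d) {disp : measure_display}
  {T : measurableType disp} (P : probability T R).
Context (L C : R) (b : (T -> 'rV[R]_d) -> 'rV[R]_d -> 'rV[R]_d)
  (Hb : mean_field_drift D P L C b).
Hypotheses (cD : compact D) (vD : convex_set D) (intD : D° !=set0)
  (bD : C1_boundary D).
Context (tau : R) (Y : R -> T -> 'rV[R]_d)
  (rY : forall t, 0 <= t -> t <= tau -> rvD D (Y t)).
Hypothesis aY : forall k, 0 < k -> exists2 h0, 0 < h0 &
  forall w, approx_path D C b tau h0 k 0 Y w.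

Let clD : closed D. Proof. exact: compact_closed_rV. Qed.

Let lip : exists2 h0, 0 < h0 & forall w s t, 0 <= s -> s <= t -> t <= tau ->
  t - s <= h0 -> enorm (Y t w - Y s w) <= C * (t - s).
Proof.
have [h0 h00 h] := aY ltr01; exists h0 => // w s t s0 st tt th.
by have [+ _] := h w s t s0 st tt th; rewrite addr0.
Qed.

(* Compare Y with the segment [Y s w + h *: q], which stays in D when q is an
   admissible direction. *)
Lemma variational_comparison w s h q G : 0 <= s -> 0 < h -> s + h <= tau ->
  (forall r, 0 <= r -> r <= h -> D (Y s w + r *: q)) ->
  (forall r, 0 <= r -> r <= h ->
     dotp (b (Y (s + r)) (Y (s + r) w) - q) (Y (s + r) w - (Y s w + r *: q)) <= G) ->
  enorm (Y (s + h) w - (Y s w + h *: q)) ^+ 2 <= 2 * h * G.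
Proof.
move=> s0 h0 sh qD qG; have C0 := mfd_speed Hb.
pose Cq := C + enorm q; have Cq0 : 0 <= Cq by rewrite addr_ge0 ?enorm_ge0.
apply/ler_addgt0Pr => e e0.
have k0 : 0 < e / (4 * h) by rewrite divr_gt0// mulr_gt0.
have [h1 h10 hk] := aY k0.
(* The first summand makes the step at most h1; the second brings the accumulated squares Cq^2 h dt
   below e / 2. The slack e / (4 h) accounts for the other e / 2. *)
pose N := (Num.truncn (h / h1 + 2 * Cq ^+ 2 * h ^+ 2 / e)).+1.
have X1 : 0 <= h / h1 by rewrite divr_ge0// ltW.
have X2 : 0 <= 2 * Cq ^+ 2 * h ^+ 2 / e.
  apply: divr_ge0; last exact: ltW.
  by apply: mulr_ge0; [apply: mulr_ge0 => //; exact: sqr_ge0|exact: sqr_ge0].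
have NX : h / h1 + 2 * Cq ^+ 2 * h ^+ 2 / e < N%:R by exact: truncnS_gt.
have N0 : (0 : R) < N%:R by rewrite ltr0n.
pose dt := h / N%:R; have dt0 : 0 < dt by rewrite divr_gt0.
have dtN : N%:R * dt = h by rewrite mulrC divfK// gt_eqF.
have dth : dt <= h1.
  rewrite ler_pdivrMr// mulrC -ler_pdivrMr//; apply: le_trans (ltW NX); lra.
pose Z r := Y (s + r) w - (Y s w + r *: q).
pose a j := enorm (Z (j%:R * dt)) ^+ 2.
have step j : (j < N)%N -> a j.+1 <= a j + (2 * dt * (G + e / (4 * h)) + (Cq * dt) ^+ 2).
  move=> jN; pose r := j%:R * dt.
  have r0 : 0 <= r by rewrite mulr_ge0// ltW.
  have rE : j.+1%:R * dt = r + dt by rewrite -[j.+1]addn1 natrD mulrDl mul1r.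
  have rh : r + dt <= h.
    by rewrite -rE -dtN ler_wpM2r ?ler_nat// ltW.
  have rh' : r <= h by apply: le_trans rh; rewrite lerDl ltW.
  rewrite /a rE -/r.
  have sr0 : 0 <= s + r by rewrite addr_ge0.
  have srr : s + r <= s + (r + dt) by rewrite addrA lerDl ltW.
  have srt : s + (r + dt) <= tau by apply: le_trans sh; rewrite lerD2l.
  have dE : s + (r + dt) - (s + r) = dt by rewrite addrA (addrC _ dt) addrK.
  have := hk w (s + r) (s + (r + dt)) sr0 srr srt; rewrite dE !addr0 => /(_ dth)[hl hv].
  have := hv _ (qD r r0 rh'); rewrite -/(Z r) => {}hv.
  have ZE : Z (r + dt) = Z r + (Y (s + (r + dt)) w - Y (s + r) w - dt *: q).
    by rewrite /Z scalerDl; apply/rowP => i; rewrite !mxE; ring.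
  have n2 : enorm (Y (s + (r + dt)) w - Y (s + r) w - dt *: q) ^+ 2 <= (Cq * dt) ^+ 2.
    have Cdt : 0 <= Cq * dt by exact: mulr_ge0 Cq0 (ltW dt0).
    rewrite ler_pXn2r ?nnegrE ?enorm_ge0//.
    apply: le_trans (enormD _ _) _; rewrite enormN enormZ gtr0_norm// /Cq.
    by rewrite mulrDl (mulrC (enorm q)) lerD2r.
  have sqE (u v : 'rV[R]_d) : enorm (u + v) ^+ 2 = enorm u ^+ 2 + 2 * dotp v u + enorm v ^+ 2.
    by rewrite !enorm_sqr !dotpE (dotpC u v); ring.
  rewrite ZE sqE -addrA lerD2l lerD//.
  have gr := qG r r0 rh'; rewrite -/(Z r) in gr.
  move: hv gr; set v := b _ _; set u := Y (s + (r + dt)) w - Y (s + r) w.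
  have -> : dotp (u - dt *: q) (Z r) = dotp (u - dt *: v) (Z r) + dt * dotp (v - q) (Z r).
    by move: (Z r) => x; rewrite !dotpE; ring.
  by move=> hv /(ler_wpM2l (ltW dt0)) gr; lra.
have main j : (j <= N)%N -> a j <= j%:R * (2 * dt * (G + e / (4 * h)) + (Cq * dt) ^+ 2).
  elim: j => [|j IH] jN.
    by rewrite /a !mul0r /Z addr0 scale0r addr0 subrr enorm0 expr0n.
  apply: le_trans (step j jN) _; move: (IH (ltnW jN)).
  by move: (_ + (Cq * dt) ^+ 2) => g aj; rewrite -[j.+1]addn1 natrD mulrDl mul1r lerD2r.
have := main N (leqnn N); rewrite /a dtN -/(Z h) => H; apply: le_trans H _.
have -> : N%:R * (2 * dt * (G + e / (4 * h)) + (Cq * dt) ^+ 2) =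
    2 * (N%:R * dt) * (G + e / (4 * h)) + Cq ^+ 2 * (N%:R * dt) * dt by ring.
rewrite dtN.
have e1 : 2 * h * (e / (4 * h)) = e / 2.
  by field; rewrite gt_eqF.
have e2 : Cq ^+ 2 * h * dt <= e / 2.
  rewrite /dt mulrA ler_pdivrMr//.
  have : 2 * Cq ^+ 2 * h ^+ 2 / e <= N%:R by apply: le_trans (ltW NX); rewrite lerDr.
  rewrite ler_pdivrMr//; lra.
rewrite mulrDr e1; lra.
Qed.

(** The projected velocity p itself may point out of D along a curved boundary, so Y is compared
    with the segment in a nearby admissible direction q. The pairing stays below h e' B, whence
    |Y(s+h) - x - h q|^2 <= 2 h^2 e' B, and q is within e' of p. *)
Lemma variational_right_derivative w s e : 0 <= s -> s < tau -> 0 < e ->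
  exists2 r, 0 < r & forall h, 0 < h -> h < r -> s + h <= tau ->
    enorm (Y (s + h) w - Y s w - h *: tangential_proj D (Y s w) (b (Y s) (Y s w))) <= e * h.
Proof.
move=> s0 st e0; have C0 := mfd_speed Hb.
have split4 (vr v p q y x : 'rV[R]_d) (r : R) : dotp (vr - q) (y - (x + r *: q)) =
    dotp (vr - v) (y - (x + r *: q)) + dotp (v - p) (y - x) - r * dotp (v - p) q +
    dotp (p - q) (y - (x + r *: q)) by rewrite !dotpE; ring.
set x := Y s w; set v := b (Y s) x; set p := tangential_proj D x v.
have Dx : D x by exact: (rY s0 (ltW st)).2.
have vC : enorm v <= C by apply: (mfd_bounded Hb) => //; exact: rY s0 (ltW st).
have pC : enorm p <= C by apply: le_trans vC; exact: enorm_tangential_proj.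
(* Two terms below contribute 2C + 1 each and one contributes C. The bound e^2 / (8 B) on e' then
   gives 2 h^2 e' B <= (e h / 2)^2. *)
pose B := 5 * C + 2; have B0 : 0 < B by rewrite ltr_wpDl// mulr_ge0.
pose e' := Num.min 1 (Num.min (e / 2) (e ^+ 2 / (8 * B))).
have e'0 : 0 < e' by rewrite !lt_min ltr01 !divr_gt0 ?exprn_gt0// mulr_gt0.
have e'1 : e' <= 1 by rewrite ge_min lexx.
have e'2 : e' <= e / 2 by rewrite !ge_min lexx !orbT.
have e'3 : e' * (8 * B) <= e ^+ 2.
  by rewrite -ler_pdivlMr ?mulr_gt0// !ge_min lexx !orbT.
have [q [qp pn pq [r1 r10 hr1]]] := tangential_proj_approx clD vD bD v intD Dx e'0.
rewrite -/p in qp pn pq.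
have qC : enorm q <= C + 1.
  rewrite -(subrK p q); apply: le_trans (enormD _ _) _; lra.
have e'h : 0 < e' / 2 by rewrite divr_gt0.
have [A A0 hA] := mfd_modulus Hb e'h.
have [h0 h00 hlip] := lip.
(* Within time r2 the quadratic part of the drift modulus, at most 2 A C^2 r, stays below e' / 2. *)
pose r2 := e' / 2 / (2 * A * C ^+ 2 + 1).
have A1 : 0 < 2 * A * C ^+ 2 + 1 by rewrite ltr_pwDr// !mulr_ge0 ?sqr_ge0.
have r20 : 0 < r2 by rewrite !divr_gt0.
exists (Num.min (Num.min 1 r1) (Num.min h0 r2)); first by rewrite !lt_min ltr01 r10 h00.
move=> h hh; rewrite !lt_min => /andP[/andP[h1 hr] /andP[hh0 hr2]] sh.
have bound r : 0 <= r -> r <= h ->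
    dotp (b (Y (s + r)) (Y (s + r) w) - q) (Y (s + r) w - (x + r *: q)) <= h * e' * B.
  move=> rr0 rh.
  have sr0 : 0 <= s + r by rewrite addr_ge0.
  have srt : s + r <= tau by apply: le_trans sh; rewrite lerD2l.
  have ssr : s <= s + r by rewrite lerDl.
  have rE : s + r - s = r by rewrite addrAC subrr add0r.
  have yl w' : enorm (Y (s + r) w' - Y s w') <= C * r.
    by have := hlip w' s (s + r) s0 ssr srt; rewrite rE; apply; apply: le_trans rh (ltW hh0).
  have Dy : D (Y (s + r) w) by exact: (rY sr0 srt).2.
  set y := Y (s + r) w in Dy *; set vr := b _ y.
  have vv : enorm (vr - v) <= e'.
    apply: le_trans (hA _ _ _ _ (rY sr0 srt) (rY s0 (ltW st)) Dy Dx) _.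
    have sq w' : enorm (Y (s + r) w' - Y s w') ^+ 2 <= C ^+ 2 * r.
      apply: (@le_trans _ _ ((C * r) ^+ 2)).
        by rewrite ler_pXn2r ?nnegrE ?enorm_ge0 ?mulr_ge0.
      rewrite exprMn; apply: ler_wpM2l; first exact: sqr_ge0.
      by rewrite expr2 -[leRHS]mulr1 ler_wpM2l// (le_trans rh)// ltW.
    have E2 : Ex P (fun w => enorm (Y (s + r) w - Y s w) ^+ 2) <= C ^+ 2 * r.
      rewrite -[leRHS](Ex_cst P); apply: Ex_le => //; last exact: bmeas_cst.
      by apply: (bmeas_dist cD); [exact: (rY sr0 srt)|exact: (rY s0 (ltW st))].
    have sqw := sq w; rewrite -/y -/x in sqw.
    rewrite [e' in leRHS]splitr lerD2l.
    apply: (@le_trans _ _ (A * (2 * (C ^+ 2 * r)))).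
      by apply: ler_wpM2l => //; lra.
    have : r * (2 * A * C ^+ 2 + 1) <= e' / 2.
      by rewrite -ler_pdivlMr//; apply: le_trans rh (ltW hr2).
    lra.
  set Zr := y - (x + r *: q).
  have Zn : enorm Zr <= h * (2 * C + 1).
    rewrite /Zr opprD addrA; apply: le_trans (enormD _ _) _; rewrite enormN enormZ ger0_norm//.
    have := yl w; rewrite -/y -/x.
    have := ler_wpM2l rr0 qC; have C1 : 0 <= 2 * C + 1 by lra.
    by have := ler_wpM2r C1 rh; lra.
  (* In order: drift variation is small, v - p is normal to D at x, v - p is almost orthogonal to q,
     and p is close to q. *)
  have -> : dotp (vr - q) Zr = dotp (vr - v) Zr + dotp (v - p) (y - x) -
      r * dotp (v - p) q + dotp (p - q) Zr.
    exact: split4.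
  have t1 : dotp (vr - v) Zr <= e' * (h * (2 * C + 1)).
    apply: le_trans (dotp_le_enorm _ _) _; apply: ler_pM; rewrite ?enorm_ge0//.
  have t2 : dotp (v - p) (y - x) <= 0 by exact: pn.
  have t3 : - (r * dotp (v - p) q) <= h * (e' * C).
    rewrite -mulrN; apply: le_trans (ler_norm _) _; rewrite normrM normrN (ger0_norm rr0).
    apply: ler_pM => //; apply: le_trans pq _; apply: ler_wpM2l => //; exact: ltW.
  have t4 : dotp (p - q) Zr <= e' * (h * (2 * C + 1)).
    apply: le_trans (dotp_le_enorm _ _) _; apply: ler_pM; rewrite ?enorm_ge0//.
    by rewrite enormB.
  rewrite /B; lra.
have := variational_comparison s0 hh sh _ bound.
move=> /(_ (fun r r0 rh => hr1 r r0 (le_lt_trans rh hr))) H.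
have n1 : enorm (Y (s + h) w - (x + h *: q)) <= e / 2 * h.
  rewrite -(@ler_pXn2r _ 2)// ?nnegrE ?enorm_ge0 ?mulr_ge0 ?divr_ge0 ?(ltW hh) ?(ltW e0)//.
  apply: le_trans H _; rewrite exprMn.
  have := ler_wpM2l (sqr_ge0 h) e'3; lra.
have -> : Y (s + h) w - x - h *: p = (Y (s + h) w - (x + h *: q)) + h *: (q - p).
  by apply/rowP => i; rewrite !mxE; ring.
apply: le_trans (enormD _ _) _; rewrite enormZ gtr0_norm//.
have := ler_wpM2l (ltW hh) qp; have := ler_wpM2l (ltW hh) e'2; lra.
Qed.

Lemma variational_integral_equation w : 0 < tau ->
  let p s := tangential_proj D (Y s w) (b (Y s) (Y s w)) in
  (forall i, lebesgue_measure.-integrable `[0, tau] (fun s => (p s 0 i)%:E)) /\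
  forall t, 0 <= t -> t <= tau ->
    Y t w = Y 0 w + \row_(i < d) \int[lebesgue_measure]_(s in `[0, t]) (p s 0 i).
Proof.
move=> tau0 p; have [h0 h00 hlip] := lip.
have key i := @integral_right_derivative R (fun t => Y t w 0 i) (fun s => p s 0 i) tau C h0
  tau0 h00 (mfd_speed Hb).
have {}key i : lebesgue_measure.-integrable `[0, tau] (EFin \o (fun s => p s 0 i)) /\
    forall t, 0 <= t -> t <= tau -> Y t w 0 i = Y 0 w 0 i +
      \int[lebesgue_measure]_(s in `[0, t]) (p s 0 i).
  apply: key.
  - move=> s t s0 st tt th; apply: le_trans (hlip w s t s0 st tt th).
    by have := normr_coord_le_enorm (Y t w - Y s w) i; rewrite !mxE.
  - move=> s s0 st e e0; have [r r0 hr] := variational_right_derivative w s0 st e0.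
    exists r => // h hh hhr sh; apply: le_trans (hr h hh hhr sh).
    have := normr_coord_le_enorm (Y (s + h) w - Y s w - h *: p s) i.
    by rewrite !mxE.
split=> [i|t t0 tt]; first by have [] := key i.
by apply/rowP => i; rewrite !mxE; have [_ ->] := key i.
Qed.

End VariationalSolution.

(** * From the integral equation to the variational inequality *)

Lemma integrable_Rintegral_sum {R : realType} {disp : measure_display}
  {T : measurableType disp} (m : {measure set T -> \bar R}) (A : set T)
  (I : Type) (rs : seq I) (f : I -> T -> R) :
  measurable A -> (forall i, m.-integrable A (EFin \o f i)) ->
  m.-integrable A (EFin \o (fun r => \sum_(i <- rs) f i r)) /\
  \int[m]_(r in A) (\sum_(i <- rs) f i r) = \sum_(i <- rs) \int[m]_(r in A) f i r.
Proof.
move=> mA fi; elim: rs => [|i rs [IH1 IH2]].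
  under [X in EFin \o X]eq_fun do rewrite big_nil.
  under [X in Rintegral _ _ X]eq_fun do rewrite big_nil.
  rewrite big_nil; split; last by rewrite /Rintegral integral0.
  exact: integrable0.
under [X in EFin \o X]eq_fun do rewrite big_cons.
under [X in Rintegral _ _ X]eq_fun do rewrite big_cons.
rewrite big_cons; split; first exact: (integrableD mA (fi i) IH1).
by rewrite RintegralD// IH2.
Qed.

Section IntegralDirection.
Context {R : realType} {d : nat}.
Notation mu := (@lebesgue_measure R).

Lemma dotp_integral_le (p : R -> 'rV[R]_d) (tau s t c : R) (u : 'rV[R]_d) :
  (forall i, mu.-integrable `[0, tau] (EFin \o (fun r => p r 0 i))) ->
  0 <= s -> s <= t -> t <= tau ->
  (forall r, s <= r -> r <= t -> dotp (p r) u <= c) ->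
  dotp (\row_(i < d) \int[mu]_(r in `[0, t]) (p r 0 i) -
        \row_(i < d) \int[mu]_(r in `[0, s]) (p r 0 i)) u <= c * (t - s).
Proof.
move=> pint s0 st tt pc.
have int_t i : mu.-integrable `[0, t] (EFin \o (fun r => p r 0 i)).
  apply: integrableS (pint i) => //; apply: subset_itvl; rewrite bnd_simp//.
have sub : `]s, t] `<=` `[0, t].
  by apply: subset_itv; rewrite bnd_simp.
have int_st i : mu.-integrable `]s, t] (EFin \o (fun r => u 0 i * p r 0 i)).
  have -> : EFin \o (fun r => u 0 i * p r 0 i) = (fun r => ((u 0 i)%:E * (p r 0 i)%:E)%E).
    by apply/funext.
  by apply: integrableZl => //; apply: integrableS (int_t i).
have dE r : dotp (p r) u = \sum_i u 0 i * p r 0 i.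
  by apply: eq_bigr => i _; rewrite mulrC.
have [//|i1 i2] := integrable_Rintegral_sum (index_enum 'I_d) _ int_st.
have -> : dotp (\row_(i < d) \int[mu]_(r in `[0, t]) (p r 0 i) -
        \row_(i < d) \int[mu]_(r in `[0, s]) (p r 0 i)) u =
    \int[mu]_(r in `]s, t]) dotp (p r) u.
  under [X in Rintegral _ _ X]eq_fun do rewrite dE.
  rewrite i2; apply: eq_bigr => i _; rewrite !mxE RintegralZl//; last first.
    by apply: integrableS (int_t i).
  by rewrite mulrC Rintegral_itvB// bnd_simp.
have lst : mu `]s, t] = (t - s)%:E.
  by rewrite lebesgue_measure_itv/= lte_fin; case: ltP => // ts;
    rewrite (le_anti (introT andP (conj st ts))) subrr.
have -> : c * (t - s) = \int[mu]_(r in `]s, t]) c.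
  by rewrite Rintegral_cst//; congr (c * _); exact: esym (congr1 fine lst).
apply: le_Rintegral => //.
- by under [X in EFin \o X]eq_fun do rewrite dE; exact: i1.
- apply: measurable_bounded_integrable => //; last exact: bounded_cst.
  by move: (ltry (t - s)); rewrite -lst.
- by move=> r; rewrite /= in_itv /= => /andP[sr rt]; apply: pc => //; exact: ltW.
Qed.

End IntegralDirection.

Section SolutionVariational.
Context {R : realType} {d : nat} (D : set 'rV[R]_d) {disp : measure_display}
  {T : measurableType disp} (P : probability T R).
Context (L C : R) (b : (T -> 'rV[R]_d) -> 'rV[R]_d -> 'rV[R]_d)
  (Hb : mean_field_drift D P L C b).
Hypotheses (cD : compact D) (vD : convex_set D) (bD : C1_boundary D).
Context (tau : R) (Y0 : T -> 'rV[R]_d) (Y : R -> T -> 'rV[R]_d)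
  (rY : forall t, 0 <= t -> t <= tau -> rvD D (Y t)).
Let p s w := tangential_proj D (Y s w) (b (Y s) (Y s w)).

Let good w := (forall i, lebesgue_measure.-integrable `[0, tau] (EFin \o (fun s => p s w 0 i))) /\
  forall t, 0 <= t -> t <= tau ->
    Y t w = Y0 w + \row_(i < d) \int[lebesgue_measure]_(s in `[0, t]) (p s w 0 i).

Let clD : closed D. Proof. exact: compact_closed_rV. Qed.

Let increment_le w s t u c : good w -> 0 <= s -> s <= t -> t <= tau ->
  (forall r, s <= r -> r <= t -> dotp (p r w) u <= c) ->
  dotp (Y t w - Y s w) u <= c * (t - s).
Proof.
move=> [gi ge] s0 st tt h.
rewrite (ge t (le_trans s0 st) tt) (ge s s0 (le_trans st tt)) opprD addrACA subrr add0r.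
exact: (@dotp_integral_le _ _ (fun r => p r w) tau).
Qed.

Let speed r w : 0 <= r -> r <= tau -> enorm (p r w) <= C.
Proof.
move=> r0 rt; apply: le_trans (enorm_tangential_proj _ _ _ _ _) _ => //.
  exact: (rY r0 rt).2.
by apply: (mfd_bounded Hb); [exact: rY|exact: (rY r0 rt).2].
Qed.

Let increment_lipschitz w s t : good w -> 0 <= s -> s <= t -> t <= tau ->
  enorm (Y t w - Y s w) <= C * (t - s).
Proof.
move=> gw s0 st tt; have C0 := mfd_speed Hb.
apply: enorm_dual => [|u]; first by rewrite mulr_ge0// subr_ge0.
rewrite mulrAC; apply: increment_le => // r sr rt.
apply: le_trans (dotp_le_enorm _ _) _; apply: ler_wpM2r; first exact: enorm_ge0.
by apply: speed; [exact: le_trans s0 sr|exact: le_trans rt tt].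
Qed.

(** At each time r of the window the projection is dropped by testing at Y r, where it only helps;
    then Y r and the drift at r are replaced by their values at s, with errors controlled by h0. The
    constant Q collects these errors. *)
Lemma solution_approx_path k : 0 < k -> {ae P, forall w, good w} ->
  exists2 h0, 0 < h0 & {ae P, forall w, approx_path D C b tau h0 k 0 Y w}.
Proof.
move=> k0 gY; have gY' := gY; have C0 := mfd_speed Hb.
have [M M0 hM] := compact_diameter cD.
have kap0 : 0 < k / 2 / (M + 1) by rewrite !divr_gt0// ltr_pwDr.
have [A A0 hA] := mfd_modulus Hb kap0.
pose Q := 2 * A * C ^+ 2 * M + 2 * C ^+ 2 + 1.
have C2 : 0 <= C ^+ 2 by exact: sqr_ge0.
have Q0 : 0 < Q.
  by have := mulr_ge0 (mulr_ge0 A0 C2) M0; rewrite /Q; lra.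
pose h0 := Num.min 1 (k / 2 / Q).
have h00 : 0 < h0 by rewrite lt_min ltr01 !divr_gt0.
have h01 : h0 <= 1 by rewrite ge_min lexx.
have hQ : h0 * Q <= k / 2 by rewrite -ler_pdivlMr// ge_min lexx orbT.
have kM : k / 2 / (M + 1) * M <= k / 2.
  rewrite mulrAC ler_pdivrMr ?ltr_pwDr//; apply: ler_wpM2l; first lra.
  by rewrite lerDl.
have final a : a <= k / 2 / (M + 1) + A * (2 * (C ^+ 2 * h0)) ->
    a * M + 2 * (C ^+ 2 * h0) <= k.
  by move=> /(ler_wpM2r M0) h; move: hQ; rewrite /Q; lra.
exists h0 => //; apply: filterS gY => w gw s t s0 st tt th; rewrite !addr0.
split; first exact: increment_lipschitz.
move=> z Dz; have stau : s <= tau by exact: le_trans st tt.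
have Ds : D (Y s w) by exact: (rY s0 stau).2.
rewrite dotpDl dotpNl dotpZl lerBlDr.
have -> : (t - s) * k + (t - s) * dotp (b (Y s) (Y s w)) (Y s w - z) =
  (dotp (b (Y s) (Y s w)) (Y s w - z) + k) * (t - s) by move: (dotp _ _) => q; ring.
apply: increment_le => // r sr rt.
have r0 : 0 <= r by exact: le_trans s0 sr.
have rtau : r <= tau by exact: le_trans rt tt.
have Dr : D (Y r w) by exact: (rY r0 rtau).2.
have rs : r - s <= h0 by apply: le_trans th; rewrite lerD2r.
have lip w' : good w' -> enorm (Y r w' - Y s w') <= C * h0.
  move=> gw'; apply: le_trans (increment_lipschitz gw' s0 sr rtau) _.
  exact: ler_wpM2l.
have sq w' : good w' -> enorm (Y r w' - Y s w') ^+ 2 <= C ^+ 2 * h0.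
  move=> gw'; apply: (@le_trans _ _ ((C * h0) ^+ 2)).
    by rewrite ler_pXn2r ?nnegrE ?enorm_ge0 ?lip//; apply: le_trans (lip _ gw'); exact: enorm_ge0.
  rewrite exprMn; apply: ler_wpM2l => //.
  by rewrite expr2 -[leRHS]mulr1 ler_wpM2l// ltW.
have db : enorm (b (Y r) (Y r w) - b (Y s) (Y s w)) <=
    k / 2 / (M + 1) + A * (2 * (C ^+ 2 * h0)).
  apply: le_trans (hA _ _ _ _ (rY r0 rtau) (rY s0 stau) Dr Ds) _.
  rewrite lerD2l; apply: ler_wpM2l => //.
  rewrite mulr2n mulrDl !mul1r; apply: lerD; first exact: sq.
  (* The integral equation holds only almost surely, so the second moment of the increment is
     bounded almost everywhere. *)
  rewrite -[leRHS](Ex_cst P); apply: Ex_le_ae; last by apply: filterS gY'.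
    by apply: (bmeas_dist cD); exact: rY.
  exact: bmeas_cst.
have split3 (q v v' y y' x : 'rV[R]_d) : dotp q (y' - x) = dotp q (y - x) - dotp v (y - x) +
    (dotp v' (y' - x) + dotp (v - v') (y - x) + dotp v' (y - y')) - dotp q (y - y').
  by rewrite !dotpE; ring.
rewrite (split3 _ (b (Y r) (Y r w)) (b (Y s) (Y s w)) (Y r w)).
have t1 : dotp (p r w) (Y r w - z) <= dotp (b (Y r) (Y r w)) (Y r w - z).
  exact: tangential_proj_dotp.
have t2 : dotp (b (Y r) (Y r w) - b (Y s) (Y s w)) (Y r w - z) <=
    enorm (b (Y r) (Y r w) - b (Y s) (Y s w)) * M.
  apply: le_trans (dotp_le_enorm _ _) _; apply: ler_wpM2l; first exact: enorm_ge0.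
  exact: hM.
have t3 : dotp (b (Y s) (Y s w)) (Y r w - Y s w) <= C ^+ 2 * h0.
  apply: le_trans (dotp_le_enorm _ _) _; rewrite expr2 -mulrA.
  apply: ler_pM; rewrite ?enorm_ge0 ?lip//.
  by apply: (mfd_bounded Hb) => //; exact: rY.
have t4 : - dotp (p r w) (Y r w - Y s w) <= C ^+ 2 * h0.
  rewrite -dotpNl; apply: le_trans (dotp_le_enorm _ _) _; rewrite enormN expr2 -mulrA.
  by apply: ler_pM; rewrite ?enorm_ge0 ?lip// speed.
have := final _ db; lra.
Qed.

End SolutionVariational.

(** * The gradient drift meets the abstract conditions and represents the velocity *)

Section MeanFieldVelocity.
Context {R : realType} {d : nat} (D : set 'rV[R]_d) (K V : 'rV[R]_d -> R)
  (lamK lamV : R) (hA : assumption_A D K V lamK lamV).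
Context {disp : measure_display} {T : measurableType disp} (P : probability T R).

Let b := drift (grad_on (diff_set D) K) (grad_on D V) P.

Let cD : compact D. Proof. exact: assumption_A_compact hA. Qed.

Let vD : convex_set D. Proof. by have [[_ _ ? _ _] _ _ _] := hA. Qed.

Let D0 : D !=set0.
Proof. by have [[_ _ _ [x /interior_subset Dx] _] _ _ _] := hA; exists x. Qed.

Let gKc : {within diff_set D, continuous (grad_on (diff_set D) K)}.
Proof. by have [_ _ [KC _] _] := hA; have [] := grad_onP KC. Qed.

Let gVc : {within D, continuous (grad_on D V)}.
Proof. by have [_ _ _ [VC _]] := hA; have [] := grad_onP VC. Qed.

Lemma mean_field_drift_gradient : exists C,
  mean_field_drift D P (- (Num.min 0 lamK + Num.min 0 lamV)) C b.
Proof.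
have [_ _ [_ Kl] [_ Vl]] := hA.
have gKo := assumption_A_gradK_odd hA.
have gKm p q : diff_set D p -> diff_set D q -> lamK * enorm (p - q) ^+ 2 <=
    dotp (grad_on (diff_set D) K p - grad_on (diff_set D) K q) (p - q).
  exact: lambda_convex_monotone.
have gVm p q : D p -> D q -> lamV * enorm (p - q) ^+ 2 <=
    dotp (grad_on D V p - grad_on D V q) (p - q).
  exact: lambda_convex_monotone.
have [C C0 hC] := drift_bounded cD gKc gVc P.
exists C; split=> //.
- exact: drift_rate_ge0.
- by move=> e; exact: drift_modulus.
- by move=> Y Y'; exact: drift_monotone.
- by move=> e; exact: drift_pathwise.
- by move=> Y Y'; exact: bvec_drift.
Qed.

(** A change of variables from the law to the sample space. The gradient is controlled only on D -
    D, so the integrand is first composed with [nearest D], which is the identity on D and makes it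
    bounded and measurable everywhere. *)
Lemma velocity_drift (Y : {RV P >-> borel_rV R d}) x : (forall w, D (Y w)) -> D x ->
  velocity D K V (distribution P Y) x = tangential_proj D x (b Y x).
Proof.
move=> DY Dx; rewrite /velocity; congr tangential_proj.
apply/rowP => i; rewrite !mxE; congr (- _ + _).
pose f (y : borel_rV R d) : R := grad_on (diff_set D) K (x - nearest D y) 0 i.
have fE y : D y -> grad_on (diff_set D) K (x - y) 0 i = f y.
  by move=> Dy; rewrite /f nearest_id.
have rvN : rvD D (fun y : borel_rV R d => nearest D y).
  split; last by move=> y; have [] := nearestP y cD vD D0.
  by apply: measurable_continuous_rV; [exact: nearest_continuous|exact: measurable_id].
have [mf [M fM]] : bmeas f by apply: bmeas_coord; exact: (bvec_gK cD gKc rvN Dx).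
have bfY : bmeas (f \o Y).
  by split; [exact: measurableT_comp mf (measurable_funPT Y)|exists M => w; exact: fM].
have YD : Y @^-1` D = setT by apply/seteqP; split => // w _; exact: DY.
rewrite /Rintegral /Ex; congr fine.
under eq_integral => y /set_mem Dy do rewrite fE//.
rewrite (@integral_pushforward _ _ _ _ R Y _ P (D : set (borel_rV R d)) (EFin \o f))//.
- by rewrite YD; apply: eq_integral => w _ /=; rewrite -fE.
- exact/measurable_EFinP.
- by rewrite YD; exact: bmeas_integrable bfY.
- rewrite -(setCK D); apply: measurableC; apply: sub_sigma_algebra.
  by apply: closed_openC; exact: compact_closed_rV.
Qed.

End MeanFieldVelocity.

(** * Existence, uniqueness and contraction *)

Section VariationalUniqueness.
Context {R : realType} {d : nat} (D : set 'rV[R]_d) {disp : measure_display}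
  {T : measurableType disp} (P : probability T R).
Context (L C : R) (b : (T -> 'rV[R]_d) -> 'rV[R]_d -> 'rV[R]_d)
  (Hb : mean_field_drift D P L C b) (cD : compact D) (tau : R) (tau0 : 0 <= tau).
Implicit Types Y : R -> T -> 'rV[R]_d.

Definition variational_solution Y :=
  (forall t, 0 <= t -> t <= tau -> rvD D (Y t)) /\
  forall k, 0 < k -> exists2 h0, 0 < h0 &
    {ae P, forall w, approx_path D C b tau h0 k 0 Y w}.

Lemma approx_path_shorter h0 h1 k eps Y w : h1 <= h0 ->
  approx_path D C b tau h0 k eps Y w -> approx_path D C b tau h1 k eps Y w.
Proof. by move=> h01 a s t s0 st tt th; apply: a => //; exact: le_trans th h01. Qed.

Lemma variational_solution_pair Y Y' k : 0 < k ->
  variational_solution Y -> variational_solution Y' ->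
  exists2 h0, 0 < h0 & {ae P, forall w, approx_path D C b tau h0 k 0 Y w} /\
    {ae P, forall w, approx_path D C b tau h0 k 0 Y' w}.
Proof.
move=> k0 [_ /(_ _ k0)[h1 h10 a1]] [_ /(_ _ k0)[h2 h20 a2]].
exists (Num.min h1 h2); first by rewrite lt_min h10.
by split; [apply: filterS a1|apply: filterS a2] => w;
  apply: approx_path_shorter; rewrite ge_min lexx ?orbT.
Qed.

Lemma variational_solution_mean Y Y' t :
  variational_solution Y -> variational_solution Y' -> 0 <= t -> t <= tau ->
  Ex P (fun w => enorm (Y t w - Y' t w) ^+ 2) <=
    expR (2 * t * L) * Ex P (fun w => enorm (Y 0 w - Y' 0 w) ^+ 2).
Proof.
move=> sY sY' t0 tt; apply/ler_addgt0Pr => eta eta0.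
have [k k0 H] := mean_stability Hb cD tau0 eta0.
have [h0 h00 [aY aY']] := variational_solution_pair k0 sY sY'.
have [e e0 {}H] := H h0 h00.
exact: (H 0 (lexx _) (ltW e0) _ _ sY.1 sY'.1 aY aY').
Qed.

(** The mean estimate alone leaves an exceptional set depending on t. Used as equality of laws
    inside [path_stability], it bounds the distance by 1/(n+1) for all t at once, outside a null set
    depending only on n. *)
Lemma variational_solution_unique Y Y' :
  variational_solution Y -> variational_solution Y' ->
  {ae P, forall w, Y 0 w = Y' 0 w} ->
  {ae P, forall w, forall t, 0 <= t -> t <= tau -> Y t w = Y' t w}.
Proof.
move=> sY sY' Y0.
have E0 t : 0 <= t -> t <= tau -> Ex P (fun w => enorm (Y t w - Y' t w) ^+ 2) <= 0.
  move=> t0 tt; apply: le_trans (variational_solution_mean sY sY' t0 tt) _.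
  rewrite (@Ex_ae _ _ _ P _ (fun=> 0)) ?Ex_cst ?mulr0//.
  - by apply: (bmeas_dist cD); [apply: sY.1|apply: sY'.1].
  - exact: bmeas_cst.
  - by apply: filterS Y0 => w ->; rewrite subrr enorm0 expr0n.
have step n : {ae P, forall w, forall t, 0 <= t -> t <= tau ->
    enorm (Y t w - Y' t w) ^+ 2 <= n.+1%:R^-1}.
  have n0 : (0 : R) < n.+1%:R^-1 by rewrite invr_gt0.
  have [k k0 [rho rho0 H]] := path_stability Hb tau0 n0.
  have [h0 h00 [aY aY']] := variational_solution_pair k0 sY sY'.
  have [e e0 {}H] := H h0 h00.
  apply: filterS3 aY aY' Y0 => w aw aw' w0 t t0 tt.
  have small s : 0 <= s -> s <= tau -> Ex P (fun w => enorm (Y s w - Y' s w) ^+ 2) <= rho.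
    by move=> s0 st; exact: le_trans (E0 s s0 st) (ltW rho0).
  have := H 0 (lexx _) (ltW e0) _ _ sY.1 sY'.1 small w aw aw' t t0 tt.
  by rewrite w0 subrr enorm0 expr0n mulr0 add0r.
apply: filterS (ae_foralln step) => w hw t t0 tt.
apply/subr0_eq/dotp_eq0; rewrite -enorm_sqr; apply/le_anti; rewrite sqr_ge0 andbT.
apply/ler_addgt0Pr => e e0; rewrite add0r.
apply: le_trans (hw (Num.truncn e^-1) t t0 tt) _.
by rewrite -[leRHS]invrK lef_pV2 ?posrE ?invr_gt0//; apply: ltW; exact: truncnS_gt.
Qed.

End VariationalUniqueness.

Section MeanFieldEquation.
Context {R : realType} {d : nat} (D : set 'rV[R]_d) (K V : 'rV[R]_d -> R)
  (lamK lamV : R) (hA : assumption_A D K V lamK lamV).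
Context {disp : measure_display} {Omega : measurableType disp} (P : probability Omega R).
Implicit Type Y : R -> {RV P >-> borel_rV R d}.

Let gK := grad_on (diff_set D) K.
Let gV := grad_on D V.
Let L := - (Num.min 0 lamK + Num.min 0 lamV).

Lemma solution_variational C T (Y0 : {RV P >-> borel_rV R d}) Y : 0 < T ->
  mean_field_drift D P L C (drift gK gV P) -> solution D K V T Y0 Y ->
  variational_solution D P C (drift gK gV P) T (fun t w => Y t w) /\
  {ae P, forall w, Y 0 w = Y0 w}.
Proof.
move=> T0 Hb [DY _ iY eY].
have [[_ _ vD _ bD] _ _ _] := hA; have cD := assumption_A_compact hA.
have in0T t : 0 <= t -> t <= T -> t \in `[0, T] by move=> t0 tt; rewrite in_itv/= t0.
have rY t : 0 <= t -> t <= T -> rvD D (fun w => Y t w : 'rV[R]_d).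
  by move=> t0 tt; split => [|w]; [exact: measurable_funPT|apply: DY; exact: in0T].
have vE s w : s \in `[0, T] -> velocity D K V (distribution P (Y s)) (Y s w) =
    tangential_proj D (Y s w) (drift gK gV P (Y s) (Y s w)).
  by move=> sT; apply: (velocity_drift hA) => [w'|]; exact: DY.
split; last first.
  apply: filterS eY => w /(_ 0); rewrite in0T ?(ltW T0)// => /(_ isT) ->.
  apply/rowP => i; rewrite !mxE set_itv1 Rintegral_set1 addr0//.
split=> // k k0; apply: (solution_approx_path (Y0 := Y0) Hb cD vD bD rY k0).
apply: filterS2 iY eY => w iw ew; split => [i|t t0 tt].
  apply: eq_integrable (iw i) => // s; rewrite inE /= => sT.
  by rewrite vE.
rewrite ew ?in0T//; congr (_ + _); apply/rowP => i; rewrite !mxE.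
apply: eq_Rintegral => s; rewrite inE /= in_itv/= => /andP[s0 st].
by rewrite vE// in0T// (le_trans st).
Qed.

(** Carries the equation solved on the state space over to the sample space. *)
Lemma drift_distribution (Y0 : {RV P >-> borel_rV R d}) (f : borel_rV R d -> 'rV[R]_d) x :
  rvD D f -> D x ->
  drift gK gV (distribution P Y0) f x = drift gK gV P (fun w => f (Y0 w)) x.
Proof.
move=> rf Dx; apply/rowP => i; rewrite !mxE; congr (- _ - _).
have [_ _ [KC _] _] := hA; have [_ gKc _] := grad_onP KC.
have bf : bmeas (fun y : borel_rV R d => gK (x - f y) 0 i).
  exact: bmeas_coord (bvec_gK (assumption_A_compact hA) gKc rf Dx).
have [mf [M fM]] := bf.
rewrite /Ex /Rintegral; congr fine.
apply: (@integral_distribution _ _ _ _ _ P Y0 (fun y => (gK (x - f y) 0 i)%:E)).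
  exact/measurable_EFinP.
apply: (@bmeas_integrable _ _ _ P (fun w => gK (x - f (Y0 w)) 0 i)).
by split; [exact: measurableT_comp mf (measurable_funPT Y0)|exists M => w; exact: fM].
Qed.

Lemma exists_random_variable (f : Omega -> 'rV[R]_d) :
  measurable_fun setT (f : Omega -> borel_rV R d) ->
  exists Z : {RV P >-> borel_rV R d}, forall w, Z w = f w :> 'rV[R]_d.
Proof. by move=> mf; exists (mfun_Sub (mem_set mf)). Qed.

(* The equation is solved on the law of Y0 and composed with Y0: this makes
   the solution a measurable function of the initial datum. *)
Lemma solution_exists T (Y0 : {RV P >-> borel_rV R d}) : 0 < T -> (forall w, D (Y0 w)) ->
  exists Y, solution D K V T Y0 Y /\ forall t A, measurable A ->
    exists2 B : set (borel_rV R d), measurable B & Y t @^-1` A = Y0 @^-1` B.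
Proof.
move=> T0 DY0; have [[_ _ vD intD bD] _ _ _] := hA; have cD := assumption_A_compact hA.
have D0 : D !=set0 by have [x /interior_subset Dx] := intD; exists x.
have [C Hb] := mean_field_drift_gradient hA (distribution P Y0).
(* The initial datum on the state space should be the identity, but that is not D-valued everywhere;
   [nearest D] is, and it fixes every value of Y0. *)
have rvN : rvD D (fun y : borel_rV R d => nearest D y).
  split; last by move=> y; have [] := nearestP y cD vD D0.
  by apply: measurable_continuous_rV; [exact: nearest_continuous|exact: measurable_id].
have [F [rF F0 aF]] := variational_solution_exists Hb cD vD D0 rvN (ltW T0).
have cT t : 0 <= clamp T t <= T by exact/clamp_itv/ltW.
have rFc t : rvD D (F (clamp T t)) by have /andP[c0 c1] := cT t; exact: rF.
have /choice[Y YE] : forall t, exists Yt : {RV P >-> borel_rV R d},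
    forall w, Yt w = F (clamp T t) (Y0 w) :> 'rV[R]_d.
  move=> t; apply: exists_random_variable.
  exact: measurableT_comp (rFc t).1 (measurable_funPT Y0).
have YEt t w : 0 <= t -> t <= T -> Y t w = F t (Y0 w) :> 'rV[R]_d.
  by move=> t0 tt; rewrite YE clamp_id.
have DY t w : D (Y t w) by rewrite YE; exact: (rFc t).2.
have vE s w : 0 <= s -> s <= T -> velocity D K V (distribution P (Y s)) (Y s w) =
    tangential_proj D (F s (Y0 w)) (drift gK gV (distribution P Y0) (F s) (F s (Y0 w))).
  move=> s0 sT; rewrite (velocity_drift hA)// drift_distribution//.
  - have -> : (fun w => F s (Y0 w)) = (fun w => Y s w : 'rV[R]_d).
      by apply/funext => w'; rewrite YEt.
    by rewrite YEt.
  - exact: rF.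
  - exact: (rF s s0 sT).2.
exists Y; split; last first.
  move=> t A mA; exists (F (clamp T t) @^-1` A).
    by rewrite -[X in measurable X]setTI; exact: (rFc t).1.
  by apply/seteqP; split => w /=; rewrite YE.
have key x := variational_integral_equation Hb cD vD intD bD rF aF x T0.
split=> [t w _|w||].
- exact: DY.
- apply: continuous_subspaceT => t; have [h0 h00 a1] := aF 1 ltr01.
  have C0 := mfd_speed Hb.
  have lip s s' : s <= s' -> s' - s <= h0 ->
      enorm ((Y s' w : 'rV[R]_d) - Y s w) <= C * (s' - s).
    move=> ss' h; rewrite !YE; have /andP[c0 _] := cT s; have /andP[_ c1] := cT s'.
    have cd := clamp_dist T ss'.
    have [+ _] := a1 (Y0 w) _ _ c0 (clamp_le T ss') c1 (le_trans cd h).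
    by rewrite addr0 => /le_trans; apply; exact: ler_wpM2l.
  move=> A /nbhs_enormP[e e0 eA].
  have r0 : 0 < Num.min h0 (e / (C + 1)) by rewrite lt_min h00 divr_gt0// ltr_pwDr.
  apply/nbhs_ballP; exists (Num.min h0 (e / (C + 1))) => //= s.
  rewrite /ball /= lt_min => /andP[sh]; rewrite ltr_pdivlMr ?ltr_pwDr// => se.
  apply: eA; apply: le_lt_trans se; apply: (@le_trans _ _ (C * `|t - s|)); last first.
    by rewrite mulrC ler_wpM2l// lerDl.
  have [st|ts] := leP s t.
    rewrite enormB; have := sh; rewrite ger0_norm ?subr_ge0// => th.
    exact: lip _ _ st (ltW th).
  have := sh; rewrite distrC ger0_norm ?subr_ge0 ?(ltW ts)// => th.
  exact: lip _ _ (ltW ts) (ltW th).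
- apply: aeW => w i; apply: eq_integrable ((key (Y0 w)).1 i) => // s.
  by rewrite inE /= in_itv/= => /andP[s0 sT]; rewrite vE.
- apply: aeW => w t; rewrite in_itv/= => /andP[t0 tT].
  rewrite YEt// (key (Y0 w)).2// F0 nearest_id//; congr (_ + _).
  apply/rowP => i; rewrite !mxE; apply: eq_Rintegral => s.
  by rewrite inE /= in_itv/= => /andP[s0 st]; rewrite vE// (le_trans st).
Qed.

End MeanFieldEquation.

(** Multiply 1 - x <= e^(-x) by e^x. This turns the exponential of Gronwall into the factor of the
    theorem. *)
Lemma expR_le1Dx {R : realType} (x : R) : expR x <= 1 + x * expR x.
Proof.
have := ler_wpM2l (expR_ge0 x) (expR_ge1Dx (- x)).
by rewrite expRN divff ?gt_eqF ?expR_gt0// mulrDr mulr1 mulrN lerBlDr (mulrC x).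
Qed.

Theorem theorem3p4 (R : realType) (d : nat) (hd : (2 <= d)%N)
    (D : set 'rV[R]_d) (K V : 'rV[R]_d -> R) (lamK lamV : R)
    (hA : assumption_A D K V lamK lamV)
    (disp : measure_display) (Omega : measurableType disp)
    (P : probability Omega R) :
  (forall (Y0 : {RV P >-> borel_rV R d}) (B : R -> {RV P >-> borel_rV R d}),
     (forall w, D (Y0 w)) ->
     brownian_motion B ->
     independent_systems P (generated_by [set: unit] (fun=> Y0))
       (generated_by `[0, +oo[ (fun t => B t)) ->
     forall T : R, 0 < T ->
       exists Y : R -> {RV P >-> borel_rV R d},
         strong_solution D K V T Y0 B Y /\
         forall Y' : R -> {RV P >-> borel_rV R d},
           strong_solution D K V T Y0 B Y' ->
           {ae P, forall w, forall t, t \in `[0, T] -> Y' t w = Y t w}) /\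
  (forall (T : R) (Y01 Y02 : {RV P >-> borel_rV R d})
     (Y1 Y2 : R -> {RV P >-> borel_rV R d}),
     0 < T ->
     (forall w, D (Y01 w)) -> (forall w, D (Y02 w)) ->
     solution D K V T Y01 Y1 -> solution D K V T Y02 Y2 ->
     forall t, t \in `[0, T] ->
       let lam := Num.min 0 lamK + Num.min 0 lamV in
       ('E_P[(fun w => enorm ((Y1 t w : 'rV[R]_d) - (Y2 t w : 'rV[R]_d)) ^+ 2)%R]
        <= (1 - 2 * t * lam * expR (- (2 * t * lam)))%:E *
           'E_P[(fun w => enorm ((Y01 w : 'rV[R]_d) - (Y02 w : 'rV[R]_d)) ^+ 2)%R])%E).
Proof.
have cD := assumption_A_compact hA.
have [C Hb] := mean_field_drift_gradient hA P.
split=> [Y0 B DY0 _ _ T T0|T Y01 Y02 Y1 Y2 T0 D1 D2 sol1 sol2 t].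
  have [Y [sY Ymeas]] := solution_exists hA T0 DY0.
  exists Y; split.
    (* Each Y t is a Borel function of Y0, so its events already lie in the part of the filtration
       generated by Y0. *)
    split=> // t _ A /(Ymeas t)[A' mA' ->]; apply: sub_sigma_algebra; left; left.
    apply: sub_sigma_algebra; exists tt => //; exists A' => //.
    by rewrite setTI.
  move=> Y' [sY' _].
  have [v i0] := solution_variational hA T0 Hb sY.
  have [v' i0'] := solution_variational hA T0 Hb sY'.
  have := variational_solution_unique Hb cD (ltW T0) v' v.
  have e0 : {ae P, forall w, Y' 0 w = Y 0 w}.
    by apply: filterS2 i0 i0' => w -> ->.
  move=> /(_ e0); apply: filterS => w hw t; rewrite in_itv/= => /andP[t0 tT].
  exact: hw.
rewrite in_itv/= => /andP[t0 tT]; set lam := Num.min 0 lamK + Num.min 0 lamV.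
have [v1 i1] := solution_variational hA T0 Hb sol1.
have [v2 i2] := solution_variational hA T0 Hb sol2.
have b0 : bmeas (fun w => enorm ((Y01 w : 'rV[R]_d) - (Y02 w : 'rV[R]_d)) ^+ 2).
  by apply: (bmeas_dist cD); split => //; exact: measurable_funPT.
have bt s : 0 <= s -> s <= T ->
    bmeas (fun w => enorm ((Y1 s w : 'rV[R]_d) - (Y2 s w : 'rV[R]_d)) ^+ 2).
  by move=> s0 sT; apply: (bmeas_dist cD); [exact: v1.1|exact: v2.1].
rewrite (expectation_Ex P (bt t t0 tT)) (expectation_Ex P b0) -EFinM lee_fin.
apply: le_trans (variational_solution_mean Hb cD (ltW T0) v1 v2 t0 tT) _.
have <- : Ex P (fun w => enorm (Y1 0 w - Y2 0 w) ^+ 2) =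
    Ex P (fun w => enorm ((Y01 w : 'rV[R]_d) - (Y02 w : 'rV[R]_d)) ^+ 2).
  apply: Ex_ae b0 _; first exact: bt (lexx _) (ltW T0).
  by apply: filterS2 i1 i2 => w -> ->.
apply: ler_wpM2r; first by apply: Ex_ge0 => w; exact: sqr_ge0.
rewrite -/lam mulrN; set a := - (2 * t * lam).
rewrite (_ : 1 - _ = 1 + a * expR a); last by rewrite /a mulNr.
exact: expR_le1Dx.
Qed.
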